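(* Let $X_1,X_2,\dots$ be i.i.d. nonnegative random variables such that $\frac1n\sum_{j=1}^nX_j\to c$ almost surely as $n\to\infty$ for some $c\in(0,\infty)$, and let $\Sigma_k=X_1+\dots+X_k$ ($\Sigma_0=0$). Let $r>0$, $\alpha\in\mathbb R\setminus\{0\}$, and for each $n\in\mathbb N$ let $N_{r,\alpha,1/n^{\alpha}}$ have the generalized negative binomial distribution with parameters $r,\alpha,\mu=n^{-\alpha}$ and be independent of $X_1,X_2,\dots$. Then $$\lim_{n\to\infty}\sup_{x\ge0}\Big|\mathsf P\big(\Sigma_{N_{r,\alpha,1/n^{\alpha}}}<nx\big)-\int_0^x g^*(z;r,\alpha,c^{-\alpha})\,dz\Big|=0.$$ If, moreover, $r\in(0,1)$ and $\alpha\in(0,1)$, then the limit GG distribution is mixed exponential: $$G^*_{r,\alpha,c^{-\alpha}}\stackrel{d}{=}\frac{cW_1}{S_{\alpha,1}Z_{r,1}^{1/\alpha}}$$ with independent factors.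
   Context: The generalized gamma density is $g^*(x;r,\alpha,\lambda)=\frac{|\alpha|\lambda^r}{\Gamma(r)}x^{\alpha r-1}e^{-\lambda x^{\alpha}}$, $x\ge0$ ($r>0$, $\lambda>0$, $\alpha\ne0$); $G^*_{r,\alpha,\lambda}$ denotes a random variable with this density. $N_{r,\alpha,\mu}$ has the generalized negative binomial distribution: $\mathsf P(N_{r,\alpha,\mu}=k)=\frac1{k!}\int_0^\infty e^{-z}z^kg^*(z;r,\alpha,\mu)\,dz$, $k\ge0$. $W_1$ is standard exponential. $G_{s,1}$ is gamma with density $\frac1{\Gamma(s)}x^{s-1}e^{-x}$. For $0<\alpha<1$, $S_{\alpha,1}$ has characteristic function $\exp\{-|t|^{\alpha}\exp(-\tfrac12 i\pi\alpha\,\mathrm{sign}\,t)\}$. $Z_{r,1}=(G_{r,1}+G_{1-r,1})/G_{r,1}$ with independent gamma factors. A distribution is mixed exponential if it is the law of $W_1/V$ with $V>0$ independent of $W_1$. *)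

(* Defs.v *)
From HB Require Import structures.
From mathcomp Require Import all_boot all_order all_algebra.
From mathcomp Require Import all_classical all_reals all_analysis.
Set Implicit Arguments. Unset Strict Implicit. Unset Printing Implicit Defensive.
Import Order.TTheory GRing.Theory Num.Theory.
Import numFieldNormedType.Exports.
Local Open Scope classical_set_scope.
Local Open Scope ring_scope.

Definition gammaf (R : realType) (s : R) : R :=
  Rintegral lebesgue_measure `[0%R, +oo[%classic (fun x => x `^ (s - 1) * expR (- x)).

Definition gg_density (R : realType) (r a l : R) (x : R) : R :=
  if 0 < x then `|a| * l `^ r / gammaf r * x `^ (a * r - 1) * expR (- l * x `^ a)
  else 0.

Definition gamma_density (R : realType) (s : R) (x : R) : R :=
  if 0 < x then x `^ (s - 1) * expR (- x) / gammaf s else 0.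

Definition exp_density (R : realType) (x : R) : R :=
  if 0 <= x then expR (- x) else 0.

Definition has_density d (T : measurableType d) (R : realType)
  (P : probability T R) (Y : T -> R) (f : R -> R) : Prop :=
  forall B : set R, measurable B ->
    P (Y @^-1` B) = (\int[lebesgue_measure]_(x in B) (f x)%:E)%E.

Definition mutual_indep d (T : measurableType d) (R : realType)
  (P : probability T R) (I : eqType) (Y : I -> T -> R) : Prop :=
  forall (J : seq I) (B : I -> set R), uniq J -> (forall i, measurable (B i)) ->
    fine (P (\bigcap_(i in [set` J]) (Y i @^-1` B i))) =
    \prod_(i <- J) fine (P (Y i @^-1` B i)).

Definition fam_NX (T : Type) (R : realType) (N : T -> nat) (X : nat -> T -> R)
  : option nat -> T -> R :=
  fun i => match i with None => fun w => (N w)%:R | Some j => X j end.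

Definition fam4 (T : Type) (R : realType) (W S G1 G2 : T -> R) : 'I_4 -> T -> R :=
  fun i => match val i with 0 => W | 1 => S | 2 => G1 | _ => G2 end%N.

(* random sum Sigma_N = X_1 + ... + X_N (our X is indexed from 0) *)
Definition rsum (T : Type) (R : realType) (X : nat -> T -> R) (k : nat) (w : T) : R :=
  \sum_(j < k) X j w.

(* Main.v *)
(* Limit theorem.  Mixing Poisson laws against the GG density gives
   P(N < m) = \int Q_m(n z) g*(z; r, a, 1) dz, where Q_m(l) is the probability that a
   Poisson variable of mean l is < m, so N/n converges in law to the GG law with scale 1.
   By Egoroff, off a set of small probability Sigma_k lies between (c - d) k and (c + d) k
   for all k >= K, so {Sigma_N < n x} is squeezed between events {N < n y} with y close
   to x / c, up to the negligible event {N < K}.  Monotonicity and continuity of the limit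
   make the convergence uniform (Polya).

   Mixed exponential representation.  Integrating exp(-s t) cos(t (v + S)) in t shows that
   the characteristic function of S determines E[s / (s^2 + (v + S)^2)]; rotating the contour of the
   resulting integral by a right angle turns it into \int exp(-v t - t^a) sin(s t) dt <= s/v^2.
   Hence S puts no mass below 0, and s -> 0 gives
   E (v + S)^-2 = \int t exp(-v t) exp(-t^a) dt for all v > 0, so that E exp(-t S) = exp(-t^a)
   by uniqueness of Laplace transforms.  Integrating out W_1, then S, then the second gamma
   variable, the tail of c W_1 / (S Z^(1/a)) at x is, with y = (x / c)^a,
   E exp(-y Z) = exp(-y) E (1 + y / G_(r,1))^-(1 - r)
   = (1 / Gamma(r)) \int_y^oo u^(r-1) exp(-u) du, which is the tail of the GG law. *)
Require Import Defs.
From HB Require Import structures.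
From mathcomp Require Import all_boot all_order all_algebra.
From mathcomp Require Import all_classical all_reals all_analysis.
From mathcomp Require Import measurable_realfun.
From mathcomp Require Import ring lra.
Set Implicit Arguments. Unset Strict Implicit. Unset Printing Implicit Defensive.
Import Order.TTheory GRing.Theory Num.Theory.
Import numFieldNormedType.Exports.
Local Open Scope classical_set_scope.
Local Open Scope ring_scope.

Section integral_density.
Import HBNNSimple.

Lemma ge0_integral_density (d : measure_display) (T : measurableType d)
    (R : realType) (mu m : {measure set T -> \bar R}) (g : T -> R) :
  measurable_fun setT g -> (forall x, 0 <= g x) ->
  (forall A, measurable A -> m A = (\int[mu]_(x in A) (g x)%:E)%E) ->
  forall f : T -> \bar R, measurable_fun setT f -> (forall x, (0 <= f x)%E) ->
  (\int[m]_x f x = \int[mu]_x (f x * (g x)%:E))%E.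
Proof.
move=> mg g0 mE f mf f0.
pose h := nnsfun_approx measurableT mf.
have hf x : ((h n x)%:E @[n --> \oo] --> f x)%E by exact: cvg_nnsfun_approx.
have hnd x : {homo (fun n => h n x) : n k / (n <= k)%N >-> (n <= k)}.
  by move=> n k nk; exact/lefP/nd_nnsfun_approx.
have mEg : measurable_fun setT (fun x => (g x)%:E) by exact/measurable_EFinP.
transitivity (limn (fun n => (\int[m]_x (h n x)%:E)%E)).
  rewrite -monotone_convergence//.
  - by apply: eq_integral => x _; apply/esym/cvg_lim => //; exact: hf.
  - by move=> n; exact/measurable_EFinP/measurable_funP.
  - by move=> n x _; rewrite lee_fin.
  - by move=> x _ n k nk; rewrite lee_fin; exact: hnd.
transitivity (limn (fun n => (\int[mu]_x ((h n x)%:E * (g x)%:E))%E)); last first.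
  rewrite -monotone_convergence//.
  - apply: eq_integral => x _; apply/cvg_lim => //.
    by apply: cvgeZr => //; exact: hf.
  - move=> n; apply: emeasurable_funM => //.
    exact/measurable_EFinP/measurable_funP.
  - by move=> n x _; rewrite mule_ge0// lee_fin.
  - by move=> x _ n k nk; rewrite lee_wpmul2r ?lee_fin//; exact: hnd.
congr (limn _); apply/funext => n.
have ind0 y x : (0 <= (y * \1_(h n @^-1` [set y]) x)%:E)%E.
  exact: nnfun_muleindic_ge0.
have mind y : measurable_fun setT (fun x => (y * \1_(h n @^-1` [set y]) x)%:E).
  exact/measurable_EFinP/measurable_funM.
under eq_integral do rewrite fimfunE -fsumEFin//.
rewrite ge0_integral_fsum//.
under [RHS]eq_integral => x _.
  rewrite fimfunE -fsumEFin// ge0_mule_fsuml; last by move=> y; exact: ind0.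
  over.
rewrite ge0_integral_fsum//; last 2 first.
- by move=> y; exact: emeasurable_funM.
- by move=> y x _; rewrite mule_ge0// lee_fin.
apply: eq_fsbigr => y /set_mem[z _ yE].
have y0 : 0 <= y by rewrite -yE.
have my : measurable (h n @^-1` [set y]) by [].
under eq_integral do rewrite EFinM.
under [RHS]eq_integral do rewrite EFinM -muleA.
rewrite !ge0_integralZl//=.
- rewrite integral_indic// setIT mE// integral_mkcond; congr (_ * _)%E.
  by apply: eq_integral => x _; rewrite epatch_indic muleC.
- by apply: emeasurable_funM => //; exact/measurable_EFinP.
- by move=> x _; rewrite mule_ge0// lee_fin.
- exact/measurable_EFinP.
Qed.

End integral_density.

Definition image_measure {d d' : measure_display} {T : measurableType d}
    {T' : measurableType d'} {R : realType} (m : {measure set T -> \bar R})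
    (f : T -> T') (mf : measurable_fun setT f) : {measure set T' -> \bar R} :=
  measure_function_pushforward__canonical__measure_function_Measure m mf.

Lemma measurable_affine (R : realType) (k b : R) :
  measurable_fun setT (fun x : measurableTypeR R => k * x + b : measurableTypeR R).
Proof.
by apply: measurable_funD => //.
Qed.

Lemma lebesgue_measure_affine (R : realType) (k b : R) (A : set R) : 0 < k -> measurable A ->
  (lebesgue_measure A = k%:E * lebesgue_measure ((fun x => (k * x + b)%R) @^-1` A))%E.
Proof.
move=> k0 mA.
pose mu := mscale (NngNum (ltW k0))
  (image_measure lebesgue_measure (measurable_affine k b)).
suff E X : ocitv X -> lebesgue_measure X = mu X.
  exact: (lebesgue_measure_unique E mA).
move=> [[u v]] _ <-.
rewrite /mu /mscale/= /pushforward/=.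
have -> : (fun x => k * x + b) @^-1` `]u, v]%classic = `](u - b) / k, (v - b) / k]%classic.
  by apply/seteqP; split => x /=; rewrite !in_itv/= ltr_pdivrMr// ler_pdivlMr// ltrBlDr lerBrDr mulrC.
rewrite !lebesgue_measure_itv/= !lte_fin ltr_pM2r ?invr_gt0// ltrD2r.
case: ifPn => _; last by rewrite mule0.
rewrite -!EFinB -EFinM; congr EFin; field; lra.
Qed.

Lemma ge0_integral_affine (R : realType) (k b : R) (f : R -> \bar R) : 0 < k ->
  measurable_fun setT f -> (forall x, 0 <= f x)%E ->
  (\int[lebesgue_measure]_x f x =
   k%:E * \int[lebesgue_measure]_x f (k * x + b)%R)%E.
Proof.
move=> k0 mf f0.
rewrite -(ge0_integral_pushforward (measurable_affine k b) lebesgue_measure measurableT)//.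
rewrite -(@ge0_integral_mscale _ _ _ (image_measure lebesgue_measure (measurable_affine k b)) setT measurableT (NngNum (ltW k0)))//.
by apply: eq_measure_integral => A mA _; exact: lebesgue_measure_affine.
Qed.

Lemma cvg_Rintegral_itv0y (R : realType) (g : R -> R) :
  (@lebesgue_measure R).-integrable `[0, +oo[ (EFin \o g) ->
  \int[lebesgue_measure]_(x in `[0, n.+1%:R]) g x @[n --> \oo] -->
  (\int[lebesgue_measure]_(x in `[0, +oo[) g x : R).
Proof.
move=> ig.
have mg : measurable_fun (`[0, +oo[%classic : set (measurableTypeR R)) (EFin \o g).
  exact: measurable_int ig.
have m0y : measurable (`[0, +oo[%classic : set (measurableTypeR R)) by [].
apply: fine_cvg; rewrite fineK; last exact: integrable_fin_num.
pose f_ n : measurableTypeR R -> \bar R := (EFin \o g) \_ `[0, n.+1%:R].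
have f_E n : (\int[lebesgue_measure]_(x in `[0%R, n.+1%:R]) (g x)%:E =
    \int[lebesgue_measure]_(x in `[0%R, +oo[) f_ n x)%E.
  rewrite /f_ -integral_mkcondr setIidr//.
  by move=> x /=; rewrite !in_itv/= andbT => /andP[].
rewrite [X in X @ _ --> _](_ : _ = (fun n => \int[lebesgue_measure]_(x in `[0%R, +oo[) f_ n x)%E); last first.
  exact/funext.
apply: (@dominated_cvg _ _ _ _ _ m0y f_ (EFin \o g) (fun x => `|(g x)%:E|)%E).
- move=> n; apply/measurable_restrict => //.
  by apply: measurable_funS mg.
- move=> x; rewrite /= in_itv/= andbT => x0.
  apply: cvg_near_cst; near=> n; rewrite /f_ patchE ifT// inE/= in_itv/= x0/=.
  near: n; exists (Num.trunc x) => // n /= xn.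
  by rewrite (le_trans (ltW (truncnS_gt x)))// ler_nat ltnS.
- by [].
- exact: integrable_abse.
- move=> n x _; rewrite /f_ patchE; case: ifPn => // _.
  by rewrite abse0 abse_ge0.
Unshelve. all: end_near. Qed.

Lemma integral_expRNM (R : realType) (k : R) : 0 < k ->
  (\int[lebesgue_measure]_(t in `[0%R, +oo[) (expR (- (k * t)))%:E = (k^-1)%:E)%E.
Proof.
move=> k0.
have cE : continuous (fun t : R => expR (- (k * t))).
  move=> t; apply: continuous_comp; last exact: continuous_expR.
  by apply: cvgN; apply: cvgM; [exact: cvg_cst|exact: cvg_id].
pose G (t : R) := - (k^-1 * expR (- (k * t))).
have dG (t : R) : is_derive t 1 G (expR (- (k * t))).
  have D : is_derive t 1 (expR \o (fun t => - (k * t))) (expR (- (k * t)) * (- k)).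
    by apply: is_derive1_comp; apply: is_derive_eq; rewrite /GRing.scale/=; ring.
  have D2 : is_derive t 1 (fun t => expR (- (k * t))) (expR (- (k * t)) * (- k)) := D.
  by apply: is_derive_eq; rewrite /GRing.scale/=; field; rewrite gt_eqF.
rewrite (@ge0_continuous_FTC2y _ _ G 0 0)//.
- by rewrite /G mulr0 oppr0 expR0 mulr1 -EFinB sub0r opprK.
- exact/continuous_subspaceT.
- rewrite -oppr0 -(mulr0 k^-1); apply: cvgN; apply: cvgM; first exact: cvg_cst.
  apply: (@cvg_comp _ _ _ (fun t => k * t) (fun z => expR (- z)) _ (pinfty_nbhs R)); last exact: cvgr_expR.
  exact: gt0_cvgMry.
- apply: cvg_at_right_filter; apply: cvgN; apply: cvgM; first exact: cvg_cst.
  exact: cE.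
- by move=> x _; rewrite derive1E; apply: derive_val.
Qed.

Lemma integrable_expRNM (R : realType) (k : R) : 0 < k ->
  (@lebesgue_measure R).-integrable `[0, +oo[ (fun t => (expR (- (k * t)))%:E).
Proof.
move=> k0; apply/integrableP; split.
  apply/measurable_EFinP; apply: measurable_funTS; apply: measurableT_comp => //.
  by apply: measurableT_comp => //; exact: mulrl_measurable.
under eq_integral do rewrite gee0_abs ?lee_fin ?expR_ge0//.
by rewrite integral_expRNM// ltry.
Qed.

(** * Contour rotation *)

Lemma continuous_norm_powR (R : realType) (a : R) : 0 < a ->
  continuous (fun t : R => `|t| `^ a).
Proof.
move=> a0 t; have [->|t0] := eqVneq t 0.
  rewrite /continuous_at normr0 powR0 ?gt_eqF//.
  apply/cvgrPdist_lt => e e0; near=> x.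
  rewrite sub0r normrN ger0_norm ?powR_ge0//.
  have -> : e = (e `^ a^-1) `^ a by rewrite -powRrM mulVf ?gt_eqF// powRr1// ltW.
  rewrite gt0_ltr_powR// ?nnegrE ?powR_ge0//.
  near: x; exists (e `^ a^-1); first by rewrite /= powR_gt0.
  by move=> y /=; rewrite sub0r normrN.
apply: (@continuous_comp R R R (fun u => `|u|) (fun y => y `^ a)); first exact: norm_continuous.
apply: differentiable_continuous; apply/derivable1_diffP.
by apply: derivable_powR; rewrite in_itv/= andbT normr_gt0.
Unshelve. all: end_near. Qed.

Lemma is_derive_norm_powR (R : realType) (a t : R) : 0 < t ->
  is_derive t 1 (fun t : R => `|t| `^ a) (a * t `^ (a - 1)).
Proof.
move=> t0; apply: near_eq_is_derive (is_derive1_powR a t0).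
near=> x; rewrite ger0_norm//; near: x.
by apply: filterS (lt_nbhsr t0) => x /ltW.
Unshelve. all: end_near. Qed.

Lemma is_derive_expR_cos (R : realType) (A F : R -> R) (x dA dF : R) :
  is_derive x 1 A dA -> is_derive x 1 F dF ->
  is_derive x 1 (fun x => expR (- A x) * cos (F x))
    (- (expR (- A x) * (dF * sin (F x) + dA * cos (F x)))).
Proof.
move=> HA HF.
have He : is_derive x 1 (expR \o (fun x => - A x)) (expR (- A x) * (- dA)).
  exact: is_derive1_comp.
have Hc : is_derive x 1 (cos \o F) (- sin (F x) * dF) by exact: is_derive1_comp.
apply: (is_derive_eq (is_deriveM He Hc)).
by rewrite /= /GRing.scale/=; ring.
Qed.

Lemma is_derive_expR_sin (R : realType) (A F : R -> R) (x dA dF : R) :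
  is_derive x 1 A dA -> is_derive x 1 F dF ->
  is_derive x 1 (fun x => expR (- A x) * sin (F x))
    (expR (- A x) * (dF * cos (F x) - dA * sin (F x))).
Proof.
move=> HA HF.
have He : is_derive x 1 (expR \o (fun x => - A x)) (expR (- A x) * (- dA)).
  exact: is_derive1_comp.
have Hc : is_derive x 1 (sin \o F) (cos (F x) * dF) by exact: is_derive1_comp.
apply: (is_derive_eq (is_deriveM He Hc)).
by rewrite /= /GRing.scale/=; ring.
Qed.

Section rotation.
Variables (R : realType) (a s v : R).
Hypotheses (a0 : 0 < a) (a1 : a < 1) (s0 : 0 < s) (v0 : 0 < v).
Let mu := @lebesgue_measure R.
Let tau (t : R) := `|t| `^ a.
Let A (t x : R) := t * (s * cos x + v * sin x) + tau t * cos (a * (x - pi / 2)).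
Let F (t x : R) := x - t * (s * sin x - v * cos x) - tau t * sin (a * (x - pi / 2)).
Let dA (t x : R) := t * (v * cos x - s * sin x) - a * tau t * sin (a * (x - pi / 2)).
Let dF (t x : R) := 1 - t * (s * cos x + v * sin x) - a * tau t * cos (a * (x - pi / 2)).
(* [H t x] is the real part of e^(i x) exp (- (v + i s) u - u^a) on the ray
   u = t e^(i (x - pi / 2)); holomorphy of this function appears as dH/dx = - dK/dt. *)
Let H t x := expR (- A t x) * cos (F t x).
Let K t x := t * (expR (- A t x) * sin (F t x)).
Let h t x := expR (- A t x) * (dF t x * sin (F t x) + dA t x * cos (F t x)).

Let is_derive_shift (x : R) : is_derive x 1 (fun x : R => a * (x - pi / 2)) a.
Proof. by apply: is_derive_eq; rewrite /GRing.scale/=; ring. Qed.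

Let HA (t x : R) : is_derive x 1 (A t) (dA t x).
Proof.
have D1 : is_derive x 1 (cos \o (fun x : R => a * (x - pi / 2))) (- sin (a * (x - pi / 2)) * a).
  exact: is_derive1_comp.
by apply: is_derive_eq; rewrite /dA /GRing.scale/=; ring.
Qed.

Let HF (t x : R) : is_derive x 1 (F t) (dF t x).
Proof.
have D1 : is_derive x 1 (sin \o (fun x : R => a * (x - pi / 2))) (cos (a * (x - pi / 2)) * a).
  exact: is_derive1_comp.
by apply: is_derive_eq; rewrite /dF /GRing.scale/=; ring.
Qed.

Let HH (t x : R) : is_derive x 1 (H t) (- h t x).
Proof. exact: is_derive_expR_cos. Qed.

Let HAt (t x : R) : 0 < t -> is_derive t 1 (A ^~ x) ((1 - dF t x) / t).
Proof.
move=> t0; have D1 := is_derive_norm_powR a t0.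
apply: is_derive_eq; rewrite /dF /tau /GRing.scale/=.
by rewrite (gtr0_norm t0) -(mulr_powRB1 (ltW t0) a0); field; rewrite gt_eqF.
Qed.

Let HFt (t x : R) : 0 < t -> is_derive t 1 (F ^~ x) (dA t x / t).
Proof.
move=> t0; have D1 := is_derive_norm_powR a t0.
apply: is_derive_eq; rewrite /dA /tau /GRing.scale/=.
by rewrite (gtr0_norm t0) -(mulr_powRB1 (ltW t0) a0); field; rewrite gt_eqF.
Qed.

Let HK (t x : R) : 0 < t -> is_derive t 1 (K ^~ x) (h t x).
Proof.
move=> t0; have D1 := is_derive_expR_sin (HAt x t0) (HFt x t0).
apply: is_derive_eq; rewrite /h /GRing.scale/=; field; by rewrite gt_eqF.
Qed.

Let ctau : continuous tau. Proof. exact: continuous_norm_powR. Qed.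


Let cA x : continuous (A ^~ x).
Proof.
move=> t; apply: cvgD; apply: cvgM; try exact: cvg_cst.
  exact: cvg_id.
exact: ctau.
Qed.

Let cF x : continuous (F ^~ x).
Proof.
move=> t; apply: cvgB; first apply: cvgB; try exact: cvg_cst.
  by apply: cvgM; [exact: cvg_id|exact: cvg_cst].
by apply: cvgM; [exact: ctau|exact: cvg_cst].
Qed.

Let cE x : continuous (fun t => expR (- A t x)).
Proof.
by move=> t; apply: continuous_comp; [apply: cvgN; exact: cA|exact: continuous_expR].
Qed.

Let csF x : continuous (fun t => sin (F t x)).
Proof. by move=> t; apply: continuous_comp; [exact: cF|exact: continuous_sin]. Qed.

Let ccF x : continuous (fun t => cos (F t x)).
Proof. by move=> t; apply: continuous_comp; [exact: cF|exact: continuous_cos]. Qed.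

Let cH x : continuous (H ^~ x).
Proof. by move=> t; apply: cvgM; [exact: cE|exact: ccF]. Qed.

Let cK x : continuous (K ^~ x).
Proof.
by move=> t; apply: cvgM; [exact: cvg_id|apply: cvgM; [exact: cE|exact: csF]].
Qed.

Let ch x : continuous (h ^~ x).
Proof.
move=> t; apply: cvgM; first exact: cE.
apply: cvgD; apply: cvgM; [|exact: csF| |exact: ccF].
- apply: cvgB; first apply: cvgB; try exact: cvg_cst.
    by apply: cvgM; [exact: cvg_id|exact: cvg_cst].
  by apply: cvgM; [apply: cvgM; [exact: cvg_cst|exact: ctau]|exact: cvg_cst].
- apply: cvgB; first by apply: cvgM; [exact: cvg_id|exact: cvg_cst].
  by apply: cvgM; [apply: cvgM; [exact: cvg_cst|exact: ctau]|exact: cvg_cst].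
Qed.

Let integral_h (T x : R) : 0 < T -> \int[mu]_(t in `[0, T]) h t x = K T x.
Proof.
move=> T0; rewrite /Rintegral (continuous_FTC2 (F := K ^~ x) T0).
- by rewrite /= {2}/K mul0r subr0.
- exact/continuous_subspaceT/ch.
- split.
  + by move=> t; rewrite in_itv/= => /andP[t0 _]; apply: (@ex_derive _ _ _ _ _ _ _ (HK x t0)).
  + by apply: cvg_at_right_filter; exact: cK.
  + by apply: cvg_at_left_filter; exact: cK.
- move=> t; rewrite in_itv/= => /andP[t0 _].
  by rewrite derive1E; apply: derive_val; exact: HK.
Qed.

Let norm_trig (p q y : R) : `|p * sin y| + `|q * cos y| <= `|p| + `|q|.
Proof.
rewrite !normrM; apply: lerD; apply: ler_piMr => //; [exact: sin_max|exact: cos_max].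
Qed.

Let h_bound (T t x : R) : 0 <= t -> t <= T ->
  `|h t x| <= expR (T * (s + v) + tau T) * (1 + 2 * (T * (s + v) + tau T)).
Proof.
move=> t0 tT; have T0 := le_trans t0 tT.
have tauT : tau t <= tau T.
  by rewrite /tau !ger0_norm//; apply: ge0_ler_powR => //; rewrite ?nnegrE// ltW.
have tau0 : 0 <= tau t by exact: powR_ge0.
have b1 : `|t * (s * cos x + v * sin x)| <= T * (s + v).
  rewrite normrM ger0_norm//; apply: ler_pM => //.
  rewrite (le_trans (ler_normD _ _))// !normrM (gtr0_norm s0) (gtr0_norm v0); apply: lerD; apply: ler_piMr;
  rewrite ?(ltW s0) ?(ltW v0) ?sin_max ?cos_max//.
have b2 : `|t * (v * cos x - s * sin x)| <= T * (s + v).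
  rewrite normrM ger0_norm//; apply: ler_pM => //.
  rewrite (le_trans (ler_normB _ _))// !normrM (gtr0_norm s0) (gtr0_norm v0) addrC; apply: lerD; apply: ler_piMr;
  rewrite ?(ltW s0) ?(ltW v0) ?sin_max ?cos_max//.
have b3 y : `|y| <= 1 -> `|tau t * y| <= tau T.
  by move=> y1; rewrite normrM ger0_norm// (le_trans _ tauT)// ler_piMr.
have b4 y : `|y| <= 1 -> `|a * tau t * y| <= tau T.
  move=> y1; have -> : a * tau t * y = tau t * (a * y) by ring.
  by apply: b3; rewrite normrM (gtr0_norm a0) mulr_ile1 ?(ltW a1) ?(ltW a0).
have bA : `|A t x| <= T * (s + v) + tau T.
  by rewrite (le_trans (ler_normD _ _))// lerD// b3// cos_max.
have bdF : `|dF t x| <= 1 + (T * (s + v) + tau T).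
  rewrite /dF (le_trans (ler_normB _ _))// addrA lerD//; last by rewrite b4// cos_max.
  by rewrite (le_trans (ler_normB _ _))// normr1 lerD.
have bdA : `|dA t x| <= T * (s + v) + tau T.
  by rewrite (le_trans (ler_normB _ _))// lerD// b4// sin_max.
rewrite /h normrM ger0_norm ?expR_ge0//; apply: ler_pM => //.
  by rewrite ler_expR (le_trans _ bA)// -normrN ler_norm.
rewrite (le_trans (ler_normD _ _))// (le_trans (norm_trig _ _ _))//.
by rewrite (le_trans (lerD bdF bdA))//; lra.
Qed.

Let J T x := \int[mu]_(t in `[0, T]) H t x.

Let intH T x : mu.-integrable `[0, T] (EFin \o (H ^~ x)).
Proof.
apply: continuous_compact_integrable; first exact: segment_compact.
exact/continuous_subspaceT/cH.
Qed.

Let is_derive_J (T x : R) : 0 < T -> is_derive x 1 (J T) (- K T x).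
Proof.
move=> T0; pose f (x t : R) := H t x.
have mT : measurable (`[0, T]%classic : set (measurableTypeR R)) by [].
have Ix : `]x - 1, x + 1[%classic x by rewrite /= in_itv/=; apply/andP; split; lra.
have Hint y : `]x - 1, x + 1[%classic y -> mu.-integrable `[0, T] (EFin \o f y).
  by move=> _; exact: intH.
have Hder y t : `]x - 1, x + 1[%classic y -> `[0, T]%classic t -> derivable (f ^~ t) y 1.
  by move=> _ _; apply: (@ex_derive _ _ _ _ _ _ _ (HH t y)).
have d1f y t : partial1of2 f y t = - h t y.
  by rewrite /partial1of2 derive1E; apply: derive_val; exact: HH.
pose G := cst (expR (T * (s + v) + tau T) * (1 + 2 * (T * (s + v) + tau T))) : R -> R.
have G0 t : 0 <= G t.
  rewrite /G/= mulr_ge0 ?expR_ge0// addr_ge0// mulr_ge0// addr_ge0 ?powR_ge0//.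
  by rewrite mulr_ge0 ?addr_ge0// ltW.
have intG : mu.-integrable `[0, T] (EFin \o G).
  apply: continuous_compact_integrable; first exact: segment_compact.
  by apply: continuous_subspaceT => ?; exact: cvg_cst.
have Gub y t : `]x - 1, x + 1[%classic y -> `[0, T]%classic t -> `|partial1of2 f y t| <= G t.
  by move=> _; rewrite /= in_itv/= d1f normrN => /andP[t0 tT]; exact: h_bound.
apply: DeriveDef.
  exact: (derivable_under_integral mT Ix Hint Hder G0 intG Gub).
rewrite -derive1E (differentiation_under_integral mT Ix Hint Hder G0 intG Gub).
under eq_Rintegral do rewrite d1f.
rewrite -(integral_h x T0) -mulN1r -RintegralZl//; last first.
  apply: continuous_compact_integrable; first exact: segment_compact.
  exact/continuous_subspaceT/ch.
by apply: eq_Rintegral => t _; rewrite mulN1r.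
Qed.

Let m := Num.min s v.

Let K_bound (T x : R) : 0 < T -> 0 <= x -> x <= pi / 2 -> `|K T x| <= T * expR (- (T * m)).
Proof.
move=> T0 x0 x1; rewrite /K normrM gtr0_norm// ler_pM2l// normrM ger0_norm ?expR_ge0//.
rewrite (le_trans (ler_piMr _ (sin_max _))) ?expR_ge0// ler_expR lerN2.
have c0 : 0 <= cos x by apply: cos_ge0_pihalf; rewrite x1 andbT (le_trans _ x0)// lerNl oppr0 divr_ge0 ?pi_ge0.
have si0 : 0 <= sin x.
  by apply: sin_ge0_pi; rewrite x0/= (le_trans x1)// ler_pdivrMr// ler_peMr ?pi_ge0//; lra.
have m0 : 0 <= m by rewrite le_min !ltW.
have cs : 1 <= cos x + sin x.
  have h1 := cos2Dsin2 x; have h2 : 0 <= cos x * (1 - cos x) by rewrite mulr_ge0// subr_ge0 cos_le1.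
  have h3 : 0 <= sin x * (1 - sin x) by rewrite mulr_ge0// subr_ge0 sin_le1.
  by nra.
have ca : 0 <= cos (a * (x - pi / 2)).
  have p0 := pi_ge0 R; have h1 : 0 <= (1 - a) * (pi / 2 - x) by rewrite mulr_ge0// subr_ge0 ?(ltW a1).
  have h2 : 0 <= a * (pi / 2 - x) by rewrite mulr_ge0 ?(ltW a0)// subr_ge0.
  by apply: cos_ge0_pihalf; apply/andP; split; lra.
rewrite /A -[T * m]addr0; apply: lerD; last by rewrite mulr_ge0 ?powR_ge0.
rewrite ler_pM2l// (@le_trans _ _ (m * (cos x + sin x)))// ?ler_peMr//.
by rewrite mulrDr lerD// ler_wpM2r// /m ge_min lexx ?orbT.
Qed.

Let J_diff T : 0 < T -> `|J T (pi / 2) - J T 0| <= T * expR (- (T * m)) * (pi / 2).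
Proof.
move=> T0; have p0 : 0 < pi / 2 :> R by rewrite divr_gt0 ?pi_gt0.
have [x|x|x xI ->] := @MVT R (J T) (fun x => - K T x) 0 (pi / 2) p0.
- by move=> _; exact: is_derive_J.
- by apply: continuous_subspaceT => {}x; apply: differentiable_continuous;
  apply/derivable1_diffP; apply: (@ex_derive _ _ _ _ _ _ _ (is_derive_J x T0)).
rewrite subr0 normrM normrN (gtr0_norm p0) ler_pM2r//.
by move: xI; rewrite in_itv/= => /andP[/ltW ? /ltW ?]; exact: K_bound.
Qed.

Let m0 : 0 < m. Proof. by rewrite lt_min s0. Qed.

Let cvg_J_diff : J n.+1%:R (pi / 2) - J n.+1%:R 0 @[n --> \oo] --> 0.
Proof.
have p0 : 0 < pi / 2 :> R by rewrite divr_gt0 ?pi_gt0.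
apply: norm_cvg0.
apply: (@squeeze_cvgr _ _ _ _ (cst 0) (fun n => 4 / m ^+ 2 * (pi / 2) * harmonic n)).
- apply: nearW => n /=; rewrite normr_ge0/= (le_trans (J_diff _))//.
  rewrite [leRHS]mulrAC ler_pM2r// expRN /harmonic/=.
  have T0 : 0 < n.+1%:R :> R by [].
  have e1 : (n.+1%:R * m) ^+ 2 / 4 <= expR (n.+1%:R * m).
    have -> : expR (n.+1%:R * m) = expR (n.+1%:R * m / 2) ^+ 2.
      by rewrite -expRM_natl; congr expR; field.
    have -> : (n.+1%:R * m) ^+ 2 / 4 = (n.+1%:R * m / 2) ^+ 2 by field.
    rewrite ler_sqr ?nnegrE ?expR_ge0//; last by rewrite divr_ge0// mulr_ge0// ltW.
    by rewrite (le_trans _ (expR_ge1Dx _))// lerDr.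
  have -> : 4 / m ^+ 2 / n.+1%:R = n.+1%:R * ((n.+1%:R * m) ^+ 2 / 4)^-1.
    by field; rewrite gt_eqF//= gt_eqF.
  rewrite ler_pM2l// lef_pV2 ?posrE ?expR_gt0//.
  by rewrite divr_gt0// exprn_gt0// mulr_gt0.
- exact: cvg_cst.
- rewrite -(mulr0 (4 / m ^+ 2 * (pi / 2))); apply: cvgM; first exact: cvg_cst.
  exact: cvg_harmonic.
Qed.

Let HE0 t : 0 <= t -> H t 0 = expR (- (s * t)) *
  (expR (- (t `^ a * cos (pi * a / 2))) * cos (t * v + t `^ a * sin (pi * a / 2))).
Proof.
move=> t0; rewrite /H /A /F /tau ger0_norm// cos0 sin0 !mulr0 mulr1 addr0 !sub0r mulr1.
rewrite mulrN cosN sinN !mulrN !opprK mulrA -expRD -opprD mulrA [a * pi]mulrC.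
by rewrite [t * s]mulrC.
Qed.

Let HEpi t : 0 <= t -> H t (pi / 2) = expR (- (v * t)) * expR (- (t `^ a)) * sin (t * s).
Proof.
move=> t0; rewrite /H /A /F /tau ger0_norm// cos_pihalf sin_pihalf subrr !mulr0 cos0 sin0.
rewrite add0r !mulr1 mulr0 !subr0 cosB cos_pihalf sin_pihalf mul0r mul1r add0r.
by rewrite -expRD -opprD [t * v]mulrC.
Qed.

Let integrable_H x k : 0 < k -> (forall t, 0 <= t -> `|H t x| <= expR (- (k * t))) ->
  mu.-integrable `[0, +oo[ (EFin \o (H ^~ x)).
Proof.
move=> k0 Hk; apply: le_integrable (integrable_expRNM k0) => //.
- apply: measurable_funTS; apply/measurable_EFinP; exact: continuous_measurable_fun.
- move=> t; rewrite /= in_itv/= andbT => t0.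
  by rewrite lee_fin (ger0_norm (expR_ge0 _)) Hk.
Qed.

Lemma rotate_contour :
  \int[lebesgue_measure]_(t in `[0, +oo[) (expR (- (s * t)) *
    (expR (- (t `^ a * cos (pi * a / 2))) * cos (t * v + t `^ a * sin (pi * a / 2)))) =
  \int[lebesgue_measure]_(t in `[0, +oo[)
    (expR (- (v * t)) * expR (- (t `^ a)) * sin (t * s)).
Proof.
have c0 : 0 <= cos (pi * a / 2).
  have p0 := pi_ge0 R; have h1 : 0 <= pi * a by rewrite mulr_ge0// ltW.
  have h2 : 0 <= pi * (1 - a) by rewrite mulr_ge0// subr_ge0 ltW.
  by apply: cos_ge0_pihalf; apply/andP; split; lra.
have i0 : mu.-integrable `[0, +oo[ (EFin \o (H ^~ 0)).
  apply: (integrable_H s0) => t t0; rewrite HE0// normrM ger0_norm ?expR_ge0//.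
  rewrite ler_piMr ?expR_ge0// normrM mulr_ile1 ?cos_max// ger0_norm ?expR_ge0//.
  by rewrite expR_le1 oppr_le0 mulr_ge0 ?powR_ge0.
have ipi : mu.-integrable `[0, +oo[ (EFin \o (H ^~ (pi / 2))).
  apply: (integrable_H v0) => t t0; rewrite HEpi// -mulrA normrM ger0_norm ?expR_ge0//.
  rewrite ler_piMr ?expR_ge0// normrM mulr_ile1 ?sin_max// ger0_norm ?expR_ge0//.
  by rewrite expR_le1 oppr_le0 powR_ge0.
transitivity (\int[mu]_(t in `[0, +oo[) H t 0).
  by apply: eq_Rintegral => t; rewrite inE/= in_itv/= andbT => t0; rewrite HE0.
transitivity (\int[mu]_(t in `[0, +oo[) H t (pi / 2)); last first.
  by apply: eq_Rintegral => t; rewrite inE/= in_itv/= andbT => t0; rewrite HEpi.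
apply/esym/eqP; rewrite -subr_eq0; apply/eqP.
have E : J n.+1%:R (pi / 2) - J n.+1%:R 0 @[n --> \oo] -->
    (\int[mu]_(t in `[0, +oo[) H t (pi / 2) - \int[mu]_(t in `[0, +oo[) H t 0 : R).
  by apply: cvgB; exact: cvg_Rintegral_itv0y.
rewrite -[LHS](cvg_lim _ E)//.
by apply/cvg_lim => //; exact: cvg_J_diff.
Qed.

End rotation.

Lemma mul_expRN_le (R : realType) (k t : R) : 0 < k -> 0 < t ->
  t * expR (- (k * t)) <= 4 / k ^+ 2 / t.
Proof.
move=> k0 t0; have kt0 : 0 < k * t by rewrite mulr_gt0.
have e1 : (k * t / 2) ^+ 2 <= expR (k * t).
  have -> : expR (k * t) = expR (k * t / 2) ^+ 2.
    by rewrite -expRM_natl; congr expR; field.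
  rewrite ler_sqr ?nnegrE ?expR_ge0//; last by rewrite divr_ge0// ltW.
  by rewrite (le_trans _ (expR_ge1Dx _))// lerDr.
have -> : 4 / k ^+ 2 / t = t * ((k * t / 2) ^+ 2)^-1.
  by field; rewrite !gt_eqF.
rewrite ler_pM2l// expRN lef_pV2 ?posrE ?expR_gt0//.
by rewrite exprn_gt0// divr_gt0.
Qed.

Lemma cvgy_mul_expRN (R : realType) (k : R) : 0 < k ->
  t * expR (- (k * t)) @[t --> +oo] --> (0 : R).
Proof.
move=> k0; apply: (@squeeze_cvgr _ _ _ _ (cst 0) (fun t => 4 / k ^+ 2 * t^-1)).
- near=> t; have t0 : 0 < t by [].
  by rewrite mul_expRN_le// andbT mulr_ge0 ?expR_ge0// ltW.
- exact: cvg_cst.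
- rewrite -(mulr0 (4 / k ^+ 2)); apply: cvgM; first exact: cvg_cst.
  apply/gtr0_cvgV0; last exact: cvg_id.
  by near=> t.
Unshelve. all: end_near. Qed.

Lemma integral_mul_expRN (R : realType) (k : R) : 0 < k ->
  (\int[lebesgue_measure]_(t in `[0%R, +oo[) (t * expR (- (k * t)))%:E = (k ^- 2)%:E)%E.
Proof.
move=> k0.
have cE : continuous (fun t : R => expR (- (k * t))).
  move=> t; apply: continuous_comp; last exact: continuous_expR.
  by apply: cvgN; apply: cvgM; [exact: cvg_cst|exact: cvg_id].
pose G (t : R) := - (k^-1 * (t * expR (- (k * t))) + k ^- 2 * expR (- (k * t))).
have dG (t : R) : is_derive t 1 G (t * expR (- (k * t))).
  have D : is_derive t 1 (expR \o (fun t => - (k * t))) (expR (- (k * t)) * (- k)).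
    by apply: is_derive1_comp; apply: is_derive_eq; rewrite /GRing.scale/=; ring.
  have D2 : is_derive t 1 (fun t => expR (- (k * t))) (expR (- (k * t)) * (- k)) := D.
  by apply: is_derive_eq; rewrite /GRing.scale/=; field; rewrite gt_eqF.
rewrite (@ge0_continuous_FTC2y _ _ G 0 0)//.
- by rewrite /G mul0r !mulr0 oppr0 expR0 mulr1 -EFinB; congr EFin; ring.
- by move=> x x0; rewrite mulr_ge0 ?expR_ge0.
- by apply: continuous_subspaceT => t; apply: cvgM; [exact: cvg_id|exact: cE].
- rewrite -oppr0 -[X in _ --> - X]addr0 -[X in _ --> - (X + _)](mulr0 k^-1)
    -[X in _ --> - (_ + X)](mulr0 (k ^- 2)).
  apply: cvgN; apply: cvgD; apply: cvgM; try exact: cvg_cst; first exact: cvgy_mul_expRN.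
  apply: (@cvg_comp _ _ _ (fun t => k * t) (fun z => expR (- z)) _ (pinfty_nbhs R)); last exact: cvgr_expR.
  exact: gt0_cvgMry.
- apply: cvg_at_right_filter; apply: cvgN; apply: cvgD; apply: cvgM; try exact: cvg_cst; try exact: cE.
  by apply: cvgM; [exact: cvg_id|exact: cE].
- by move=> x _; rewrite derive1E; apply: derive_val.
Qed.

Lemma integrable_expRNM_bounded (R : realType) (k : R) (g : R -> R) : 0 < k ->
  measurable_fun setT g -> (forall t, 0 <= t -> `|g t| <= 1) ->
  (@lebesgue_measure R).-integrable `[0, +oo[
    (fun t => (expR (- (k * t)) * g t)%:E).
Proof.
move=> k0 mg g1; apply: le_integrable (integrable_expRNM k0) => //.
- apply: measurable_funTS; apply/measurable_EFinP; apply: measurable_funM => //.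
  by apply: measurableT_comp => //; apply: measurableT_comp => //; exact: mulrl_measurable.
- move=> t; rewrite /= in_itv/= andbT => t0.
  rewrite lee_fin normrM ler_piMr//; exact: g1.
Qed.

Lemma Rintegral_expRN_cos (R : realType) (s x : R) : 0 < s ->
  \int[lebesgue_measure]_(t in `[0, +oo[) (expR (- (s * t)) * cos (t * x)) =
  s / (s ^+ 2 + x ^+ 2).
Proof.
move=> s0.
have D0 : 0 < s ^+ 2 + x ^+ 2 by rewrite ltr_wpDr ?sqr_ge0// exprn_gt0.
have cE : continuous (fun t : R => expR (- (s * t))).
  move=> t; apply: continuous_comp; last exact: continuous_expR.
  by apply: cvgN; apply: cvgM; [exact: cvg_cst|exact: cvg_id].
have cx : continuous (fun t : R => t * x).
  by move=> t; apply: cvgM; [exact: cvg_id|exact: cvg_cst].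
have cC : continuous (fun t : R => cos (t * x)).
  by move=> t; apply: continuous_comp; [exact: cx|exact: continuous_cos].
have cS : continuous (fun t : R => sin (t * x)).
  by move=> t; apply: continuous_comp; [exact: cx|exact: continuous_sin].
pose G (t : R) := (s ^+ 2 + x ^+ 2)^-1 *
  (x * (expR (- (s * t)) * sin (t * x)) - s * (expR (- (s * t)) * cos (t * x))).
have cG : continuous G.
  move=> t; apply: cvgM; first exact: cvg_cst.
  by apply: cvgB; (apply: cvgM; first exact: cvg_cst); apply: cvgM; [exact: cE|exact: cS|exact: cE|exact: cC].
have dG (t : R) : is_derive t 1 G (expR (- (s * t)) * cos (t * x)).
  have d1 : is_derive t 1 (fun t => s * t) s.
    by apply: is_derive_eq; rewrite /GRing.scale/=; ring.
  have d2 : is_derive t 1 (fun t => t * x) x.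
    by apply: is_derive_eq; rewrite /GRing.scale/=; ring.
  have D1 := is_derive_expR_cos d1 d2.
  have D2 := is_derive_expR_sin d1 d2.
  by apply: is_derive_eq; rewrite /GRing.scale/=; field; rewrite gt_eqF.
have int : (@lebesgue_measure R).-integrable `[0, +oo[
    (EFin \o (fun t => expR (- (s * t)) * cos (t * x))).
  apply: integrable_expRNM_bounded => //.
    by apply: continuous_measurable_fun.
  by move=> t _; exact: cos_max.
have E n : \int[lebesgue_measure]_(t in `[0, n.+1%:R]) (expR (- (s * t)) * cos (t * x)) =
    G n.+1%:R - G 0.
  rewrite /Rintegral (continuous_FTC2 (F := G)) ?ltr0n//.
  - by apply: continuous_subspaceT => t; apply: cvgM; [exact: cE|exact: cC].
  - split.
    + by move=> t _; apply: (@ex_derive _ _ _ _ _ _ _ (dG t)).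
    + by apply: cvg_at_right_filter; exact: cG.
    + by apply: cvg_at_left_filter; exact: cG.
  - by move=> t _; rewrite derive1E; apply: derive_val.
have := cvg_Rintegral_itv0y int; under eq_fun do rewrite E.
move=> /cvg_lim <- //; apply/cvg_lim => //.
have -> : s / (s ^+ 2 + x ^+ 2) = 0 - G 0.
  rewrite /G mulr0 oppr0 mul0r expR0 sin0 cos0; field; by rewrite gt_eqF.
apply: cvgB; last exact: cvg_cst.
apply: norm_cvg0.
apply: (@squeeze_cvgr _ _ _ _ (cst 0) (fun n => (s ^+ 2 + x ^+ 2)^-1 * ((`|x| + s) * (s^-1 * harmonic n)))).
- apply: nearW => n /=; rewrite normr_ge0/= /G normrM gtr0_norm ?invr_gt0//.
  rewrite ler_pM2l ?invr_gt0// (le_trans (ler_normB _ _))// mulrDl.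
  have b : expR (- (s * n.+1%:R)) <= s^-1 * harmonic n.
    rewrite /harmonic/= -invfM expRN lef_pV2 ?posrE ?expR_gt0//; last by rewrite mulr_gt0.
    by rewrite (le_trans _ (expR_ge1Dx _))// lerDr.
  apply: lerD; rewrite normrM ?(gtr0_norm s0); apply: ler_wpM2l => //.
  + by rewrite normrM ger0_norm ?expR_ge0// (le_trans _ b)// ler_piMr ?expR_ge0// sin_max.
  + exact: ltW.
  + by rewrite normrM ger0_norm ?expR_ge0// (le_trans _ b)// ler_piMr ?expR_ge0// cos_max.
- exact: cvg_cst.
- rewrite -(mulr0 (s ^+ 2 + x ^+ 2)^-1) -(mulr0 (`|x| + s)) -(mulr0 s^-1).
  do 3 (apply: cvgM; first exact: cvg_cst).
  exact: cvg_harmonic.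
Qed.

(** * The one-sided stable law *)

Lemma measurable_cos (R : realType) : measurable_fun setT (@cos R).
Proof. by apply: continuous_measurable_fun; exact: continuous_cos. Qed.

Lemma measurable_sin (R : realType) : measurable_fun setT (@sin R).
Proof. by apply: continuous_measurable_fun; exact: continuous_sin. Qed.

Lemma integrable_norm_le (d : measure_display) (T : measurableType d) (R : realType)
    (P : probability T R) (X : T -> R) (M : R) :
  measurable_fun setT X -> (forall w, `|X w| <= M) ->
  P.-integrable setT (EFin \o X).
Proof.
move=> mX XM.
have iM := finite_measure_integrable_cst P M measurableT.
apply: (le_integrable _ _ _ iM); [exact: measurableT|exact/measurable_EFinP|].
by move=> w _; rewrite /= lee_fin (le_trans (XM w))// ler_norm.
Qed.

Section stable.
Context {d : measure_display} {T : measurableType d} {R : realType}.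
Variables (P : probability T R) (S : T -> R) (a : R).
Hypotheses (mS : measurable_fun setT S) (a0 : 0 < a) (a1 : a < 1).
Hypothesis char_fun : forall t : R,
  (\int[P]_w (cos (t * S w))%:E)%E =
    (expR (- (`|t| `^ a * cos (pi * a / 2)))
     * cos (`|t| `^ a * Num.sg t * sin (pi * a / 2)))%:E /\
  (\int[P]_w (sin (t * S w))%:E)%E =
    (expR (- (`|t| `^ a * cos (pi * a / 2)))
     * sin (`|t| `^ a * Num.sg t * sin (pi * a / 2)))%:E.

Let mcos (t : R) : measurable_fun setT (fun w => cos (t * S w)).
Proof.
apply: measurableT_comp; first exact: measurable_cos.
exact: measurable_funM.
Qed.

Let msin (t : R) : measurable_fun setT (fun w => sin (t * S w)).
Proof.
apply: measurableT_comp; first exact: measurable_sin.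
exact: measurable_funM.
Qed.

Lemma char_fun_shift (v t : R) : 0 <= t ->
  (\int[P]_w (cos (t * (v + S w)))%:E =
   (expR (- (t `^ a * cos (pi * a / 2))) * cos (t * v + t `^ a * sin (pi * a / 2)))%:E)%E.
Proof.
move=> t0; have [hc hs] := char_fun t.
have -> : t `^ a * sin (pi * a / 2) = `|t| `^ a * Num.sg t * sin (pi * a / 2).
  have [->|tn0] := eqVneq t 0; first by rewrite normr0 powR0 ?gt_eqF// !mul0r.
  by rewrite gtr0_sg ?lt_def ?tn0// mulr1 ger0_norm.
under eq_integral do rewrite mulrDr cosD EFinB !EFinM.
have ic := integrable_norm_le P (mcos t) (fun=> cos_max _).
have is_ := integrable_norm_le P (msin t) (fun=> sin_max _).
rewrite integralB//=; [|exact: integrableZl..].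
rewrite !integralZl// hc hs (ger0_norm t0) -!EFinM -EFinB cosD; congr EFin; ring.
Qed.

Let mu := @lebesgue_measure R.
Let kernel (s v : R) (z : measurableTypeR R * T) : \bar R :=
  (((fun t => expR (- (s * t))) \_ `[0, +oo[) z.1 * cos (z.1 * (v + S z.2)))%:E.

Let mkernel s v : measurable_fun setT (kernel s v).
Proof.
apply/measurable_EFinP; apply: measurable_funM.
  apply: (@measurableT_comp _ _ _ _ _ _ (((fun t => expR (- (s * t))) \_ `[0, +oo[) : measurableTypeR R -> R)) => //.
  apply/measurable_restrict => //; apply: measurable_funTS.
  by apply: measurableT_comp => //; apply: measurableT_comp => //; exact: mulrl_measurable.
apply: measurableT_comp; first exact: measurable_cos.
apply: measurable_funM; first exact: measurable_fst.
by apply: measurable_funD => //; exact: measurableT_comp.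
Qed.

Let ikernel s v : 0 < s -> (mu \x P)%E.-integrable setT (kernel s v).
Proof.
move=> s0; apply/integrable12ltyP; first exact: mkernel.
apply: (@le_lt_trans _ _ (\int[mu]_(t in `[0%R, +oo[) (expR (- (s * t)))%:E)%E); last first.
  by rewrite integral_expRNM// ltry.
rewrite [leRHS]integral_mkcond; apply: ge0_le_integral => //.
- by move=> t _; apply: integral_ge0.
- have mk : measurable_fun setT (fun z => `|kernel s v z|)%E.
    by apply: measurableT_comp => //; exact: mkernel.
  exact: (measurable_fun_fubini_tonelli_F (m2 := P) _ mk (fun=> abse_ge0 _)).
- apply/measurable_restrict => //; apply/measurable_funTS/measurable_EFinP.
  by apply: measurableT_comp => //; apply: measurableT_comp => //; exact: mulrl_measurable.
move=> t _.
have mkt : measurable_fun setT (fun w => `|kernel s v (t, w)|)%E.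
  have mk : measurable_fun setT (fun w => kernel s v (t, w)).
    rewrite /kernel/=; apply/measurable_EFinP; apply: measurable_funM => //.
    apply: measurableT_comp; first exact: measurable_cos.
    by apply: measurable_funM => //; exact: measurable_funD.
  exact: measurableT_comp.
apply: (@le_trans _ _ (\int[P]_w (((fun t => expR (- (s * t))) \_ `[0, +oo[) t)%:E)%E).
  apply: ge0_le_integral => //.
    move=> w _; rewrite /kernel/= lee_fin normrM ger0_norm; last first.
      by rewrite patchE; case: ifPn => // _; exact: expR_ge0.
    rewrite ler_piMr ?cos_max// patchE; case: ifPn => // _; exact: expR_ge0.
rewrite integral_cst// [X in (_ * X)%E](_ : _ = 1%E); last exact: probability_setT.
by rewrite mule1 !patchE; case: ifPn.
Qed.

Lemma expectation_poisson (s v : R) : 0 < s -> 0 < v ->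
  (\int[P]_w (s / (s ^+ 2 + (v + S w) ^+ 2))%:E =
  (\int[lebesgue_measure]_(t in `[0, +oo[)
    (expR (- (v * t)) * expR (- (t `^ a)) * sin (t * s)))%:E)%E.
Proof.
move=> s0 v0; rewrite -rotate_contour//.
have mexp : measurable_fun setT (fun t : R => expR (- (s * t))).
  by apply: measurableT_comp => //; apply: measurableT_comp => //; exact: mulrl_measurable.
have mpw : measurable_fun setT (fun t : R => t `^ a) by exact: measurable_powR.
have icos x : mu.-integrable `[0, +oo[ (fun t => (expR (- (s * t)) * cos (t * x))%:E).
  apply: integrable_expRNM_bounded => //; last by move=> t _; exact: cos_max.
  by apply: measurableT_comp; [exact: measurable_cos|exact: measurable_funM].
have c0 : 0 <= cos (pi * a / 2).
  have p0 := pi_ge0 R; have h1 : 0 <= pi * a by rewrite mulr_ge0// ltW.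
  have h2 : 0 <= pi * (1 - a) by rewrite mulr_ge0// subr_ge0 ltW.
  by apply: cos_ge0_pihalf; apply/andP; split; lra.
transitivity (\int[P]_w \int[mu]_t kernel s v (t, w))%E.
  apply: eq_integral => w _; rewrite -(Rintegral_expRN_cos (v + S w) s0).
  rewrite /Rintegral fineK; last by apply: integrable_fin_num => //; exact: icos.
  rewrite integral_mkcond; apply: eq_integral => t _.
  by rewrite /kernel/= !patchE; case: ifPn => // _; rewrite mul0r.
rewrite -(Fubini (ikernel v s0)) /Rintegral fineK; last first.
  apply: integrable_fin_num => //; apply: integrable_expRNM_bounded => //.
    apply: measurable_funM.
      by apply: measurableT_comp => //; apply: measurableT_comp => //; exact: measurable_funM.
    apply: measurableT_comp; first exact: measurable_cos.
    by apply: measurable_funD; exact: measurable_funM.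
  move=> t t0; rewrite normrM mulr_ile1 ?cos_max// ger0_norm ?expR_ge0//.
  by rewrite expR_le1 oppr_le0 mulr_ge0 ?powR_ge0.
rewrite [RHS]integral_mkcond; apply: eq_integral => t _; rewrite patchE.
case: ifPn => [|tn]; last first.
  by apply: integral0_eq => w _; rewrite /kernel/= patchE (negbTE tn) mul0r.
rewrite inE/= in_itv/= andbT => t0; rewrite /kernel/= patchE mem_set/=; last by rewrite in_itv/= t0.
under eq_integral do rewrite EFinM.
rewrite integralZl//; last first.
  apply: (@integrable_norm_le _ _ _ _ _ 1); last by move=> w; exact: cos_max.
  apply: measurableT_comp; first exact: measurable_cos.
  by apply: measurable_funM => //; exact: measurable_funD.
by rewrite char_fun_shift// -EFinM.
Qed.
End stable.

(** * Uniqueness of Laplace transforms *)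

Lemma bernoulli_inequality (R : realFieldType) (n : nat) (x : R) : 0 <= x ->
  1 + n%:R * x <= (x + 1) ^+ n.
Proof.
move=> x0; elim: n => [|n IH]; first by rewrite mul0r addr0.
rewrite exprSr -natr1.
have n0 : 0 <= n%:R * x * x by rewrite !mulr_ge0.
have := ler_wpM2r (addr_ge0 x0 ler01) IH; apply: le_trans; lra.
Qed.

Lemma geometric_domination (R : realType) (A B C M : R) :
  0 < B -> B < A -> 0 < C -> ~ (forall n, A ^+ n * C <= B ^+ n * M).
Proof.
move=> B0 BA C0 H.
have AB : 0 < A / B - 1 by rewrite subr_gt0 ltr_pdivlMr// mul1r.
pose m := Num.truncn (M / C / (A / B - 1)).
have : M / C < (A / B) ^+ m.+1.
  apply: (@lt_le_trans _ _ (1 + m.+1%:R * (A / B - 1))); last first.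
    by have := bernoulli_inequality m.+1 (ltW AB); rewrite subrK.
  rewrite -ltrBlDl -ltr_pdivrMr// (le_lt_trans _ (truncnS_gt _))//.
  by rewrite ler_wpM2r ?invr_ge0 ?(ltW AB)// gerBl.
apply/negP; rewrite -leNgt expr_div_n ler_pdivlMr// mulrAC ler_pdivrMr ?exprn_gt0//.
by rewrite [leRHS]mulrC; exact: H.
Qed.

Section laplace_uniqueness.
Variables (R : realType) (h : R -> R).
Let mu := @lebesgue_measure R.
Let D : set (measurableTypeR R) := `[0, +oo[%classic.
Hypothesis ih : forall k, mu.-integrable D (fun t => (expR (- (k.+1%:R * t)) * h t)%:E).
Hypothesis h0 : forall k, \int[mu]_(t in D) (expR (- (k.+1%:R * t)) * h t) = 0.

Let null (q : R -> R) :=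
  mu.-integrable D (fun t => (q t * (expR (- t) * h t))%:E) /\
  \int[mu]_(t in D) (q t * (expR (- t) * h t)) = 0.

Let mD : measurable D. Proof. exact: measurable_itv. Qed.

Let nullD q1 q2 : null q1 -> null q2 -> null (fun t => q1 t + q2 t).
Proof.
move=> [i1 e1] [i2 e2]; split.
  under eq_fun do rewrite mulrDl EFinD.
  exact: integrableD.
under eq_Rintegral do rewrite mulrDl.
by rewrite RintegralD// e1 e2 addr0.
Qed.

Let nullZ k q : null q -> null (fun t => k * q t).
Proof.
move=> [i1 e1]; split.
  under eq_fun do rewrite -mulrA EFinM.
  exact: integrableZl.
under eq_Rintegral do rewrite -mulrA.
by rewrite RintegralZl// e1 mulr0.
Qed.

Let nullX n : null (fun t => expR (- t) ^+ n).
Proof.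
have E t : expR (- t) ^+ n * (expR (- t) * h t) = expR (- (n.+1%:R * t)) * h t.
  by rewrite mulrA -exprSr -expRM_natl mulrN.
split; first by under eq_fun do rewrite E; exact: ih.
by under eq_Rintegral do rewrite E; exact: h0.
Qed.

Let null_poly (p : {poly R}) : null (fun t => p.[expR (- t)]).
Proof.
have -> : (fun t => p.[expR (- t)]) =
    (fun t => \sum_(i < size p) p`_i * expR (- t) ^+ i).
  by apply/funext => t; rewrite horner_coef.
elim: (size p) => [|n IH].
  under eq_fun do rewrite big_ord0.
  have := nullZ 0 (nullX 0); congr null; apply/funext => t; exact: mul0r.
under eq_fun do rewrite big_ord_recr/=.
by apply: nullD => //; apply: nullZ; exact: nullX.
Qed.

(* The weights (1 - (e^-t - e^-t0)^2)^n are polynomials in e^-t which concentrate at [t0]. *)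
Lemma laplace_not_gt0 t0 : 0 < t0 -> {for t0, continuous h} -> ~ (0 < h t0).
Proof.
move=> t00 ch ht0.
move/cvgrPdist_lt : (ch) => {}ch.
have ht2 : 0 < h t0 / 2 by rewrite divr_gt0.
have [d1/= d10 d1P] := ch _ ht2.
pose d := Num.min d1 t0 / 2.
have d0 : 0 < d by rewrite divr_gt0// lt_min d10.
have dt0 : d < t0.
  rewrite /d ltr_pdivrMr// (@le_lt_trans _ _ t0)// ?ge_min ?lexx ?orbT//; lra.
have dd1 : d < d1.
  rewrite /d ltr_pdivrMr// (@le_lt_trans _ _ d1)// ?ge_min ?lexx//; lra.
have hd t : `|t - t0| <= d -> h t0 / 2 <= h t.
  move=> td; have : `|h t0 - h t| < h t0 / 2.
    by apply: d1P; rewrite /= distrC (le_lt_trans td).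
  by rewrite ltr_norml => /andP[_]; lra.
pose x0 := expR (- t0).
have [x00 x01] : 0 < x0 /\ x0 < 1 by rewrite expR_gt0 expR_lt1 oppr_lt0.
pose e := Num.min (expR (- (t0 - d)) - x0) (x0 - expR (- (t0 + d))).
have e0 : 0 < e by rewrite lt_min !subr_gt0 !ltr_expR; apply/andP; split; lra.
have e1 : e < 1.
  rewrite (@le_lt_trans _ _ (x0 - expR (- (t0 + d))))// ?ge_min ?lexx ?orbT//.
  have := expR_gt0 (- (t0 + d)); lra.
have out t : d <= `|t - t0| -> e <= `|expR (- t) - x0|.
  rewrite ler_normr => /orP[td|td].
    rewrite ler_normr; apply/orP; right; rewrite ge_min; apply/orP; right.
    have : expR (- t) <= expR (- (t0 + d)) by rewrite ler_expR; lra.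
    lra.
  rewrite ler_normr; apply/orP; left; rewrite ge_min; apply/orP; left.
  have : expR (- (t0 - d)) <= expR (- t) by rewrite ler_expR; lra.
  lra.
have cE : {for t0, continuous (fun t : R => expR (- t))}.
  by apply: continuous_comp; [exact: opp_continuous|exact: continuous_expR].
have e20 : 0 < e / 2 by rewrite divr_gt0.
move/cvgrPdist_lt : cE => /(_ _ e20)[d2/= d20 d2P].
pose d' := Num.min (d / 2) (d2 / 2).
have d'0 : 0 < d' by rewrite lt_min; apply/andP; split; rewrite divr_gt0.
have d'd : d' < d by rewrite (@le_lt_trans _ _ (d / 2))// ?ge_min ?lexx//; lra.
have inn t : `|t - t0| <= d' -> `|expR (- t) - x0| <= e / 2.
  move=> td; rewrite distrC; apply/ltW/d2P; rewrite /= distrC (le_lt_trans td)//.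
  rewrite (@le_lt_trans _ _ (d2 / 2))// ?ge_min ?lexx ?orbT//; lra.
pose p : {poly R} := 1 - ('X - x0%:P) ^+ 2.
have pE x : p.[x] = 1 - (x - x0) ^+ 2 by rewrite !hornerE.
have p01 t : 0 <= t -> 0 <= p.[expR (- t)].
  move=> tt0; rewrite pE.
  have y0 := expR_gt0 (- t); have y1 : expR (- t) <= 1 by rewrite expR_le1 oppr_le0.
  by rewrite subr_ge0 -real_normK ?num_real// expr_le1// ler_norml; apply/andP; split; lra.
pose A := 1 - (e / 2) ^+ 2; pose B := 1 - e ^+ 2.
have e2 : e ^+ 2 < 1 by rewrite expr_lt1 ?(ltW e0).
have B0 : 0 < B by rewrite subr_gt0.
have BA : B < A by rewrite /A /B expr_div_n; have := exprn_gt0 2 e0; lra.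
have A0 : 0 < A by exact: lt_trans BA.
have pA t : `|t - t0| <= d' -> A <= p.[expR (- t)].
  move=> /inn td; rewrite pE lerD2l lerN2 -real_normK ?num_real// ler_sqr ?nnegrE//.
  exact: ltW.
have pB t : d <= `|t - t0| -> p.[expR (- t)] <= B.
  move=> /out td; rewrite pE lerD2l lerN2 -[leRHS]real_normK ?num_real// ler_sqr ?nnegrE//.
  exact: ltW.
pose I : set (measurableTypeR R) := `[t0 - d', t0 + d']%classic.
have mI : measurable I by exact: measurable_itv.
have inI t : I t -> `|t - t0| <= d'.
  by rewrite /I/= in_itv/= ler_norml => /andP[? ?]; apply/andP; split; lra.
pose c := expR (- (t0 + d')) * (h t0 / 2).
have c0 : 0 < c by rewrite mulr_gt0 ?expR_gt0.
have i1 : mu.-integrable D (EFin \o (fun t => expR (- t) * h t)).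
  have := ih 0; congr integrable; apply/funext => t; by rewrite mul1r.
have iabs : mu.-integrable D (EFin \o (fun t => `|expR (- t) * h t|)).
  exact: integrable_norm.
pose M := \int[mu]_(t in D) `|expR (- t) * h t|.
have ind : mu.-integrable D (EFin \o (\1_I : R -> R)).
  apply: (@integrableS _ _ _ _ setT) => //.
  exact: integrable_indic_itv.
have int1 : \int[mu]_(t in D) (\1_I t : R) = 2 * d'.
  rewrite /Rintegral integral_indic// setIidl; last first.
    by move=> t /inI; rewrite ler_norml /D/= in_itv/= andbT => /andP[td _]; lra.
  have muI : lebesgue_measure I = (2 * d')%:E.
    by rewrite /I lebesgue_measure_itv/= lte_fin ifT ?(EFinN, EFinD)//; [rewrite -EFinB; congr EFin; lra|lra].
  exact: (congr1 fine muI).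
have iZ k (f : R -> R) : mu.-integrable D (EFin \o f) ->
    mu.-integrable D (EFin \o (fun t => k * f t)).
  by move=> /(integrableZl mD k); apply: eq_integrable => // t _ /=; rewrite EFinM.
have key n : A ^+ n * c * (2 * d') <= B ^+ n * M.
  have [ip ep] := null_poly (p ^+ n).
  rewrite -subr_le0 -ep.
  have -> : A ^+ n * c * (2 * d') - B ^+ n * M =
      \int[mu]_(t in D) (A ^+ n * c * \1_I t - B ^+ n * `|expR (- t) * h t|).
    rewrite RintegralB//; [|exact: iZ..].
    by rewrite !RintegralZl// int1.
  apply: le_Rintegral => //.
    have := integrableB mD (iZ (A ^+ n * c) _ ind) (iZ (B ^+ n) _ iabs).
    by apply: eq_integrable => // t _ /=; rewrite EFinB.
  move=> t; rewrite /D/= in_itv/= andbT => tt0.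
  rewrite horner_exp.
  have p0 := p01 _ tt0.
  have [td|td] := leP d `|t - t0|.
    rewrite indicE memNset ?mulr0 ?sub0r; last first.
      by move=> /inI; lra.
    rewrite lerNl (@le_trans _ _ `|p.[expR (- t)] ^+ n * (expR (- t) * h t)|)//.
      by rewrite -normrN ler_norm.
    rewrite normrM ler_wpM2r// ger0_norm ?exprn_ge0// lerXn2r ?nnegrE//; first exact: ltW.
    exact: pB.
  have hh : h t0 / 2 <= h t by apply: hd; exact: ltW.
  have [tI|tI] := boolP (t \in I).
    rewrite indicE tI mulr1 (@le_trans _ _ (A ^+ n * c))//.
      by rewrite gerBl mulr_ge0// exprn_ge0// ltW.
    move: tI => /set_mem/inI tI; apply: ler_pM => //.
    - by rewrite exprn_ge0// ltW.
    - exact: ltW.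
    - by rewrite lerXn2r ?nnegrE// ?(ltW A0)// pA.
    - rewrite /c ler_pM ?expR_ge0// ?(ltW ht2)// ler_expR lerN2.
      by move: tI; rewrite ler_norml => /andP[_]; lra.
  rewrite indicE (negbTE tI) mulr0 sub0r (@le_trans _ _ 0)//.
    by rewrite oppr_le0 mulr_ge0// exprn_ge0// ltW.
  by rewrite !mulr_ge0 ?exprn_ge0 ?expR_ge0// (le_trans _ hh)// ltW.
have C0 : 0 < c * (2 * d') by rewrite mulr_gt0// mulr_gt0.
apply: (geometric_domination B0 BA C0 (M := M)) => n.
by rewrite mulrA; exact: key.
Qed.

End laplace_uniqueness.

Lemma laplace_eq0 (R : realType) (h : R -> R) :
  (forall k, (@lebesgue_measure R).-integrable `[0, +oo[
    (fun t => (expR (- (k.+1%:R * t)) * h t)%:E)) ->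
  (forall k, \int[lebesgue_measure]_(t in `[0, +oo[) (expR (- (k.+1%:R * t)) * h t) = 0) ->
  forall t, 0 < t -> {for t, continuous h} -> h t = 0.
Proof.
move=> ih h0 t t0 ch; have [ht|ht|//] := ltgtP (h t) 0; last first.
  by case: (laplace_not_gt0 ih h0 t0 ch).
have [k|k||] := @laplace_not_gt0 R (fun t => - h t) _ _ t t0.
- have := integrableN (ih k); apply: eq_integrable => //= x _.
  by rewrite mulrN EFinN.
- under eq_Rintegral do rewrite -[- h _]mulN1r mulrCA.
  rewrite RintegralZl//; last exact: ih.
  exact: (eq_trans (congr1 (fun y => -1 * y) (h0 k)) (mulr0 _)).
- by apply: cvgN; exact: ch.
- by rewrite oppr_gt0.
Qed.

(** * Laplace transform of the stable law *)

Lemma sin_le_id (R : realType) (x : R) : `|sin x| <= `|x|.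
Proof.
wlog x0 : x / 0 < x => [H|].
  have [x0|x0|->] := ltgtP x 0; [|exact: H|by rewrite sin0].
  by rewrite -normrN -[leRHS]normrN -sinN; apply: H; rewrite oppr_gt0.
have [|y _ E] := @MVT R sin cos 0 x x0.
- by apply: continuous_subspaceT => z; exact: continuous_sin.
by move: E; rewrite sin0 !subr0 => ->; rewrite normrM ler_piMl// cos_max.
Qed.

Lemma cvg_sinM_div (R : realType) (t : R) :
  sin (t * harmonic n) / harmonic n @[n --> \oo] --> t.
Proof.
have D : is_derive (0 : R) 1 (fun x => sin (t * x)) t.
  have d1 : is_derive (0 : R) 1 (fun x => t * x) t.
    by apply: is_derive_eq; rewrite /GRing.scale/=; ring.
  have d2 : is_derive (0 : R) 1 (sin \o (fun x => t * x)) (cos (t * 0) * t).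
    exact: is_derive1_comp.
  by apply: (is_derive_eq d2); rewrite mulr0 cos0 mul1r.
have hl : h^-1 *: (sin (t * (h *: 1 + 0)) - sin (t * 0)) @[h --> 0^'] -->
    'D_1 (fun x => sin (t * x)) 0 := @ex_derive _ _ _ _ _ _ _ D.
rewrite derive_val in hl.
have hn : (forall n, harmonic n != 0 :> R) /\ (@harmonic R) n @[n --> \oo] --> 0.
  by split => [n|]; [rewrite invr_eq0|exact: cvg_harmonic].
have -> : (fun n => sin (t * harmonic n) / harmonic n) =
    (fun n => (harmonic n)^-1 *: (sin (t * (harmonic n *: 1 + 0)) - sin (t * 0))).
  apply/funext => n.
  by rewrite mulr0 sin0 subr0 addr0 /GRing.scale/= mulr1 mulrC.
exact: ((cvgr_dnbhsP _ _ _).1 hl _ hn).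
Qed.

Lemma measurable_invr (R : realType) : measurable_fun setT (fun x : R => x^-1).
Proof.
have -> : (fun x : R => x^-1) = (fun x => x * (x ^+ 2) `^ (-1)).
  apply/funext => x; rewrite powR_inv1 ?sqr_ge0//.
  have [->|x0] := eqVneq x 0; first by rewrite invr0 mul0r.
  by rewrite expr2 invfM mulrA divff// mul1r.
apply: measurable_funM => //; apply: (measurableT_comp (measurable_powR _)).
exact: exprn_measurable.
Qed.

Lemma integrable_mul_expRN (R : realType) (k : R) : 0 < k ->
  (@lebesgue_measure R).-integrable `[0, +oo[ (fun t => (t * expR (- (k * t)))%:E).
Proof.
move=> k0; apply/integrableP; split.
  apply/measurable_EFinP; apply: measurable_funTS; apply: measurable_funM => //.
  by apply: measurableT_comp => //; apply: measurableT_comp => //; exact: mulrl_measurable.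
rewrite [X in (X < _)%E](_ : _ = (k ^- 2)%:E) ?ltry//.
rewrite -integral_mul_expRN//; apply: eq_integral => t.
rewrite inE/= in_itv/= andbT => t0.
by rewrite /= ger0_norm// mulr_ge0 ?expR_ge0.
Qed.

Lemma le0_harmonic (R : realType) (x : \bar R) (C : R) :
  (forall n, (x <= (C * harmonic n)%:E)%E) -> (x <= 0)%E.
Proof.
move=> xC; apply/lee_addgt0Pr => e e0; rewrite add0e.
apply: (le_trans (xC (Num.truncn (C / e)))).
rewrite lee_fin /harmonic/= ler_pdivrMr// mulrC -ler_pdivrMr//.
by rewrite ltW// truncnS_gt.
Qed.

Section stable2.
Context {d : measure_display} {T : measurableType d} {R : realType}.
Variables (P : probability T R) (S : T -> R) (a : R).
Hypotheses (mS : measurable_fun setT S) (a0 : 0 < a) (a1 : a < 1).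
Hypothesis char_fun : forall t : R,
  (\int[P]_w (cos (t * S w))%:E)%E =
    (expR (- (`|t| `^ a * cos (pi * a / 2)))
     * cos (`|t| `^ a * Num.sg t * sin (pi * a / 2)))%:E /\
  (\int[P]_w (sin (t * S w))%:E)%E =
    (expR (- (`|t| `^ a * cos (pi * a / 2)))
     * sin (`|t| `^ a * Num.sg t * sin (pi * a / 2)))%:E.
Let mu := @lebesgue_measure R.

Let q s v w := (s ^+ 2 + (v + S w) ^+ 2)^-1.

Let q_ge0 s v w : 0 <= q s v w.
Proof. by rewrite invr_ge0 addr_ge0 ?sqr_ge0. Qed.

Let mq s v : measurable_fun setT (q s v).
Proof.
apply: (measurableT_comp (@measurable_invr R)); apply: measurable_funD => //.
by apply: measurable_funX; exact: measurable_funD.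
Qed.

Let f (v s t : R) := expR (- (v * t)) * expR (- (t `^ a)) * (sin (t * s) / s).

Let mf v s : measurable_fun setT (f v s).
Proof.
apply: measurable_funM; last first.
  apply: measurable_funM => //; apply: measurableT_comp; first exact: measurable_sin.
  exact: measurable_funM.
by apply: measurable_funM; apply: measurableT_comp => //; apply: measurableT_comp.
Qed.

Let f_le v s t : 0 < s -> 0 <= t -> `|f v s t| <= t * expR (- (v * t)).
Proof.
move=> s0 t0; rewrite /f [leRHS]mulrC -mulrA normrM ger0_norm ?expR_ge0//.
rewrite ler_wpM2l ?expR_ge0// normrM -[leRHS]mul1r ler_pM//.
  by rewrite ger0_norm ?expR_ge0// expR_le1 oppr_le0 powR_ge0.
rewrite normrM [ `|s^-1|]gtr0_norm ?invr_gt0// ler_pdivrMr//.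
by rewrite (le_trans (sin_le_id _))// normrM ger0_norm// gtr0_norm.
Qed.

Let if_ v s : 0 < v -> 0 < s -> mu.-integrable `[0, +oo[ (EFin \o f v s).
Proof.
move=> v0 s0; apply: le_integrable (integrable_mul_expRN v0) => //.
- by apply: measurable_funTS; apply/measurable_EFinP; exact: mf.
- move=> t; rewrite /= in_itv/= andbT => t0.
  by rewrite lee_fin (le_trans (f_le _ s0 t0))// ler_norm.
Qed.

Let expectation_q s v : 0 < s -> 0 < v -> (\int[P]_w (q s v w)%:E =
  \int[mu]_(t in `[0%R, +oo[) (f v s t)%:E)%E.
Proof.
move=> s0 v0; have := expectation_poisson mS a0 a1 char_fun s0 v0.
under eq_integral do rewrite EFinM.
rewrite ge0_integralZl//; last 3 first.
- exact/measurable_EFinP/mq.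
- by move=> w _; rewrite lee_fin; exact: q_ge0.
- by rewrite lee_fin ltW.
have -> : \int[lebesgue_measure]_(t in `[0, +oo[)
    (expR (- (v * t)) * expR (- t `^ a) * sin (t * s)) =
    \int[lebesgue_measure]_(t in `[0, +oo[) (s * f v s t).
  by apply: eq_Rintegral => t _; rewrite /f; field; rewrite gt_eqF.
rewrite RintegralZl//; last exact: if_.
rewrite EFinM /Rintegral fineK; last by apply: integrable_fin_num => //; exact: if_.
move=> /(congr1 (fun x => (s^-1)%:E * x)%E).
by rewrite !muleA -EFinM mulVf ?gt_eqF// !mul1e.
Qed.

Let expectation_q_le s v : 0 < s -> 0 < v -> (\int[P]_w (q s v w)%:E <= (v ^- 2)%:E)%E.
Proof.
move=> s0 v0; rewrite expectation_q// -integral_mul_expRN//.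
apply: le_integral => //; [exact: if_|exact: integrable_mul_expRN|].
move=> t; rewrite inE/= in_itv/= andbT => t0.
by rewrite lee_fin (le_trans _ (f_le _ s0 t0))// ler_norm.
Qed.

Let mabs s v : measurable [set w | `|v + S w| <= s].
Proof.
rewrite -[X in measurable X]setTI.
apply: (measurable_fun_ler (f := fun w => `|v + S w|) (g := cst s)) => //.
by apply: measurableT_comp => //; exact: measurable_funD.
Qed.

Let interval_bound s v : 0 < s -> 0 < v ->
  (P [set w | `|v + S w| <= s]%R <= (2 * s ^+ 2 / v ^+ 2)%:E)%E.
Proof.
move=> s0 v0; set A := [set w | _].
have s20 : 0 < 2 * s ^+ 2 by rewrite mulr_gt0// exprn_gt0.
rewrite EFinM -lee_pdivrMl//; apply: le_trans (expectation_q_le s0 v0).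
have -> : (((2 * s ^+ 2)^-1)%:E * P A = \int[P]_w ((2 * s ^+ 2)^-1 * \1_A w)%:E)%E.
  under eq_integral do rewrite EFinM.
  rewrite ge0_integralZl ?integral_indic ?setIT//; last 3 first.
  - exact: mabs.
  - exact/measurable_EFinP/measurable_indic/mabs.
  - by rewrite lee_fin invr_ge0 ltW.
apply: ge0_le_integral => //.
- by move=> w _; rewrite lee_fin mulr_ge0// invr_ge0 ltW.
- by apply/measurable_EFinP/measurable_funM => //; exact/measurable_indic/mabs.
- exact/measurable_EFinP/mq.
move=> w _; rewrite lee_fin indicE; case: (boolP (w \in A)) => [/set_mem wA|_]; last first.
  by rewrite mulr0; exact: q_ge0.
rewrite mulr1 /q lef_pV2 ?posrE//.
  rewrite mulrDl mul1r lerD2l -[leLHS]real_normK ?num_real// lerXn2r ?nnegrE// ltW//.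
by rewrite ltr_wpDr ?sqr_ge0// exprn_gt0.
Qed.

(* The interval is covered by O(n) intervals of length O(1 / n), each of probability
   O(1 / n^2). *)
Let interval_null v l : 0 < v -> 0 < l ->
  P [set w | - (v + l) <= S w <= - v]%R = 0%E.
Proof.
move=> v0 l0; set A := [set w | _].
have mA : measurable A.
  have -> : A = [set w | - (v + l) <= S w] `&` [set w | S w <= - v].
    by apply/seteqP; split => w; [move=> /andP|move=> H; apply/andP].
  apply: measurableI; rewrite -[X in measurable X]setTI.
    exact: (measurable_fun_ler (f := cst (- (v + l))) (g := S)).
  exact: (measurable_fun_ler (f := S) (g := cst (- v))).
apply/eqP; rewrite eq_le measure_ge0 andbT.
have bnd n : (P A <= (l ^+ 2 / v ^+ 2 * harmonic n)%:E)%E.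
  pose h := l / (2 * n.+1%:R).
  have h0 : 0 < h by rewrite divr_gt0// mulr_gt0.
  pose B j := [set w | `|(v + (2 * j%:R + 1) * h) + S w| <= h].
  have mB j : measurable (B j) by exact: mabs.
  have AB : A `<=` \big[setU/set0]_(j < n.+2) B j.
    move=> w /andP[wl wv]; rewrite -bigcup_mkord.
    pose x := - S w - v.
    have x0 : 0 <= x by rewrite /x; lra.
    have xl : x <= l by rewrite /x; lra.
    have h20 : 0 < 2 * h by rewrite mulr_gt0.
    have /andP[t1 t2] := truncn_itv (divr_ge0 x0 (ltW h20)).
    exists (Num.truncn (x / (2 * h))).
      have : (Num.truncn (x / (2 * h)))%:R <= n.+1%:R :> R.
        apply: (le_trans t1); rewrite ler_pdivrMr// /h (le_trans xl)//.
        by rewrite le_eqVlt; apply/orP; left; apply/eqP; field; rewrite gt_eqF.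
      by rewrite ler_nat.
    rewrite /B/= ler_norml; move: t1 t2.
    rewrite -[(Num.truncn _).+1%:R]natr1 ler_pdivlMr// ltr_pdivrMr//.
    move: (_%:R) => j; rewrite /x => t1 t2; apply/andP; split; nra.
  apply: (@le_trans _ _ (P (\big[setU/set0]_(j < n.+2) B j))).
    by apply: le_measure; rewrite ?inE//; exact: bigsetU_measurable.
  apply: (le_trans (Boole_inequality P (fun i _ => mB i))).
  apply: (@le_trans _ _ (\sum_(j < n.+2) (2 * h ^+ 2 / v ^+ 2)%:E)%E).
    apply: lee_sum => j _; have vj : v <= v + (2 * j%:R + 1) * h.
      by rewrite lerDl mulr_ge0 ?(ltW h0)// addr_ge0// mulr_ge0.
    apply: (le_trans (interval_bound h0 (lt_le_trans v0 vj))); rewrite lee_fin.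
    apply: ler_wpM2l; first by rewrite mulr_ge0// sqr_ge0.
    rewrite lef_pV2 ?posrE ?exprn_gt0 ?(lt_le_trans v0)//.
    by rewrite lerXn2r ?nnegrE ?(le_trans (ltW v0)) ?(ltW v0).
  rewrite sumEFin sumr_const card_ord lee_fin /harmonic/= /h -[leLHS]mulr_natl.
  have -> : n.+2%:R * (2 * (l / (2 * n.+1%:R)) ^+ 2 / v ^+ 2) =
      (l ^+ 2 / v ^+ 2 / n.+1%:R) * (n.+2%:R / (2 * n.+1%:R)) :> R.
    by field; rewrite !gt_eqF.
  rewrite ler_piMr ?divr_ge0 ?sqr_ge0// ler_pdivrMr ?mulr_gt0// mul1r.
  by rewrite -natrM ler_nat mul2n -addnn addSnnS leq_addl.
exact: le0_harmonic bnd.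
Qed.

Let S_ge0 : {ae P, forall w, 0 <= S w}.
Proof.
pose A n := [set w | - (harmonic n + n.+1%:R) <= S w <= - harmonic n].
have : P.-negligible (\bigcup_n A n).
  apply: negligible_bigcup => n; exists (A n); split => //.
    rewrite -[X in measurable X]setTI.
    have -> : A n = S @^-1` `[- (harmonic n + n.+1%:R), - harmonic n]%classic.
      by apply/seteqP; split => w; rewrite /A/= in_itv.
    by apply: mS => //; exact: measurable_itv.
  by apply: interval_null => //; rewrite invr_gt0.
apply: negligibleS => w /= /negP; rewrite -ltNge => Sw.
have x0 : 0 < - S w by rewrite oppr_gt0.
pose n := Num.truncn (- S w + (- S w)^-1).
have nP : - S w + (- S w)^-1 < n.+1%:R by exact: truncnS_gt.
have V0 : 0 < (- S w)^-1 by rewrite invr_gt0.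
have h0 : 0 < n.+1%:R^-1 :> R by rewrite invr_gt0.
exists n => //; rewrite /A /harmonic/=; apply/andP; split.
  by move: h0 nP V0; move: (n.+1%:R^-1) ((- S w)^-1) => u1 u2; lra.
rewrite lerNr -[leRHS]invrK lef_pV2 ?posrE//.
by move: nP; move: ((- S w)^-1) => u2; lra.
Qed.

(* [`|S w|] keeps the kernels nonnegative and bounded everywhere; it is [S w] almost surely. *)
Let mqv v : measurable_fun setT (fun w => (v + `|S w|) ^- 2).
Proof.
apply: (measurableT_comp (@measurable_invr R)); apply: measurable_funX.
by apply: measurable_funD => //; exact: measurableT_comp.
Qed.

Let expectation_q0 v : 0 < v -> (\int[P]_w ((v + `|S w|) ^- 2)%:E =
  \int[mu]_(t in `[0%R, +oo[) (expR (- (v * t)) * (t * expR (- (t `^ a))))%:E)%E.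
Proof.
move=> v0.
have hn n : 0 < harmonic n :> R by rewrite invr_gt0.
have ae1 : {ae P, forall w, setT w ->
    (q (harmonic n) v w)%:E @[n --> \oo] --> ((v + `|S w|) ^- 2)%:E}.
  apply: filterS S_ge0 => w Sw _; apply: cvg_EFin; first exact: nearW.
  rewrite /q ger0_norm//; apply: cvgV; first by rewrite expf_neq0// gt_eqF// ltr_wpDr.
  rewrite -[X in _ --> X]add0r; apply: cvgD; last exact: cvg_cst.
  rewrite -[X in _ --> X](mulr0 0); under eq_fun do rewrite expr2.
  by apply: cvgM; exact: cvg_harmonic.
have ae2 : {ae P, forall w n, setT w -> (`|(q (harmonic n) v w)%:E| <= (v ^- 2)%:E)%E}.
  apply: filterS S_ge0 => w Sw n _; rewrite /= lee_fin ger0_norm ?q_ge0//.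
  have vS : 0 < (v + S w) ^+ 2 by rewrite exprn_gt0// ltr_wpDr.
  rewrite /q lef_pV2 ?posrE ?exprn_gt0//; last by rewrite ltr_wpDl// sqr_ge0.
  rewrite (@le_trans _ _ ((v + S w) ^+ 2))// ?lerDr ?sqr_ge0//.
  by rewrite lerXn2r ?nnegrE ?(ltW v0)// ?addr_ge0 ?(ltW v0)// lerDl.
have [_ _ lim1] := @dominated_convergence _ _ _ P setT measurableT
  (fun n w => (q (harmonic n) v w)%:E) (fun w => ((v + `|S w|) ^- 2)%:E)
  (fun w => (v ^- 2)%:E)
  (fun n => (measurable_EFinP _ _).2 (mq (harmonic n) v))
  ((measurable_EFinP _ _).2 (mqv v))
  ae1 (finite_measure_integrable_cst P (v ^- 2) measurableT) ae2.
have m0y : measurable (`[0, +oo[%classic : set (measurableTypeR R)).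
  exact: measurable_itv.
have mfn n : measurable_fun (`[0, +oo[%classic : set (measurableTypeR R))
    (EFin \o f v (harmonic n)).
  by apply: measurable_funTS; apply/measurable_EFinP; exact: mf.
have lim2 : (\int[mu]_(t in `[0%R, +oo[) (f v (harmonic n) t)%:E)%E @[n --> \oo] -->
    (\int[mu]_(t in `[0%R, +oo[) (expR (- (v * t)) * (t * expR (- (t `^ a))))%:E)%E.
  apply: (@dominated_cvg _ _ _ mu _ m0y (fun n => EFin \o f v (harmonic n)) _
    (fun t => (t * expR (- (v * t)))%:E) mfn).
  - move=> t _; apply: cvg_EFin; first exact: nearW.
    have -> : expR (- (v * t)) * (t * expR (- (t `^ a))) =
      expR (- (v * t)) * expR (- (t `^ a)) * t by ring.
    apply: cvgM; first exact: cvg_cst.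
    exact: cvg_sinM_div.
  - by [].
  - exact: integrable_mul_expRN.
  - move=> n t; rewrite /= in_itv/= andbT => t0; rewrite lee_fin; exact: f_le.
have E : (fun n => \int[mu]_(t in `[0%R, +oo[) (f v (harmonic n) t)%:E)%E =
    (fun n => \int[P]_w (q (harmonic n) v w)%:E)%E.
  by apply/funext => n; rewrite expectation_q.
move: lim2; rewrite E => /cvg_lim <- //.
by apply/esym/cvg_lim => //; exact: lim1.
Qed.

Let L (t : R) := \int[P]_w (expR (- (t * `|S w|))).

Let mexpS t : measurable_fun setT (fun w => expR (- (t * `|S w|))).
Proof.
apply: measurableT_comp => //; apply: measurableT_comp => //.
by apply: measurable_funM => //; exact: measurableT_comp.
Qed.

Let expS1 t w : 0 <= t -> `|expR (- (t * `|S w|))| <= 1.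
Proof.
by move=> t0; rewrite ger0_norm ?expR_ge0// expR_le1 oppr_le0 mulr_ge0.
Qed.

Let iexpS t : 0 <= t -> P.-integrable setT (EFin \o (fun w => expR (- (t * `|S w|)))).
Proof. by move=> t0; apply: (integrable_norm_le _ (M := 1)) => // w; exact: expS1. Qed.

Let EFin_L t : 0 <= t -> (\int[P]_w (expR (- (t * `|S w|)))%:E = (L t)%:E)%E.
Proof. by move=> t0; rewrite /L /Rintegral fineK//; apply: integrable_fin_num => //; exact: iexpS. Qed.

Let kernel v (z : measurableTypeR R * T) : \bar R :=
  (((fun t => t * expR (- (v * t))) \_ `[0, +oo[) z.1 * expR (- (z.1 * `|S z.2|)))%:E.

Let mkernel v : measurable_fun setT (kernel v).
Proof.
apply/measurable_EFinP; apply: measurable_funM.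
  apply: (@measurableT_comp _ _ _ _ _ _ (((fun t => t * expR (- (v * t))) \_ `[0, +oo[) : measurableTypeR R -> R)) => //.
  apply/measurable_restrict => //; apply: measurable_funTS; apply: measurable_funM => //.
  by apply: measurableT_comp => //; apply: measurableT_comp => //; exact: mulrl_measurable.
apply: measurableT_comp => //; apply: measurableT_comp => //; apply: measurable_funM => //.
by apply: measurableT_comp => //; exact: measurableT_comp.
Qed.

Let kernel_ge0 v z : (0 <= kernel v z)%E.
Proof.
rewrite lee_fin mulr_ge0 ?expR_ge0// patchE; case: ifPn => //.
by rewrite inE/= in_itv/= andbT => z0; rewrite mulr_ge0 ?expR_ge0.
Qed.

Let LE v : 0 < v -> (\int[P]_w ((v + `|S w|) ^- 2)%:E =
  \int[mu]_(t in `[0%R, +oo[) (expR (- (v * t)) * (t * L t))%:E)%E.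
Proof.
move=> v0; transitivity (\int[P]_w \int[mu]_t kernel v (t, w))%E.
  apply: eq_integral => w _; rewrite -integral_mul_expRN ?ltr_wpDr//.
  rewrite integral_mkcond; apply: eq_integral => t _.
  rewrite /kernel/= !patchE; case: ifPn => // _; last by rewrite mul0r.
  by rewrite -mulrA -expRD -opprD mulrDl [t * `|_|]mulrC.
rewrite -(fubini_tonelli (m1 := mu) (m2 := P) _ (mkernel v) (kernel_ge0 v)).
rewrite [RHS]integral_mkcond; apply: eq_integral => t _; rewrite patchE.
case: ifPn => [|tn]; last first.
  by apply: integral0_eq => w _; rewrite /kernel/= patchE (negbTE tn) mul0r.
rewrite inE/= in_itv/= andbT => t0; rewrite /kernel/= patchE mem_set/=; last by rewrite in_itv/= t0.
under eq_integral do rewrite EFinM.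
rewrite ge0_integralZl//; [|exact/measurable_EFinP/mexpS|by rewrite lee_fin mulr_ge0 ?expR_ge0].
by rewrite EFin_L// -EFinM mulrCA mulrA.
Qed.

Let continuous_L t : 0 < t -> {for t, continuous L}.
Proof.
move=> t0.
apply: (@continuity_under_integral _ _ _ P (fun t w => expR (- (t * `|S w|))) setT measurableT
  0 (t + 1) _ _ (cst 1) (finite_measure_integrable_cst P 1 measurableT)).
- by move=> x /=; rewrite in_itv/= => /andP[/ltW x0 _]; exact: iexpS.
- apply: aeW => w _ x _; apply: continuous_comp; last exact: continuous_expR.
  by apply: cvgN; apply: cvgM; [exact: cvg_id|exact: cvg_cst].
- by move=> x /=; rewrite in_itv/= => /andP[/ltW x0 _]; apply: aeW => w _; exact: expS1.
- by rewrite inE/= in_itv/= t0/=; lra.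
Qed.

Lemma laplace_stable t : 0 < t ->
  (\int[P]_w (expR (- (t * `|S w|)))%:E = (expR (- (t `^ a)))%:E)%E.
Proof.
move=> t0; rewrite EFin_L ?ltW//; congr EFin.
pose h (t : R) := t * (L t - expR (- (`|t| `^ a))).
have hE k x : 0 <= x -> expR (- (k * x)) * h x =
    expR (- (k * x)) * (x * L x) - expR (- (k * x)) * (x * expR (- (x `^ a))).
  by move=> x0; rewrite /h ger0_norm//; ring.
have fin v : 0 < v -> ((\int[P]_w ((v + `|S w|) ^- 2)%:E)%E < +oo)%E.
  move=> v0; apply: (@le_lt_trans _ _ (v ^- 2)%:E); last exact: ltry.
  rewrite -[leRHS]mule1 -(probability_setT P) -integral_cst//.
  apply: ge0_le_integral => //.
  - by move=> w _; rewrite lee_fin invr_ge0 sqr_ge0.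
  - exact/measurable_EFinP/mqv.
  move=> w _; rewrite lee_fin lef_pV2 ?posrE ?exprn_gt0 ?ltr_wpDr//.
  by rewrite lerXn2r ?nnegrE ?addr_ge0 ?(ltW v0)// lerDl.
have L0 x : 0 <= L x by apply: Rintegral_ge0 => w _; exact: expR_ge0.
have mL : measurable_fun (`[0, +oo[%classic : set (measurableTypeR R)) L.
  apply/measurable_fun_itv_obnd_cbndP; apply: open_continuous_measurable_fun.
    exact: interval_open.
  by move=> x; rewrite inE/= in_itv/= andbT => x0; exact: continuous_L.
have mexp v : measurable_fun (`[0, +oo[%classic : set (measurableTypeR R)) (fun x => expR (- (v * x))).
  apply: measurable_funTS; apply: measurableT_comp => //; apply: measurableT_comp => //.
have int (v : R) (g : R -> R) : (forall x, 0 <= x -> 0 <= g x) ->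
    measurable_fun (`[0, +oo[%classic : set (measurableTypeR R)) g ->
    (\int[mu]_(x in `[0%R, +oo[) (expR (- (v * x)) * g x)%:E < +oo)%E ->
    mu.-integrable `[0, +oo[ (EFin \o (fun x => expR (- (v * x)) * g x)).
  move=> g0 mg gy; apply/integrableP; split.
    by apply/measurable_EFinP; apply: measurable_funM => //; exact: mexp.
  apply: le_lt_trans gy; rewrite le_eqVlt; apply/orP; left; apply/eqP.
  apply: eq_integral => x; rewrite inE/= in_itv/= andbT => x0.
  by rewrite /= ger0_norm// mulr_ge0 ?expR_ge0// g0.
have i1 v : 0 < v -> mu.-integrable `[0, +oo[ (EFin \o (fun x => expR (- (v * x)) * (x * L x))).
  move=> v0; apply: int; [by move=> x x0; exact: mulr_ge0|exact: measurable_funM|].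
  by rewrite -LE//; exact: fin.
have i2 v : 0 < v -> mu.-integrable `[0, +oo[ (EFin \o (fun x => expR (- (v * x)) * (x * expR (- (x `^ a))))).
  move=> v0; apply: int; first by move=> x x0; rewrite mulr_ge0 ?expR_ge0.
    apply: measurable_funTS; apply: measurable_funM => //; apply: measurableT_comp => //.
    by apply: measurableT_comp => //; exact: measurable_powR.
  by rewrite -expectation_q0//; exact: fin.
have ch : {for t, continuous h}.
  apply: cvgM; first exact: cvg_id.
  apply: cvgB; first exact: continuous_L.
  apply: continuous_comp; last exact: continuous_expR.
  by apply: cvgN; exact: continuous_norm_powR.
have : h t = 0.
  apply: (laplace_eq0 _ _ t0 ch) => k.
    have mD : measurable (`[0, +oo[%classic : set (measurableTypeR R)) by exact: measurable_itv.
    have := integrableB mD (i1 _ (ltr0Sn R k)) (i2 _ (ltr0Sn R k)).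
    apply: eq_integrable; first exact: measurable_itv.
    by move=> x; rewrite inE/= in_itv/= andbT => x0; rewrite hE// EFinB.
  have -> : \int[lebesgue_measure]_(x in `[0, +oo[) (expR (- (k.+1%:R * x)) * h x) =
      \int[lebesgue_measure]_(x in `[0, +oo[) (expR (- (k.+1%:R * x)) * (x * L x) -
      expR (- (k.+1%:R * x)) * (x * expR (- (x `^ a)))).
    by apply: eq_Rintegral => x; rewrite inE/= in_itv/= andbT => x0; rewrite hE.
  rewrite RintegralB//; [|exact: i1|exact: i2].
  by rewrite /Rintegral -LE// expectation_q0// subrr.
rewrite /h gtr0_norm// => /eqP; rewrite mulf_eq0 gt_eqF//= subr_eq0.
by move/eqP.
Qed.

Lemma stable_gt0 : {ae P, forall w, 0 < S w}.
Proof.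
pose N := [set w | S w = 0].
have mN : measurable N.
  rewrite (_ : N = setT `&` S @^-1` [set 0]) ?setTI//.
  by rewrite -[X in measurable X]setTI; apply: mS => //; exact: measurable_set1.
have NE n : (P N <= (1 * harmonic n)%:E)%E.
  pose t := n.+1%:R `^ a^-1 : R.
  have t0 : 0 < t by rewrite powR_gt0.
  apply: (@le_trans _ _ (\int[P]_w (expR (- (t * `|S w|)))%:E)%E); last first.
    rewrite laplace_stable// lee_fin mul1r /t -powRrM mulVf ?gt_eqF// powRr1//.
    rewrite expRN lef_pV2 ?posrE ?expR_gt0//.
    by rewrite (le_trans _ (expR_ge1Dx _))// lerDr.
  rewrite -(setIT N) -integral_indic//; apply: ge0_le_integral => //.
  - exact/measurable_EFinP.
  - exact/measurable_EFinP.
  move=> w _; rewrite lee_fin indicE; case: (boolP (w \in N)) => [/set_mem ->|_].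
    by rewrite normr0 mulr0 oppr0 expR0.
  exact: expR_ge0.
have N0 : P N = 0%E by apply/eqP; rewrite eq_le (le0_harmonic NE) measure_ge0.
have aeN : {ae P, forall w, S w <> 0}.
  by exists N; split => // w /= /contrapT.
by apply: filterS2 S_ge0 aeN => w Sw /eqP Sn; rewrite lt_def Sn.
Qed.

End stable2.

(** * Independence and densities *)

Lemma has_density_integral (d : measure_display) (T : measurableType d)
    (R : realType) (P : probability T R) (Y : T -> R) (g : R -> R) :
  measurable_fun setT Y -> measurable_fun setT g -> (forall x, 0 <= g x) ->
  has_density P Y g ->
  forall f : R -> \bar R, measurable_fun setT f -> (forall x, (0 <= f x)%E) ->
  (\int[P]_w f (Y w) = \int[lebesgue_measure]_x (f x * (g x)%:E))%E.
Proof.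
move=> mY mg g0 dY f mf f0.
have mY' : measurable_fun setT (Y : T -> measurableTypeR R) := mY.
rewrite -(@ge0_integral_density _ _ _ _ (image_measure P mY') g)//.
by rewrite (ge0_integral_pushforward mY' P measurableT).
Qed.

Lemma integral_independent (d d1 d2 : measure_display) (T : measurableType d)
    (T1 : measurableType d1) (T2 : measurableType d2) (R : realType)
    (P : probability T R) (U : T -> T1) (V : T -> T2) :
  measurable_fun setT U -> measurable_fun setT V ->
  (forall A B, measurable A -> measurable B ->
    P (U @^-1` A `&` V @^-1` B) = (P (U @^-1` A) * P (V @^-1` B))%E) ->
  forall f : T1 * T2 -> \bar R, measurable_fun setT f -> (forall x, (0 <= f x)%E) ->
  (\int[P]_w f (U w, V w) = \int[P]_w' \int[P]_w f (U w, V w'))%E.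
Proof.
move=> mU mV UV f mf f0.
have mUV : measurable_fun setT (fun w => (U w, V w)) by exact: measurable_fun_pair.
pose U' : {mfun T >-> T1} := HB.pack U (isMeasurableFun.Build _ _ _ _ U mU).
pose V' : {mfun T >-> T2} := HB.pack V (isMeasurableFun.Build _ _ _ _ V mV).
pose mu := distribution P U'; pose mv := distribution P V'.
have E : forall X, measurable X -> (mu \x mv)%E X = image_measure P mUV X.
  by apply: product_measure_unique => A B mA mB; exact: UV.
have := ge0_integral_pushforward mUV P measurableT mf (fun x _ => f0 x).
rewrite preimage_setT => <-.
rewrite (eq_measure_integral (mu \x mv)%E); last first.
  by move=> A mA _; exact/esym/E.
rewrite fubini_tonelli2// /fubini_G.
have mG := measurable_fun_fubini_tonelli_G (m1 := mu) _ mf f0.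
rewrite (ge0_integral_pushforward mV P measurableT)//; last first.
  by move=> y _; exact: integral_ge0.
rewrite preimage_setT; apply: eq_integral => w' _ /=.
rewrite (ge0_integral_pushforward mU P measurableT)// ?preimage_setT//.
by apply: measurableT_comp => //; exact: measurable_fun_pair.
Qed.

Lemma independent_pair (d d1 d2 : measure_display) (T : measurableType d)
    (T1 : measurableType d1) (T2 : measurableType d2) (R : realType)
    (P : probability T R) (V1 : T -> T1) (V2 : T -> T2) (H K : set T) (p : R) :
  measurable_fun setT V1 -> measurable_fun setT V2 ->
  measurable H -> measurable K -> 0 <= p ->
  (forall B C, measurable B -> measurable C ->
    P (H `&` (V1 @^-1` B `&` V2 @^-1` C)) =
    (p%:E * P (K `&` (V1 @^-1` B `&` V2 @^-1` C)))%E) ->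
  forall E, measurable E ->
    P (H `&` (fun w => (V1 w, V2 w)) @^-1` E) =
    (p%:E * P (K `&` (fun w => (V1 w, V2 w)) @^-1` E))%E.
Proof.
move=> mV1 mV2 mH mK p0 HK E mE.
have mV : measurable_fun setT (fun w => (V1 w, V2 w)) by exact: measurable_fun_pair.
pose mH' := image_measure (mrestr P mH) mV.
pose mK' := mscale (NngNum p0) (image_measure (mrestr P mK) mV).
suff EE : mH' E = mK' E by rewrite setIC (setIC K); exact: EE.
pose G : set (set (T1 * T2)) := [set A `*` B | A in measurable & B in measurable].
apply: (measure_unique G (fun=> setT)) => //.
- exact: measurable_prod_measurableType.
- move=> _ _ [A mA [B mB <-]] [A' mA' [B' mB' <-]]; rewrite -setXI.
  by exists (A `&` A'); [exact: measurableI|exists (B `&` B') => //; exact: measurableI].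
- by move=> _; exists setT => //; exists setT => //; rewrite setXTT.
- by rewrite bigcup_const//; exists 0%N.
- move=> _ [A mA [B mB <-]].
  by have := HK A B mA mB; rewrite setIC (setIC K).
- move=> _; apply: le_lt_trans (ltry 1).
  rewrite /mH'/= /pushforward /mrestr/=; apply: probability_le1.
  by apply: measurableI => //; rewrite preimage_setT.
Qed.

Lemma mutual_indep_fam4 (d : measure_display) (T : measurableType d) (R : realType)
    (P : probability T R) (W S G1 G2 : T -> R) :
  mutual_indep P (fam4 W S G1 G2) ->
  forall A B C D : set R, measurable A -> measurable B -> measurable C -> measurable D ->
  fine (P (W @^-1` A `&` (S @^-1` B `&` (G1 @^-1` C `&` G2 @^-1` D)))) =
  fine (P (W @^-1` A)) * (fine (P (S @^-1` B)) *
    (fine (P (G1 @^-1` C)) * fine (P (G2 @^-1` D)))).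
Proof.
move=> ind A B C D mA mB mC mD.
pose F (i : 'I_4) := match val i with 0 => A | 1 => B | 2 => C | _ => D end%N.
have mF i : measurable (F i) by rewrite /F; case: i => [[|[|[|[|]]]]].
have := ind (enum 'I_4) F (enum_uniq _) mF.
rewrite big_enum/= !big_ord_recl big_ord0 mulr1 => <-.
congr (fine (P _)); apply/seteqP; split => w /=.
  by move=> [wA [wB [wC wD]]] [[|[|[|[|]]]]].
move=> H; have HF i := H i (mem_enum _ i).
have H0 := HF (inord 0); have H1 := HF (inord 1); have H2 := HF (inord 2); have H3 := HF (inord 3).
by move: H0 H1 H2 H3; rewrite /F /fam4 /= !inordK.
Qed.

Lemma independent_fam4 (d : measure_display) (T : measurableType d) (R : realType)
    (P : probability T R) (W S G1 G2 : T -> R) :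
  measurable_fun setT W -> measurable_fun setT S ->
  measurable_fun setT G1 -> measurable_fun setT G2 ->
  mutual_indep P (fam4 W S G1 G2) ->
  [/\ forall A E, measurable A -> measurable E ->
        P (W @^-1` A `&` (fun w => (S w, (G1 w, G2 w))) @^-1` E) =
        (P (W @^-1` A) * P ((fun w => (S w, (G1 w, G2 w))) @^-1` E))%E,
      forall A E, measurable A -> measurable E ->
        P (S @^-1` A `&` (fun w => (G1 w, G2 w)) @^-1` E) =
        (P (S @^-1` A) * P ((fun w => (G1 w, G2 w)) @^-1` E))%E &
      forall A E, measurable A -> measurable E ->
        P (G2 @^-1` A `&` G1 @^-1` E) = (P (G2 @^-1` A) * P (G1 @^-1` E))%E].
Proof.
move=> mW mS mG1 mG2 /mutual_indep_fam4 ind.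
have mpre (Y : T -> R) A : measurable_fun setT Y -> measurable A -> measurable (Y @^-1` A).
  by move=> mY mA; rewrite -[X in measurable X]setTI; exact: mY.
have fE A : measurable A -> (fine (P A))%:E = P A.
  by move=> mA; rewrite fineK// fin_num_measure.
have PT : fine (P setT) = 1 by rewrite probability_setT.
have ind2 C D : measurable C -> measurable D ->
    P (G1 @^-1` C `&` G2 @^-1` D) = (P (G1 @^-1` C) * P (G2 @^-1` D))%E.
  move=> mC mD; have := ind setT setT C D measurableT measurableT mC mD.
  rewrite !preimage_setT !setTI PT !mul1r => /(congr1 (@EFin R)).
  by rewrite EFinM !fE//; [exact: mpre..|apply: measurableI; exact: mpre].
have ind3 B C D : measurable B -> measurable C -> measurable D ->
    P (S @^-1` B `&` (G1 @^-1` C `&` G2 @^-1` D)) =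
    (P (S @^-1` B) * (P (G1 @^-1` C `&` G2 @^-1` D)))%E.
  move=> mB mC mD; have := ind setT B C D measurableT mB mC mD.
  rewrite !preimage_setT !setTI PT !mul1r => /(congr1 (@EFin R)).
  rewrite !EFinM !fE// ?ind2//; try exact: mpre.
  by apply: measurableI; [|apply: measurableI]; exact: mpre.
split.
- move=> A E mA mE.
  have H1 B E' : measurable B -> measurable E' ->
    P ((W @^-1` A `&` S @^-1` B) `&` (fun w => (G1 w, G2 w)) @^-1` E') =
    ((fine (P (W @^-1` A)))%:E * P (S @^-1` B `&` (fun w => (G1 w, G2 w)) @^-1` E'))%E.
    move=> mB; apply: (independent_pair mG1 mG2) => //.
    + by apply: measurableI; exact: mpre.
    + exact: mpre.
    + exact: fine_ge0.
    move=> C D mC mD; rewrite ind3// ind2//.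
    have /(congr1 (@EFin R)) := ind A B C D mA mB mC mD.
    rewrite !EFinM !fE//; try exact: mpre; first by rewrite setIA.
    by apply: measurableI; [|apply: measurableI; [|apply: measurableI]]; exact: mpre.
  have := @independent_pair _ _ _ _ _ _ _ P S (fun w => (G1 w, G2 w)) (W @^-1` A) setT
    (fine (P (W @^-1` A))) mS (measurable_fun_pair mG1 mG2) (mpre _ _ mW mA) measurableT
    (fine_ge0 (measure_ge0 _ _)) _ E mE.
  rewrite setTI fE; last exact: mpre.
  apply => B E' mB mE'; rewrite setIA H1// setTI fE//; exact: mpre.
- move=> A E mA mE.
  have := @independent_pair _ _ _ _ _ _ _ P G1 G2 (S @^-1` A) setT
    (fine (P (S @^-1` A))) mG1 mG2 (mpre _ _ mS mA) measurableT
    (fine_ge0 (measure_ge0 _ _)) _ E mE.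
  rewrite setTI fE; last exact: mpre.
  by apply => C D mC mD; rewrite setTI ind3// fE//; exact: mpre.
- by move=> A E mA mE; rewrite setIC ind2// muleC.
Qed.

Section density_measure.
Variables (R : realType) (g : R -> R).
Hypotheses (mg : measurable_fun setT g) (g0 : forall x, 0 <= g x).
Let m (A : set (measurableTypeR R)) : \bar R :=
  (\int[lebesgue_measure]_(x in A) (g x)%:E)%E.

Let m0 : m set0 = 0%E. Proof. exact: integral_set0. Qed.

Let m_ge0 A : (0 <= m A)%E.
Proof. by apply: integral_ge0 => x _; rewrite lee_fin. Qed.

Let m_sigma_additive : semi_sigma_additive m.
Proof.
move=> F mF tF mUF; rewrite /m ge0_integral_bigcup//; last 2 first.
- by apply: measurable_funTS; exact/measurable_EFinP.
- by move=> x _; rewrite lee_fin.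
apply: is_cvg_nneseries => n _ _; exact: m_ge0.
Qed.

Definition density_measure : {measure set (measurableTypeR R) -> \bar R} :=
  HB.pack m (isMeasure.Build _ _ _ m m0 m_ge0 m_sigma_additive).

Lemma density_measureE A :
  density_measure A = (\int[lebesgue_measure]_(x in A) (g x)%:E)%E.
Proof. by []. Qed.

End density_measure.

Lemma has_density_tails (d : measure_display) (T : measurableType d) (R : realType)
    (P : probability T R) (Y : T -> R) (g : R -> R) :
  measurable_fun setT Y -> measurable_fun setT g -> (forall x, 0 <= g x) ->
  (forall x, P (Y @^-1` `]x, +oo[%classic) =
    (\int[lebesgue_measure]_(z in `]x, +oo[) (g z)%:E)%E) ->
  has_density P Y g.
Proof.
move=> mY mg g0 tails B mB.
have mY' : measurable_fun setT (Y : T -> measurableTypeR R) := mY.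
rewrite -(density_measureE mg g0).
apply: (@measure_unique _ _ (measurableTypeR R) (@RGenOInfty.G R)
  (fun n => `](- n%:R), +oo[%classic) _ _ _ _ (image_measure P mY') _ _ _ B mB).
- exact: RGenOInfty.measurableE.
- move=> _ _ [x ->] [y ->]; exists (Num.max x y).
  by apply/seteqP; split => z /=; rewrite !in_itv/= !andbT gt_max; [move=> [-> ->]|move=> /andP].
- by move=> n; exists (- n%:R).
- apply/seteqP; split => // x _; exists (Num.truncn `|x|).+1 => //=.
  rewrite in_itv/= andbT ltrNl (le_lt_trans (ler_norm _))// normrN.
  exact: truncnS_gt.
- by move=> _ [x ->]; exact: tails.
- move=> n; apply: le_lt_trans (ltry 1).
  by apply: probability_le1; rewrite -[X in measurable X]setTI; exact: mY.
Qed.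

Lemma has_density_pos_tails (d : measure_display) (T : measurableType d) (R : realType)
    (P : probability T R) (Y : T -> R) (g : R -> R) :
  measurable_fun setT Y -> measurable_fun setT g -> (forall x, 0 <= g x) ->
  (forall x, x <= 0 -> g x = 0) -> {ae P, forall w, 0 < Y w} ->
  (forall x, 0 < x -> P (Y @^-1` `]x, +oo[%classic) =
    (\int[lebesgue_measure]_(z in `]x, +oo[) (g z)%:E)%E) ->
  has_density P Y g.
Proof.
move=> mY mg g0 gneg Ypos tails; apply: has_density_tails => // x.
have [x0|x0] := ltP 0 x; first exact: tails.
have mY' : measurable_fun setT (Y : T -> measurableTypeR R) := mY.
have mpre A : measurable A -> measurable (Y @^-1` A).
  by move=> mA; rewrite -[X in measurable X]setTI; exact: mY.
have P1 y : y <= 0 -> P (Y @^-1` `]y, +oo[%classic) = 1%E.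
  move=> y0; have [N [mN N0 HN]] := Ypos.
  have mA : measurable (Y @^-1` `]y, +oo[%classic) by exact: mpre.
  rewrite -[Y @^-1` _]setCK probability_setC; last exact: measurableC.
  rewrite (subset_measure0 _ mN _ N0) ?sube0//; first exact: measurableC.
  move=> w /=; rewrite in_itv/= andbT => /negP; rewrite -leNgt => Yw.
  by apply: HN => /=; apply/negP; rewrite -leNgt (le_trans Yw).
rewrite P1//; apply/esym.
pose F n : set (measurableTypeR R) := `]n.+1%:R^-1, +oo[%classic.
have UF : \bigcup_n F n = `]0, +oo[%classic.
  apply/seteqP; split => [z [n _]|z]; rewrite /F /= !in_itv/= !andbT.
    by apply: lt_trans; rewrite invr_gt0.
  move=> z0; exists (Num.truncn z^-1) => //=; rewrite in_itv/= andbT.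
  by rewrite invf_plt ?posrE// truncnS_gt.
have mF n : measurable (F n) by exact: measurable_itv.
have ndF : nondecreasing_seq F.
  apply/nondecreasing_seqP => n; rewrite subsetEset => z; rewrite /F/= !in_itv/= !andbT.
  by apply: le_lt_trans; rewrite lef_pV2 ?posrE// ler_nat.
have mUF : measurable (\bigcup_n F n) by rewrite UF; exact: measurable_itv.
have c1 := nondecreasing_cvg_mu (mu := image_measure P mY') mF mUF ndF.
have c2 := nondecreasing_cvg_mu (mu := density_measure mg g0) mF mUF ndF.
have E : image_measure P mY' \o F = density_measure mg g0 \o F.
  by apply/funext => n; apply: tails; rewrite invr_gt0.
rewrite E in c1.
have E0 : (\int[lebesgue_measure]_(z in `]0%R, +oo[) (g z)%:E)%E = 1%E.
  rewrite -density_measureE -UF -(cvg_lim _ c2)// (cvg_lim _ c1)//.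
  by rewrite UF; exact: P1.
rewrite -E0 integral_mkcond [RHS]integral_mkcond; apply: eq_integral => z _.
rewrite !patchE; have [z0|z0] := ltP 0 z.
  by rewrite !mem_set//= in_itv/= andbT// (le_lt_trans x0).
by rewrite [g z]gneg//; do 2 case: ifPn.
Qed.

Section densities.
Variable R : realType.

Lemma measurable_pos_part (f : R -> R) : measurable_fun setT f ->
  measurable_fun setT (fun x : R => if 0 < x then f x else 0).
Proof. by move=> mf; apply: measurable_fun_ifT => //; exact: measurable_fun_ltr. Qed.

Lemma measurable_gamma_density (s : R) : measurable_fun setT (gamma_density s).
Proof.
apply: measurable_pos_part; apply: measurable_funM => //; apply: measurable_funM.
  exact: measurable_powR.
by apply: measurableT_comp => //; exact: oppr_measurable.
Qed.

Lemma gammaf_ge0 (s : R) : 0 <= gammaf s.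
Proof. by apply: Rintegral_ge0 => x _; rewrite mulr_ge0 ?powR_ge0 ?expR_ge0. Qed.

Lemma gamma_density_ge0 (s x : R) : 0 <= gamma_density s x.
Proof.
rewrite /gamma_density; case: ifPn => // _.
by rewrite divr_ge0 ?gammaf_ge0// mulr_ge0 ?powR_ge0 ?expR_ge0.
Qed.

Lemma measurable_gg_density (r a l : R) : measurable_fun setT (gg_density r a l).
Proof.
apply: measurable_pos_part; apply: measurable_funM.
  by apply: measurable_funM => //; exact: measurable_powR.
apply: measurableT_comp => //; apply: measurable_funM => //; exact: measurable_powR.
Qed.

Lemma gg_density_ge0 (r a l x : R) : 0 <= gg_density r a l x.
Proof.
rewrite /gg_density; case: ifPn => // _.
by rewrite !mulr_ge0 ?powR_ge0 ?expR_ge0// invr_ge0 gammaf_ge0.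
Qed.

Lemma has_density_total (d : measure_display) (T : measurableType d)
    (P : probability T R) (Y : T -> R) (g : R -> R) :
  has_density P Y g -> (\int[lebesgue_measure]_x (g x)%:E = 1)%E.
Proof.
by move=> /(_ setT measurableT) <-; rewrite preimage_setT probability_setT.
Qed.

Lemma has_density_gt0 (d : measure_display) (T : measurableType d)
    (P : probability T R) (Y : T -> R) (g : R -> R) :
  measurable_fun setT Y -> (forall x, x <= 0 -> g x = 0) -> has_density P Y g ->
  {ae P, forall w, 0 < Y w}.
Proof.
move=> mY g0 dY; exists (Y @^-1` `]-oo, 0]%classic); split.
- by rewrite -[X in measurable X]setTI; apply: mY => //; exact: measurable_itv.
- rewrite dY; last exact: measurable_itv.
  by apply: integral0_eq => x; rewrite /= in_itv/= => x0; rewrite g0.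
- by move=> w /negP; rewrite -leNgt /= in_itv.
Qed.

Lemma gamma_density_gammaf (s : R) :
  (\int[lebesgue_measure]_x (gamma_density s x)%:E = 1)%E -> 0 < gammaf s.
Proof.
move=> H; rewrite lt_def gammaf_ge0 andbT; apply/eqP => s0.
move: H; rewrite integral0_eq; first by move=> [] /eqP; rewrite eq_sym oner_eq0.
by move=> x _; rewrite /gamma_density s0 invr0 mulr0; case: ifP.
Qed.

Lemma gamma_density_laplace (q s : R) :
  (\int[lebesgue_measure]_x (gamma_density q x)%:E = 1)%E -> 0 <= s ->
  (\int[lebesgue_measure]_x ((expR (- (s * x)))%:E * (gamma_density q x)%:E) =
   ((1 + s) `^ (- q))%:E)%E.
Proof.
move=> H s0; have k0 : 0 < 1 + s by rewrite ltr_pwDl.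
have mE : measurable_fun setT (EFin \o gamma_density q).
  by apply/measurable_EFinP; exact: measurable_gamma_density.
have ge0E x : (0 <= (EFin \o gamma_density q) x)%E by rewrite lee_fin gamma_density_ge0.
have := ge0_integral_affine 0 k0 mE ge0E; rewrite /= H => E.
have E2 : ((1 + s)^-1%:E =
    \int[lebesgue_measure]_x (gamma_density q ((1 + s) * x + 0))%:E)%E.
  by rewrite -[LHS]mule1 E muleA -EFinM mulVf ?gt_eqF// mul1e.
transitivity (\int[lebesgue_measure]_x
    (((1 + s) `^ (1 - q))%:E * (gamma_density q ((1 + s) * x + 0))%:E))%E.
  apply: eq_integral => x _; rewrite -!EFinM; congr EFin.
  rewrite /gamma_density addr0 pmulr_rgt0//; case: ifPn => [x0|_]; last by rewrite !mulr0.
  rewrite powRM ?(ltW x0) ?(ltW k0)// -[1 - q]opprB powRN mulrDl mul1r opprD expRD.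
  by field; rewrite !gt_eqF ?powR_gt0// gamma_density_gammaf.
rewrite ge0_integralZl//; last 3 first.
- apply/measurable_EFinP.
  apply: (measurableT_comp (measurable_gamma_density q)).
  by apply: measurable_funD => //; exact: mulrl_measurable.
- by move=> x _; rewrite lee_fin gamma_density_ge0.
- by rewrite lee_fin powR_ge0.
rewrite -E2 -EFinM; congr EFin; rewrite -[(1 + s)^-1]powR_inv1 ?(ltW k0)//.
by rewrite -powRD ?(gt_eqF k0) ?implybT//; congr (_ `^ _); ring.
Qed.

Lemma exp_density_tail (t : R) : 0 <= t ->
  (\int[lebesgue_measure]_(x in `]t, +oo[) (exp_density x)%:E = (expR (- t))%:E)%E.
Proof.
move=> t0.
have cE : continuous (fun x : R => expR (- x)).
  by move=> x; apply: continuous_comp; [exact: opp_continuous|exact: continuous_expR].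
have dG (x : R) : is_derive x 1 (fun x => - expR (- x)) (expR (- x)).
  have D : is_derive x 1 (expR \o -%R) (expR (- x) * (-1)).
    by apply: is_derive1_comp.
  have D2 : is_derive x 1 (fun x => expR (- x)) (expR (- x) * (-1)) := D.
  by apply: is_derive_eq; ring.
transitivity (\int[lebesgue_measure]_(x in `[t, +oo[) (expR (- x))%:E)%E.
  rewrite -integral_itv_obnd_cbnd; last first.
    by apply: measurable_funTS; apply/measurable_EFinP; exact: continuous_measurable_fun.
  apply: eq_integral => x; rewrite inE/= in_itv/= andbT => tx.
  by rewrite /exp_density ifT// (le_trans t0)// ltW.
rewrite (@ge0_continuous_FTC2y _ _ (fun x => - expR (- x)) t 0)//.
- by rewrite -EFinB; congr EFin; ring.
- exact/continuous_subspaceT.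
- by rewrite -oppr0; apply: cvgN; exact: cvgr_expR.
- by apply: cvg_at_right_filter; apply: cvgN; exact: cE.
- by move=> x _; rewrite derive1E; apply: derive_val.
Qed.

End densities.

(** * The mixed exponential representation *)

Lemma cvgy_powR (R : realType) (b : R) : 0 < b -> z `^ b @[z --> +oo] --> +oo.
Proof.
move=> b0; apply/cvgryPge => A.
near=> z.
have A1 : A <= Num.max A 0 by rewrite le_max lexx.
rewrite (le_trans A1)//.
have -> : Num.max A 0 = ((Num.max A 0) `^ b^-1) `^ b.
  by rewrite -powRrM mulVf ?gt_eqF// powRr1// le_max lexx orbT.
by rewrite ge0_ler_powR ?nnegrE ?powR_ge0 ?(ltW b0).
Unshelve. all: end_near. Qed.

Lemma cvgy_powRN (R : realType) (b : R) : 0 < b -> z `^ (- b) @[z --> +oo] --> (0 : R).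
Proof.
move=> b0; under eq_fun do rewrite powRN.
apply/gtr0_cvgV0; last exact: cvgy_powR.
by near=> z; rewrite powR_gt0.
Unshelve. all: end_near. Qed.

Lemma continuous_powR (R : realType) (b u : R) : 0 < u ->
  {for u, continuous (fun x : R => x `^ b)}.
Proof.
move=> u0; apply: differentiable_continuous; apply/derivable1_diffP.
by apply: derivable_powR; rewrite in_itv/= andbT.
Qed.

Section substitution.
Variables (R : realType) (c r a : R).
Hypotheses (c0 : 0 < c) (a0 : 0 < a) (a1 : a < 1).
Let F (z : R) := (z / c) `^ a.
Let F' (z : R) := a * (z / c) `^ (a - 1) / c.

Let is_derive_F (z : R) : 0 < z -> is_derive z 1 F (F' z).
Proof.
move=> z0; have zc : 0 < z / c by rewrite divr_gt0.
have d1 : is_derive z 1 (fun z => z / c) c^-1.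
  by apply: is_derive_eq; rewrite /GRing.scale/=; ring.
have d2 : is_derive z 1 ((fun u : R => u `^ a) \o (fun z : R => z / c)) (a * (z / c) `^ (a - 1) * c^-1).
  by apply: is_derive1_comp; exact: is_derive1_powR.
exact: d2.
Qed.

Let continuous_F' (z : R) : 0 < z -> {for z, continuous F'}.
Proof.
move=> z0; apply: cvgM; last exact: cvg_cst.
apply: cvgM; first exact: cvg_cst.
apply: (@continuous_comp R R R (fun z => z / c) (fun u => u `^ (a - 1))).
  by apply: cvgM; [exact: cvg_id|exact: cvg_cst].
by apply: continuous_powR; rewrite divr_gt0.
Qed.

Let derive_F (z : R) : 0 < z -> derive1 F z = F' z.
Proof. by move=> z0; rewrite derive1E; apply: derive_val; exact: is_derive_F. Qed.

Lemma gg_density_tail (x : R) : 0 < x ->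
  (\int[lebesgue_measure]_(z in `]x, +oo[) (gg_density r a (c `^ (- a)) z)%:E =
   \int[lebesgue_measure]_(u in `]((x / c) `^ a)%R, +oo[) (gamma_density r u)%:E)%E.
Proof.
move=> x0.
have Fx0 : 0 < F x by rewrite powR_gt0// divr_gt0.
have cF (z : R) : 0 < z -> {for z, continuous F}.
  move=> z0; apply: differentiable_continuous; apply/derivable1_diffP.
  exact: (@ex_derive _ _ _ _ _ _ _ (is_derive_F z0)).
have cG (u : R) : 0 < u -> {for u, continuous (gamma_density r)}.
  move=> u0.
  have H : {for u, continuous (fun x : R => x `^ (r - 1) * expR (- x) / gammaf r)}.
    apply: cvgM; last exact: cvg_cst.
    apply: cvgM; last first.
      by apply: continuous_comp; [exact: opp_continuous|exact: continuous_expR].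
    exact: continuous_powR.
  rewrite /prop_for /continuous_at.
  have -> : gamma_density r u = u `^ (r - 1) * expR (- u) / gammaf r.
    by rewrite /gamma_density u0.
  apply: cvg_trans H; apply: near_eq_cvg; near=> y.
  by rewrite /gamma_density ifT//; near: y; exact: lt_nbhsr.
rewrite integral_itv_obnd_cbnd; last first.
  by apply: measurable_funTS; apply/measurable_EFinP; exact: measurable_gg_density.
rewrite [RHS]integral_itv_obnd_cbnd; last first.
  by apply: measurable_funTS; apply/measurable_EFinP; exact: measurable_gamma_density.
rewrite (@increasing_ge0_integration_by_substitutiony _ F (gamma_density r) x).
- apply: eq_integral => z; rewrite inE/= in_itv/= andbT => xz.
  have z0 : 0 < z by exact: lt_le_trans xz.
  have H b : (z / c) `^ b = z `^ b * c `^ (- b).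
    by rewrite powRM ?invr_ge0 ?(ltW z0) ?(ltW c0)// -powR_inv1 ?(ltW c0)// -powRrM mulN1r.
  congr EFin; change (gg_density r a (c `^ (- a)) z = gamma_density r (F z) * derive1 F z).
  rewrite derive_F// /gg_density /gamma_density z0 powR_gt0 ?divr_gt0//.
  rewrite /F' /F (gtr0_norm a0) -!powRrM !H -[c^-1]powR_inv1 ?(ltW c0)//.
  have -> : z `^ (a * r - 1) = z `^ (a * (r - 1)) * z `^ (a - 1).
    by rewrite -powRD ?(gt_eqF z0) ?implybT//; congr (_ `^ _); ring.
  have -> : c `^ (- a * r) = c `^ (- (a * (r - 1))) * c `^ (- (a - 1)) * c `^ (-1).
    by rewrite -!powRD ?(gt_eqF c0) ?implybT//; congr (_ `^ _); ring.
  have -> : expR (- c `^ (- a) * z `^ a) = expR (- (z `^ a * c `^ (- a))).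
    by congr expR; ring.
  by ring.
- move=> y z; rewrite !in_itv/= !andbT => xy xz yz.
  have y0 : 0 < y by exact: lt_le_trans xy.
  by rewrite gt0_ltr_powR ?nnegrE ?divr_ge0 ?(ltW c0) ?(ltW y0) ?(ltW (lt_trans y0 yz))// ltr_pM2r// invr_gt0.
- move=> z; rewrite in_itv/= andbT => xz; have z0 := lt_trans x0 xz.
  rewrite /prop_for /continuous_at derive_F//; apply: cvg_trans (continuous_F' z0).
  apply: near_eq_cvg; near=> y; rewrite derive_F//.
  by near: y; exact: lt_nbhsr.
- apply/cvg_ex; exists (F' x).
  apply: (@cvg_trans _ (F' y @[y --> x^'+])).
    apply: near_eq_cvg; near=> y; rewrite derive_F//.
    by rewrite (lt_trans x0)//.
  by apply: cvg_at_right_filter; exact: continuous_F'.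
- apply/cvg_ex; exists (a * 0 / c).
  apply: (@cvg_trans _ (F' y @[y --> +oo])).
    by apply: near_eq_cvg; near=> y; rewrite derive_F.
  apply: cvgM; last exact: cvg_cst.
  apply: cvgM; first exact: cvg_cst.
  rewrite -opprB; apply: (@cvg_comp R R R (fun z => z / c) (fun z => z `^ (- (1 - a))) _ (pinfty_nbhs R)); last first.
    by apply: cvgy_powRN; rewrite subr_gt0.
  by apply: gt0_cvgMly => //; rewrite invr_gt0.
- split.
    move=> z; rewrite in_itv/= andbT => xz.
    exact: (@ex_derive _ _ _ _ _ _ _ (is_derive_F (lt_trans x0 xz))).
  by apply: cvg_at_right_filter; exact: cF.
- apply: (@cvg_comp R R R (fun z => z / c) (fun z => z `^ a) _ (pinfty_nbhs R)); last exact: cvgy_powR.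
  by apply: gt0_cvgMly => //; rewrite invr_gt0.
- apply/continuous_within_itvcyP; split.
    by move=> u; rewrite in_itv/= andbT => Fu; apply: cG; exact: lt_trans Fu.
  by apply: cvg_at_right_filter; exact: cG.
- by move=> u _; exact: gamma_density_ge0.
Unshelve. all: end_near. Qed.

End substitution.

Section mixed_exponential.
Context {d : measure_display} {T : measurableType d} {R : realType}.
Variables (P : probability T R) (W S G1 G2 : T -> R) (c r a : R).
Hypotheses (c0 : 0 < c) (a0 : 0 < a) (a1 : a < 1).
Hypotheses (mW : measurable_fun setT W) (mS : measurable_fun setT S)
  (mG1 : measurable_fun setT G1) (mG2 : measurable_fun setT G2).
Hypothesis ind : mutual_indep P (fam4 W S G1 G2).
Hypotheses (dW : has_density P W (@exp_density R))
  (dG1 : has_density P G1 (gamma_density r))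
  (dG2 : has_density P G2 (gamma_density (1 - r))).
Hypothesis char_fun : forall t : R,
  (\int[P]_w (cos (t * S w))%:E)%E =
    (expR (- (`|t| `^ a * cos (pi * a / 2)))
     * cos (`|t| `^ a * Num.sg t * sin (pi * a / 2)))%:E /\
  (\int[P]_w (sin (t * S w))%:E)%E =
    (expR (- (`|t| `^ a * cos (pi * a / 2)))
     * sin (`|t| `^ a * Num.sg t * sin (pi * a / 2)))%:E.

Let gneg (s x : R) : x <= 0 -> gamma_density s x = 0.
Proof. by move=> x0; rewrite /gamma_density ltNge x0. Qed.

Let G1_gt0 : {ae P, forall w, 0 < G1 w}.
Proof. exact: has_density_gt0 mG1 (gneg _) dG1. Qed.

Let G2_gt0 : {ae P, forall w, 0 < G2 w}.
Proof. exact: has_density_gt0 mG2 (gneg _) dG2. Qed.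

Let S_gt0 : {ae P, forall w, 0 < S w}.
Proof. exact: stable_gt0 mS a0 a1 char_fun. Qed.

Let Zf (g : R * R) := 1 + `|g.2| / `|g.1|.

Let Zf_gt0 g : 0 < Zf g.
Proof. by rewrite ltr_pwDl// divr_ge0. Qed.

Let mZf : measurable_fun setT Zf.
Proof.
apply: measurable_funD => //; apply: measurable_funM.
  by apply: measurableT_comp => //; exact: measurable_snd.
apply: (measurableT_comp (@measurable_invr R)).
by apply: measurableT_comp => //; exact: measurable_fst.
Qed.

Let integral_indic_comp (U : T -> R) (A : set R) : measurable_fun setT U -> measurable A ->
  (\int[P]_w (\1_A (U w))%:E = P (U @^-1` A))%E.
Proof.
move=> mU mA; transitivity (\int[P]_w (\1_(U @^-1` A) w)%:E)%E; first exact: eq_integral.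
rewrite integral_indic ?setIT//.
by rewrite -[X in measurable X]setTI; exact: mU.
Qed.

Let gt_itv (t : R) : [set x : R | t < x] = `]t, +oo[%classic.
Proof. by apply/seteqP; split => x; rewrite /= in_itv/= andbT. Qed.

Let W_tail (t : R) : 0 <= t ->
  (\int[P]_w (\1_[set x : R | t < x] (W w))%:E = (expR (- t))%:E)%E.
Proof.
move=> t0; rewrite gt_itv (integral_indic_comp mW (measurable_itv _)).
by rewrite dW ?exp_density_tail//; exact: measurable_itv.
Qed.

Let W_gt0 : {ae P, forall w, 0 < W w}.
Proof.
have mA : measurable (W @^-1` [set x | 0 < x]).
  by rewrite gt_itv -[X in measurable X]setTI; apply: mW => //; exact: measurable_itv.
have := W_tail (lexx 0); rewrite gt_itv (integral_indic_comp mW (measurable_itv _)).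
rewrite -gt_itv oppr0 expR0 => PW; exists (~` (W @^-1` [set x | 0 < x])); split => //.
- exact: measurableC.
- by rewrite probability_setC// PW subee.
Qed.

Let Y w := c * W w / (S w * ((G1 w + G2 w) / G1 w) `^ a^-1).

Let mY : measurable_fun setT Y.
Proof.
apply: measurable_funM; first exact: measurable_funM.
apply: (measurableT_comp (@measurable_invr R)); apply: measurable_funM => //.
apply: (measurableT_comp (@measurable_powR R a^-1)).
apply: measurable_funM; first exact: measurable_funD.
exact: (measurableT_comp (@measurable_invr R)).
Qed.

Let f1 (t : R) (z : R * (R * (R * R))) : \bar R :=
  (\1_[set q : R | 0 < q] (z.1 - t * Zf z.2.2 `^ a^-1 * `|z.2.1|))%:E.

Let f2 (t : R) (z : R * (R * R)) : \bar R :=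
  (expR (- (t * Zf z.2 `^ a^-1 * `|z.1|)))%:E.

Let f3 (y : R) (z : R * R) : \bar R :=
  (expR (- (y / `|z.2| * `|z.1|)))%:E.

Let f1_ge0 t z : (0 <= f1 t z)%E.
Proof. by rewrite lee_fin indicE ler0n. Qed.

Let f2_ge0 t z : (0 <= f2 t z)%E. Proof. by rewrite lee_fin expR_ge0. Qed.

Let f3_ge0 y z : (0 <= f3 y z)%E. Proof. by rewrite lee_fin expR_ge0. Qed.

Let mQ t : measurable_fun setT (fun g => t * Zf g `^ a^-1).
Proof. by apply: measurable_funM => //; exact: (measurableT_comp (@measurable_powR R a^-1)). Qed.

Let mf1 t : measurable_fun setT (f1 t).
Proof.
apply/measurable_EFinP; apply: (@measurableT_comp _ _ _ _ _ _ (\1_[set q : R | 0 < q] : R -> R)).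
  by apply: measurable_indic; rewrite gt_itv; exact: measurable_itv.
apply: measurable_funB; first exact: measurable_fst.
have m2 : measurable_fun setT (fun z : R * (R * (R * R)) => z.2) by exact: measurable_snd.
apply: measurable_funM.
  by apply: (measurableT_comp (mQ t)); exact: (measurableT_comp measurable_snd m2).
by apply: measurableT_comp => //; exact: (measurableT_comp measurable_fst m2).
Qed.

Let mf2 t : measurable_fun setT (f2 t).
Proof.
apply/measurable_EFinP; apply: measurableT_comp => //; apply: measurableT_comp => //.
apply: measurable_funM; first by apply: (measurableT_comp (mQ t)); exact: measurable_snd.
by apply: measurableT_comp => //; exact: measurable_fst.
Qed.

Let mf3 t : measurable_fun setT (f3 t).
Proof.
apply/measurable_EFinP; apply: measurableT_comp => //; apply: measurableT_comp => //.
apply: measurable_funM; last by apply: measurableT_comp => //; exact: measurable_fst.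
apply: measurable_funM => //; apply: (measurableT_comp (@measurable_invr R)).
by apply: measurableT_comp => //; exact: measurable_snd.
Qed.

Let mG : measurable_fun setT (fun w => (G1 w, G2 w)).
Proof. exact: measurable_fun_pair. Qed.

Let mSG : measurable_fun setT (fun w => (S w, (G1 w, G2 w))).
Proof. exact: measurable_fun_pair. Qed.

Let tail_integral x : 0 < x -> (P (Y @^-1` `]x, +oo[%classic) =
  \int[P]_w f1 (x / c) (W w, (S w, (G1 w, G2 w))))%E.
Proof.
move=> x0; rewrite -(integral_indic_comp mY (measurable_itv _)).
apply: ge0_ae_eq_integral => //.
- apply/measurable_EFinP.
  have mi : measurable_fun setT (\1_`]x, +oo[%classic : R -> R).
    by apply: measurable_indic; exact: measurable_itv.
  exact: (measurableT_comp mi mY).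
- apply: (measurableT_comp (mf1 (x / c))); exact: measurable_fun_pair.
suff AE : {ae P, forall w, setT w -> (\1_`]x, +oo[%classic (Y w))%:E =
    f1 (x / c) (W w, (S w, (G1 w, G2 w)))} by exact: AE.
apply: filterS2 S_gt0 (filterI G1_gt0 G2_gt0) => w Sw [G1w G2w] _.
rewrite /f1/= !indicE; congr (nat_of_bool _)%:R%:E.
have Q0 : 0 < Zf (G1 w, G2 w) `^ a^-1 by rewrite powR_gt0.
have ZE : (G1 w + G2 w) / G1 w = Zf (G1 w, G2 w).
  by rewrite /Zf/= !gtr0_norm//; field; rewrite gt_eqF.
have E : (x < Y w) = (0 < W w - x / c * Zf (G1 w, G2 w) `^ a^-1 * `|S w|).
  rewrite /Y ZE ltr_pdivlMr ?mulr_gt0// subr_gt0 (gtr0_norm Sw).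
  rewrite -[RHS](ltr_pM2l c0); congr (_ < _); field; by rewrite gt_eqF.
by apply/idP/idP; rewrite !inE/= in_itv/= andbT E.
Qed.

Let integrate_W t : 0 < t -> (\int[P]_w f1 t (W w, (S w, (G1 w, G2 w))) =
  \int[P]_w f2 t (S w, (G1 w, G2 w)))%E.
Proof.
move=> t0; have [H _ _] := independent_fam4 mW mS mG1 mG2 ind.
rewrite (integral_independent mW mSG H (mf1 t) (f1_ge0 t)); apply: eq_integral => w' _.
rewrite /f1 /f2/=; set s := t * _ * _.
have s0 : 0 <= s by rewrite !mulr_ge0 ?powR_ge0// ltW.
rewrite -W_tail//; apply: eq_integral => w _; congr EFin; rewrite !indicE.
by congr (nat_of_bool _)%:R; apply/idP/idP; rewrite !inE/= subr_gt0.
Qed.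

Let integrate_S t : 0 < t -> (\int[P]_w f2 t (S w, (G1 w, G2 w)) =
  \int[P]_w ((expR (- (t `^ a)))%:E * f3 (t `^ a) (G2 w, G1 w)))%E.
Proof.
move=> t0; have [_ H _] := independent_fam4 mW mS mG1 mG2 ind.
rewrite (integral_independent mS mG H (mf2 t) (f2_ge0 t)); apply: eq_integral => w' _.
rewrite /f2 /f3/= (laplace_stable mS a0 a1 char_fun); last first.
  by rewrite mulr_gt0// powR_gt0.
rewrite -EFinM -expRD; congr (expR _)%:E.
rewrite powRM ?powR_ge0 ?(ltW t0)// -powRrM mulVf ?gt_eqF// powRr1 ?(ltW (Zf_gt0 _))//.
by rewrite /Zf/=; ring.
Qed.

Let integrate_G2 y : 0 < y -> (\int[P]_w f3 y (G2 w, G1 w) =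
  \int[P]_w ((1 + y / `|G1 w|) `^ (- (1 - r)))%:E)%E.
Proof.
move=> y0; have [_ _ H] := independent_fam4 mW mS mG1 mG2 ind.
rewrite (integral_independent mG2 mG1 H (mf3 y) (f3_ge0 y)); apply: eq_integral => w' _.
have s0 : 0 <= y / `|G1 w'| by rewrite divr_ge0// ltW.
rewrite -gamma_density_laplace//; last exact: has_density_total dG2.
pose e (x : R) : \bar R := (expR (- (y / `|G1 w'| * `|x|)))%:E.
have me : measurable_fun setT e.
  apply/measurable_EFinP; apply: measurableT_comp => //; apply: measurableT_comp => //.
  exact: measurable_funM.
have e0 x : (0 <= e x)%E by rewrite lee_fin expR_ge0.
rewrite [LHS](has_density_integral mG2 (measurable_gamma_density _)
  (gamma_density_ge0 _) dG2 me e0) /e.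
apply: eq_integral => x _; have [x0|x0] := ltP 0 x; first by rewrite (gtr0_norm x0).
by rewrite gneg// !mule0.
Qed.

Let integrate_G1 y : 0 < y -> ((expR (- y))%:E * \int[P]_w ((1 + y / `|G1 w|) `^ (- (1 - r)))%:E =
  \int[lebesgue_measure]_(u in `]y, +oo[) (gamma_density r u)%:E)%E.
Proof.
move=> y0.
have mp : measurable_fun setT (fun x : R => ((1 + y / `|x|) `^ (- (1 - r)))%:E).
  apply/measurable_EFinP; apply: (measurableT_comp (@measurable_powR R _)).
  apply: measurable_funD => //; apply: measurable_funM => //.
  by apply: (measurableT_comp (@measurable_invr R)).
rewrite (has_density_integral mG1 (measurable_gamma_density _) (gamma_density_ge0 _) dG1
  (f := fun x => ((1 + y / `|x|) `^ (- (1 - r)))%:E))//; last first.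
  by move=> x; rewrite lee_fin powR_ge0.
rewrite -ge0_integralZl//; last 2 first.
- apply: emeasurable_funM => //; apply/measurable_EFinP; exact: measurable_gamma_density.
- by move=> x _; rewrite -EFinM lee_fin mulr_ge0 ?powR_ge0 ?gamma_density_ge0.
rewrite [RHS]integral_mkcond.
pose F : R -> \bar R := (fun u => (gamma_density r u)%:E) \_ `]y, +oo[.
rewrite [RHS](@ge0_integral_affine R 1 y F)//; last 2 first.
- apply/measurable_restrict => //.
  by apply: measurable_funTS; apply/measurable_EFinP; exact: measurable_gamma_density.
- by move=> x; rewrite /F patchE; case: ifPn => // _; rewrite lee_fin gamma_density_ge0.
rewrite mul1e; apply: eq_integral => g _.
rewrite /F patchE; have [g0|g0] := ltP 0 g; last first.
  rewrite gneg// !mule0 ifF//; apply/negP; rewrite inE/= in_itv/= andbT mul1r.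
  by rewrite ltNge -lerBrDr subrr g0.
rewrite mem_set/=; last by rewrite in_itv/= andbT mul1r ltrDr.
rewrite -!EFinM mul1r; congr EFin.
have gy : 0 < g + y by rewrite addr_gt0.
rewrite /gamma_density g0 gy (gtr0_norm g0) opprB.
have -> : 1 + y / g = (g + y) / g by field; rewrite gt_eqF.
rewrite powRM ?invr_ge0 ?(ltW gy) ?(ltW g0)// -powR_inv1 ?(ltW g0)// -powRrM.
have -> : g `^ (-1 * (r - 1)) = (g `^ (r - 1))^-1 by rewrite -powRN mulN1r.
rewrite opprD expRD; field.
by rewrite !gt_eqF ?powR_gt0// gamma_density_gammaf//; exact: has_density_total dG1.
Qed.

Lemma gg_mixed_exponential : has_density P Y (gg_density r a (c `^ (- a))).
Proof.
apply: has_density_pos_tails => //.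
- exact: measurable_gg_density.
- exact: gg_density_ge0.
- by move=> x x0; rewrite /gg_density ltNge x0.
- apply: filterS2 W_gt0 (filterI S_gt0 (filterI G1_gt0 G2_gt0)) => w Ww [Sw [G1w G2w]].
  by rewrite /Y divr_gt0 ?mulr_gt0// powR_gt0// divr_gt0// addr_gt0.
move=> x x0; have t0 : 0 < x / c by rewrite divr_gt0.
have y0 : 0 < (x / c) `^ a by rewrite powR_gt0.
rewrite gg_density_tail// -integrate_G1// -integrate_G2// tail_integral// integrate_W// integrate_S//.
rewrite ge0_integralZl//.
by apply: (measurableT_comp (mf3 _)); exact: measurable_fun_pair.
Qed.
End mixed_exponential.

(** * Poisson distribution functions *)

Section poisson.
Variable R : realType.
Implicit Types (l : R) (m k : nat).

Definition pois l k : R := expR (- l) * (l ^+ k / k`!%:R).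

Definition pois_cdf m l : R := \sum_(k < m) pois l k.

Lemma pois_ge0 l k : 0 <= l -> 0 <= pois l k.
Proof. by move=> l0; rewrite mulr_ge0 ?expR_ge0// divr_ge0// exprn_ge0. Qed.

Lemma poisS l k : k.+1%:R * pois l k.+1 = l * pois l k.
Proof.
rewrite /pois factS natrM exprS; field.
by rewrite nat1r !pnatr_eq0 -lt0n fact_gt0.
Qed.

Lemma pois_cdfS m l : pois_cdf m.+1 l = pois_cdf m l + pois l m.
Proof. by rewrite /pois_cdf big_ord_recr. Qed.

Lemma pois_cdf_nondecreasing l : 0 <= l ->
  nondecreasing_seq (fun m => pois_cdf m l).
Proof.
by move=> l0; apply/nondecreasing_seqP => m; rewrite pois_cdfS lerDl pois_ge0.
Qed.

Lemma cvg_pois_cdf l : pois_cdf m l @[m --> \oo] --> (1 : R).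
Proof.
have -> : (fun m => pois_cdf m l) = (fun m => expR (- l) * series (exp_coeff l) m).
  apply/funext => m; rewrite /pois_cdf /series/= big_mkord mulr_sumr.
  by apply: eq_bigr => i _; rewrite /pois /exp_coeff/=.
have -> : 1 = expR (- l) * expR l by rewrite -expRD addNr expR0.
apply: cvgM; first exact: cvg_cst.
by have := @is_cvg_series_exp_coeff R l; rewrite /expR.
Qed.

Lemma pois_cdf_le1 m l : 0 <= l -> pois_cdf m l <= 1.
Proof.
move=> l0; rewrite -(cvg_lim _ (cvg_pois_cdf l))//.
apply: nondecreasing_cvgn_le; first exact: pois_cdf_nondecreasing.
by apply/cvg_ex; exists 1; exact: cvg_pois_cdf.
Qed.

Lemma pois_cdf_ge0 m l : 0 <= l -> 0 <= pois_cdf m l.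
Proof. by move=> l0; apply: sumr_ge0 => k _; exact: pois_ge0. Qed.

Lemma pois_varianceE m l : \sum_(k < m) pois l k * (k%:R - l) ^+ 2 =
  l * pois_cdf m l + m%:R * (l - m%:R) * pois l m.
Proof.
elim: m => [|m IH]; first by rewrite /pois_cdf !big_ord0 mulr0 !mul0r addr0.
rewrite big_ord_recr/= IH pois_cdfS.
have -> : m.+1%:R * (l - m.+1%:R) * pois l m.+1 = (l - m.+1%:R) * (l * pois l m).
  by rewrite -poisS; ring.
by rewrite -natr1; ring.
Qed.

Lemma pois_variance_le m l : 0 <= l ->
  \sum_(k < m) pois l k * (k%:R - l) ^+ 2 <= l.
Proof.
move=> l0; pose V m := \sum_(k < m) pois l k * (k%:R - l) ^+ 2.
have ndV : nondecreasing_seq V.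
  apply/nondecreasing_seqP => n; rewrite /V big_ord_recr/= lerDl.
  by rewrite mulr_ge0 ?sqr_ge0// pois_ge0.
pose M := maxn m (Num.truncn l).+1.
have lM : l <= M%:R.
  by rewrite (le_trans (ltW (truncnS_gt l)))// ler_nat leq_maxr.
apply: (@le_trans _ _ (V M)); first by apply: ndV; rewrite leq_maxl.
rewrite /V pois_varianceE -[leRHS]addr0; apply: lerD.
  by rewrite ler_piMr// pois_cdf_le1.
by rewrite mulr_le0_ge0 ?pois_ge0// mulr_ge0_le0// subr_le0.
Qed.

Lemma pois_cdf_le m l : 0 <= l -> m%:R <= l ->
  (l - m%:R) ^+ 2 * pois_cdf m l <= l.
Proof.
move=> l0 ml; apply: le_trans (pois_variance_le m l0).
rewrite /pois_cdf mulr_sumr; apply: ler_sum => k _.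
rewrite mulrC ler_wpM2l ?pois_ge0// -[leRHS]sqrrN opprB lerXn2r ?nnegrE ?subr_ge0//.
  by rewrite (le_trans _ ml)// ler_nat ltnW.
by rewrite lerD2l lerN2 ler_nat ltnW.
Qed.

Lemma pois_cdf_ge m l : 0 <= l -> l <= m%:R ->
  (m%:R - l) ^+ 2 * (1 - pois_cdf m l) <= l.
Proof.
move=> l0 lm.
have H n : (m <= n)%N -> (m%:R - l) ^+ 2 * (pois_cdf n l - pois_cdf m l) <= l.
  move=> mn; apply: le_trans (pois_variance_le n l0).
  have split (u : nat -> R) : \sum_(k < n) u k = \sum_(k < m) u k + \sum_(m <= k < n) u k.
    by rewrite -!(big_mkord xpredT) (@big_cat_nat _ _ _ m).
  have -> : pois_cdf n l - pois_cdf m l = \sum_(m <= k < n) pois l k.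
    by rewrite /pois_cdf split addrAC subrr add0r.
  rewrite (split (fun k => pois l k * (k%:R - l) ^+ 2)) -[leLHS]add0r; apply: lerD.
    by apply: sumr_ge0 => k _; rewrite mulr_ge0 ?sqr_ge0// pois_ge0.
  rewrite mulr_sumr; apply: ler_sum_nat => k /andP[mk _].
  rewrite mulrC ler_wpM2l ?pois_ge0// lerXn2r ?nnegrE ?subr_ge0//.
    by rewrite (le_trans lm)// ler_nat.
  by rewrite lerD2r ler_nat.
have c : (m%:R - l) ^+ 2 * (pois_cdf n l - pois_cdf m l) @[n --> \oo] -->
    (m%:R - l) ^+ 2 * (1 - pois_cdf m l).
  apply: cvgM; first exact: cvg_cst.
  by apply: cvgB; [exact: cvg_pois_cdf|exact: cvg_cst].
rewrite -(cvg_lim _ c)//; apply: limr_le; first by apply/cvg_ex; eexists; exact: c.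
by near=> n; apply: H; near: n; exact: nbhs_infty_ge.
Unshelve. all: end_near. Qed.

Lemma cvg_pois_cdf_scaled (m : nat -> nat) (y z : R) : 0 < z -> z != y ->
  (m n)%:R / n%:R @[n --> \oo] --> y ->
  pois_cdf (m n) (n%:R * z) @[n --> \oo] --> ((z < y)%R%:R : R).
Proof.
move=> z0 zy my; pose h := `|z - y| / 2.
have h0 : 0 < h by rewrite divr_gt0// normr_gt0 subr_eq0.
apply/cvgrPdist_le => e e0; near=> n.
have n0 : 0 < n%:R :> R by rewrite ltr0n; near: n; exact: nbhs_infty_gt.
have nh : `|y - (m n)%:R / n%:R| < h by near: n; move/cvgrPdist_lt : my; exact.
have ne : z / (h ^+ 2 * e) <= n%:R.
  by near: n; exact: nbhs_infty_ger.
have l0 : 0 <= n%:R * z by rewrite mulr_ge0 ?ltW.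
have hz : h <= `|z - (m n)%:R / n%:R|.
  have := ler_normD (z - (m n)%:R / n%:R) ((m n)%:R / n%:R - y).
  rewrite [X in _ <= _ + X]distrC addrA subrK.
  have -> : `|z - y| = 2 * h by rewrite /h; field.
  lra.
have mn : (m n)%:R = n%:R * ((m n)%:R / n%:R) :> R by field; rewrite gt_eqF.
have sq : (h * n%:R) ^+ 2 <= (n%:R * z - (m n)%:R) ^+ 2.
  rewrite mn -mulrBr [leLHS]exprMn [leRHS]exprMn mulrC ler_wpM2l ?sqr_ge0//.
  by rewrite -[leRHS]real_normK ?num_real// lerXn2r ?nnegrE// ltW.
have fin x : 0 <= x -> (n%:R * z - (m n)%:R) ^+ 2 * x <= n%:R * z -> x <= e.
  move=> x0 H; have hn : 0 < (h * n%:R) ^+ 2 by apply: exprn_gt0; exact: mulr_gt0.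
  rewrite -(ler_pM2l hn) (le_trans (ler_wpM2r x0 sq))// (le_trans H)//.
  move: ne; rewrite ler_pdivrMr; last by apply: mulr_gt0 => //; exact: exprn_gt0.
  move=> ne.
  have -> : (h * n%:R) ^+ 2 * e = n%:R * (n%:R * (h ^+ 2 * e)) by ring.
  by rewrite ler_pM2l.
have [zy'|yz] := ltP z y.
  have lm : n%:R * z <= (m n)%:R.
    have hE : 2 * h = y - z by rewrite /h ltr0_norm ?subr_lt0//; field.
    rewrite mn ler_pM2l// ltW//; move: nh.
    by rewrite ltr_norml => /andP[_]; lra.
  rewrite ger0_norm ?subr_ge0 ?pois_cdf_le1//; apply: fin.
    by rewrite subr_ge0 pois_cdf_le1.
  by rewrite -sqrrN opprB; exact: pois_cdf_ge.
have yz' : y < z by rewrite lt_def zy.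
have lm : (m n)%:R <= n%:R * z.
  have hE : 2 * h = z - y by rewrite /h gtr0_norm ?subr_gt0//; field.
  rewrite mn ler_pM2l// ltW//; move: nh.
  by rewrite ltr_norml => /andP[+ _]; lra.
rewrite sub0r normrN ger0_norm ?pois_cdf_ge0//; apply: fin; first exact: pois_cdf_ge0.
exact: pois_cdf_le.
Unshelve. all: end_near. Qed.

End poisson.

(** * Generalized negative binomial laws *)

Lemma gg_density_scale (R : realType) (r a k z : R) : 0 < k ->
  gg_density r a (k `^ (- a)) (k * z) = k^-1 * gg_density r a 1 z.
Proof.
move=> k0; rewrite /gg_density (pmulr_rgt0 z k0).
case: (ltP 0 z) => [z0|_]; last by rewrite [RHS]mulr0.
rewrite !(powRM _ (ltW k0) (ltW z0)) powR1.
rewrite -powRrM mulr1.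
have -> : expR (- k `^ (- a) * (k `^ a * z `^ a)) = expR (- 1 * z `^ a).
  have kk : k `^ (- a) * k `^ a = 1.
    by rewrite -powRD ?(gt_eqF k0) ?implybT// addNr powRr0.
  congr expR; transitivity (- (k `^ (- a) * k `^ a * z `^ a)); first by ring.
  by rewrite kk; ring.
have -> : k `^ (a * r - 1) = k `^ (a * r) * k^-1.
  by rewrite powRD ?(gt_eqF k0) ?implybT// powR_inv1 ?(ltW k0).
have -> : k `^ (- a * r) = (k `^ (a * r))^-1 by rewrite mulNr powRN.
have p0 : k `^ (a * r) != 0 by rewrite gt_eqF// powR_gt0.
move: (gammaf r)^-1 (z `^ _) (expR _) => G Z E.
by field; rewrite p0 gt_eqF.
Qed.

Section negative_binomial.
Context {d : measure_display} {T : measurableType d} {R : realType}.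
Variables (P : probability T R) (N : nat -> T -> nat) (r a : R).
Hypothesis mN : forall n k, measurable [set w | N n w = k].
Hypothesis N_law : forall n k, (0 < n)%N ->
  P [set w | N n w = k] =
  (((k`!)%:R^-1)%:E *
   \int[lebesgue_measure]_(z in `[0%R, +oo[)
      (expR (- z) * z ^+ k * gg_density r a (n%:R `^ (- a)) z)%:E)%E.
Let mu := @lebesgue_measure R.
Let g1 : R -> R := gg_density r a 1.

Let mg1 : measurable_fun setT g1. Proof. exact: measurable_gg_density. Qed.

Let g1_ge0 z : 0 <= g1 z. Proof. exact: gg_density_ge0. Qed.

Let g1_neg z : z <= 0 -> g1 z = 0.
Proof. by move=> z0; rewrite /g1 /gg_density ltNge z0. Qed.

Let mpois (n k : nat) : measurable_fun setT (fun z : R => pois (n%:R * z) k).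
Proof.
apply: measurable_funM.
  by apply: measurableT_comp => //; apply: measurableT_comp => //; exact: measurable_funM.
apply: measurable_funM => //; apply: measurable_funX; exact: measurable_funM.
Qed.

Let mQ (n m : nat) : measurable_fun setT (fun z : R => pois_cdf m (n%:R * z)).
Proof.
elim: m => [|m IH].
  by rewrite /pois_cdf; under eq_fun do rewrite big_ord0; exact: measurable_cst.
by under eq_fun do rewrite pois_cdfS; exact: measurable_funD.
Qed.

Let Qg_ge0 (n m : nat) z : 0 <= pois_cdf m (n%:R * z) * g1 z.
Proof.
have [z0|z0] := ltP 0 z; last by rewrite g1_neg// mulr0.
by rewrite mulr_ge0// pois_cdf_ge0// mulr_ge0// ltW.
Qed.

Let pg_ge0 (n m : nat) z : 0 <= pois (n%:R * z) m * g1 z.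
Proof.
have [z0|z0] := ltP 0 z; last by rewrite g1_neg// mulr0.
by rewrite mulr_ge0// pois_ge0// mulr_ge0// ltW.
Qed.

Let prob_eq n k : (0 < n)%N ->
  (P [set w | N n w = k] = \int[mu]_z (pois (n%:R * z) k * g1 z)%:E)%E.
Proof.
move=> n0; have nR : 0 < n%:R :> R by rewrite ltr0n.
pose f (z : R) := (pois z k * gg_density r a (n%:R `^ (- a)) z)%:E.
have mf : measurable_fun setT f.
  apply/measurable_EFinP; apply: measurable_funM; last exact: measurable_gg_density.
  by have := mpois 1 k; under eq_fun do rewrite mul1r.
have f0 z : (0 <= f z)%E.
  rewrite lee_fin; have [z0|z0] := ltP 0 z.
    by rewrite mulr_ge0 ?gg_density_ge0// pois_ge0// ltW.
  by rewrite /gg_density ltNge z0 mulr0.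
transitivity (\int[mu]_z f z)%E.
  rewrite N_law// -ge0_integralZl//=; last 2 first.
  - apply: measurable_funTS; apply/measurable_EFinP.
    apply: measurable_funM; last exact: measurable_gg_density.
    apply: measurable_funM; last exact: exprn_measurable.
    by apply: measurableT_comp => //; exact: oppr_measurable.
  - move=> z; rewrite in_itv/= andbT => z0.
    by rewrite lee_fin !mulr_ge0 ?expR_ge0 ?exprn_ge0 ?gg_density_ge0.
  rewrite integral_mkcond; apply: eq_integral => z _; rewrite patchE.
  case: ifPn => [_|]; first by rewrite /f -EFinM /pois; congr EFin; ring.
  rewrite notin_setE/= in_itv/= andbT => /negP; rewrite -ltNge => z0.
  by rewrite /f /gg_density ltNge (ltW z0) mulr0.
have -> : (\int[mu]_z f z)%E = ((n%:R)%:E * \int[mu]_z f (n%:R * z + 0)%R)%E.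
  exact: (ge0_integral_affine 0 nR mf f0).
have mf' : measurable_fun setT (fun z : R => f (n%:R * z + 0)).
  by apply: (measurableT_comp mf); apply: measurable_funD => //; exact: mulrl_measurable.
transitivity (\int[mu]_z ((n%:R)%:E * f (n%:R * z + 0)%R))%E.
  apply/esym; apply: (ge0_integralZl_EFin mu measurableT _ mf' (ltW nR)).
  by move=> z _; exact: f0.
apply: eq_integral => z _; rewrite /f addr0 gg_density_scale// -EFinM; congr EFin.
by rewrite mulrCA mulVKf ?gt_eqF.
Qed.

Let ltS n m : [set w | (N n w < m.+1)%N] =
  [set w | (N n w < m)%N] `|` [set w | N n w = m].
Proof.
apply/seteqP; split => w /=.
  by rewrite ltnS [(N n w <= m)%N]leq_eqVlt => /orP[/eqP|]; [right|left].
by case=> [/ltnW//|->].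
Qed.

Let mNlt n m : measurable [set w | (N n w < m)%N].
Proof.
elim: m => [|m IH].
  by rewrite (_ : [set w | _] = set0)//; apply/seteqP; split.
by rewrite ltS; exact: measurableU.
Qed.

Lemma prob_ltE n m : (0 < n)%N ->
  (P [set w | (N n w < m)%N] = \int[mu]_z (pois_cdf m (n%:R * z) * g1 z)%:E)%E.
Proof.
move=> n0; elim: m => [|m IH].
  rewrite (_ : [set w | _] = set0) ?measure0; last by apply/seteqP; split.
  by rewrite integral0_eq// => z _; rewrite /pois_cdf big_ord0 mul0r.
rewrite ltS; transitivity (P [set w | (N n w < m)%N] + P [set w | N n w = m])%E.
  by apply: measureU => //; apply/seteqP; split => w //= [] Nm NE; rewrite NE ltnn in Nm.
rewrite IH prob_eq// -ge0_integralD//.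
- by apply: eq_integral => z _; rewrite pois_cdfS mulrDl EFinD.
- by move=> z _; rewrite lee_fin.
- by apply/measurable_EFinP; exact: (measurable_funM (mQ n m) mg1).
- by move=> z _; rewrite lee_fin.
- by apply/measurable_EFinP; exact: (measurable_funM (mpois n m) mg1).
Qed.

Lemma gg_density_total : (\int[mu]_z (g1 z)%:E = 1)%E.
Proof.
have ndA : nondecreasing_seq (fun m => [set w | (N 1 w < m)%N]).
  move=> m k mk; rewrite subsetEset => w /= Nm; exact: leq_trans mk.
have UA : \bigcup_m [set w | (N 1 w < m)%N] = setT.
  by apply/seteqP; split => // w _; exists (N 1 w).+1 => /=.
have c1 : (P \o (fun m => [set w | (N 1 w < m)%N])) m @[m --> \oo] --> 1%E.
  rewrite -(probability_setT P) -UA; apply: nondecreasing_cvg_mu => //.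
  by rewrite UA.
rewrite -(cvg_lim _ c1)//.
rewrite (_ : (_ \o _) = (fun m => \int[mu]_z (pois_cdf m (1%:R * z) * g1 z)%:E)%E); last first.
  by apply/funext => m; rewrite /= prob_ltE.
rewrite -monotone_convergence//.
- apply: eq_integral => z _; apply/esym/cvg_lim => //; apply: cvg_EFin; first exact: nearW.
  rewrite -[X in _ --> X]mul1r; apply: cvgM; last exact: cvg_cst.
  exact: cvg_pois_cdf.
- by move=> m; apply/measurable_EFinP; exact: (measurable_funM (mQ 1 m) mg1).
- by move=> m z _; rewrite lee_fin.
- move=> z _ m k mk; rewrite lee_fin; have [z0|z0] := ltP 0 z; last by rewrite g1_neg// !mulr0.
  by rewrite ler_wpM2r// pois_cdf_nondecreasing// mul1r ltW.
Qed.

Lemma integrable_gg_density1 : mu.-integrable setT (EFin \o g1).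
Proof.
apply/integrableP; split; first exact/measurable_EFinP.
under eq_integral do rewrite /= ger0_norm//.
by rewrite gg_density_total ltry.
Qed.

Lemma cvg_prob_lt (m : nat -> nat) (y : R) : 0 <= y ->
  (m n)%:R / n%:R @[n --> \oo] --> y ->
  fine (P [set w | (N n w < m n)%N]) @[n --> \oo] -->
  (\int[mu]_(z in `[0, y]) g1 z : R).
Proof.
move=> y0 my.
have mlim : measurable_fun setT (g1 \_ `[0, y]).
  by apply/measurable_restrict => //; apply: measurable_funTS.
have ae1 : {ae mu, forall z, setT z ->
    (pois_cdf (m n) (n%:R * z) * g1 z)%:E @[n --> \oo] --> (g1 \_ `[0, y] z)%:E}.
  exists [set y]; split; [exact: measurable_set1|exact: lebesgue_measure_set1|].
  move=> z /= /not_implyP[_ H]; apply: contrapT => /eqP zy; apply: H.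
  apply: cvg_EFin; first exact: nearW.
  have [z0|z0] := ltP 0 z; last first.
    rewrite patchE [g1 z]g1_neg//; under eq_fun do rewrite mulr0.
    by case: ifPn => _; exact: cvg_cst.
  have -> : (g1 \_ `[0, y]) z = (z < y)%R%:R * g1 z.
    rewrite patchE; case: ifPn => [|].
      rewrite inE/= in_itv/= => /andP[_ zy']; rewrite lt_def eq_sym zy zy' mul1r//.
    rewrite notin_setE/= in_itv/= (ltW z0)/= => /negP; rewrite -ltNge => yz.
    by rewrite ltNge (ltW yz) mul0r.
  by apply: cvgM; [exact: cvg_pois_cdf_scaled|exact: cvg_cst].
have ae2 : {ae mu, forall z n, setT z ->
    (`|(pois_cdf (m n) (n%:R * z) * g1 z)%:E| <= (EFin \o g1) z)%E}.
  apply: aeW => z n _; rewrite /= lee_fin ger0_norm//.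
  have [z0|z0] := ltP 0 z; last by rewrite g1_neg// mulr0.
  by rewrite ler_piMl// pois_cdf_le1// mulr_ge0// ltW.
have [_ _ lim1] := @dominated_convergence _ _ _ mu setT measurableT
  (fun n z => (pois_cdf (m n) (n%:R * z) * g1 z)%:E)
  (fun z => (g1 \_ `[0, y] z)%:E) (EFin \o g1)
  (fun n => (measurable_EFinP _ _).2 (measurable_funM (mQ n (m n)) mg1))
  ((measurable_EFinP _ _).2 mlim) ae1 integrable_gg_density1 ae2.
apply: fine_cvg; rewrite fineK; last first.
  apply: integrable_fin_num; first exact: measurable_itv.
  by apply: integrableS integrable_gg_density1 => //; exact: measurable_itv.
have -> : (\int[mu]_(z in `[0%R, y]) (g1 z)%:E)%E =
    (\int[mu]_z (g1 \_ `[0, y] z)%:E)%E.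
  by rewrite integral_mkcond; apply: eq_integral => z _; rewrite !patchE; case: ifPn.
apply: cvg_trans lim1; apply: near_eq_cvg; near=> n.
by rewrite prob_ltE//; near: n; exact: nbhs_infty_gt.
Unshelve. all: end_near. Qed.

End negative_binomial.

(** * Pointwise to uniform convergence of distribution functions *)

Section cdf.
Context {R : realType}.
Variable g : R -> R.
Hypotheses (g0 : forall z, 0 <= g z) (g_neg : forall z, z <= 0 -> g z = 0).
Let mu := @lebesgue_measure R.
Hypothesis (ig : mu.-integrable setT (EFin \o g)).
Hypothesis g1 : (\int[mu]_z (g z)%:E = 1)%E.
Let F (y : R) : R := \int[mu]_(z in `[0, y]) g z.

Let igD D : measurable D -> mu.-integrable D (EFin \o g).
Proof. by move=> mD; exact: integrableS ig. Qed.

Let fin_cdf y : (\int[mu]_(z in `[0%R, y]) (g z)%:E)%E \is a fin_num.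
Proof.
apply: integrable_fin_num; first exact: measurable_itv.
by apply: igD; exact: measurable_itv.
Qed.

Lemma cdf0 : F 0 = 0.
Proof. by rewrite /F set_itv1 Rintegral_set1. Qed.

Lemma cdf_nondecreasing : {homo F : x y / x <= y}.
Proof.
move=> x y xy; apply: fine_le.
- exact: fin_cdf.
- exact: fin_cdf.
apply: ge0_subset_integral; [exact: measurable_itv|exact: measurable_itv| | |].
- by have /integrableP[] := igD (measurable_itv `[0, y]).
- by move=> z _; rewrite lee_fin.
- by move=> z /=; rewrite !in_itv/= => /andP[-> zx]/=; exact: le_trans xy.
Qed.

Lemma cdf_ge0 y : 0 <= F y.
Proof. by apply: Rintegral_ge0 => z _. Qed.

Lemma cdf_cvg1 : F n.+1%:R @[n --> \oo] --> (1 : R).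
Proof.
suff E : (1 : R) = \int[mu]_(z in `[0, +oo[) g z.
  rewrite [X in _ --> X]E.
  have i0 : mu.-integrable `[0%R, +oo[ (EFin \o g) by apply: igD; exact: measurable_itv.
  exact: (cvg_Rintegral_itv0y i0).
rewrite /Rintegral (_ : (\int[mu]_(z in _) _)%E = 1%E)//.
rewrite -g1 integral_mkcond; apply: eq_integral => z _; rewrite patchE.
case: ifPn => //; rewrite notin_setE/= in_itv/= andbT => /negP; rewrite -ltNge => z0.
by rewrite g_neg// ltW.
Qed.

Lemma cdf_le1 y : F y <= 1.
Proof.
rewrite -(cvg_lim _ cdf_cvg1)//.
have ndF : nondecreasing_seq (fun n => F n.+1%:R).
  by move=> m n mn; apply: cdf_nondecreasing; rewrite ler_nat.
have cF : cvgn (fun n => F n.+1%:R) by apply/cvg_ex; exists 1; exact: cdf_cvg1.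
apply: (le_trans _ (nondecreasing_cvgn_le ndF cF (Num.truncn y))).
by apply: cdf_nondecreasing; rewrite ltW// truncnS_gt.
Qed.

Lemma cdf_ivt (x y v : R) : 0 <= x -> x <= y -> F x <= v <= F y ->
  exists2 z, x <= z <= y & F z = v.
Proof.
move=> x0 xy Fv.
have cF : {within `[x, y], continuous F}.
  apply: (@continuous_subspaceW _ _ _ `[0, y]); last first.
    apply: parameterized_integral_continuous; [exact: le_trans xy|].
    by apply: igD; exact: measurable_itv.
  by move=> z /=; rewrite !in_itv/= => /andP[xz ->]; rewrite (le_trans x0 xz).
have Fmm : Num.min (F x) (F y) <= v <= Num.max (F x) (F y).
  by case/andP: Fv => Fx Fy; rewrite ge_min Fx/= le_max Fy orbT.
have [z] := IVT xy cF Fmm.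
by rewrite in_itv/=; exists z.
Qed.

Lemma cdf_right_approx z e : 0 <= z -> 0 < e -> exists2 y, z < y & F y <= F z + e.
Proof.
move=> z0 e0; have [FM|FM] := leP (F (z + 1)) (F z + e); first by exists (z + 1) => //; rewrite ltrDl.
have [||y /andP[zy _] Fy] := @cdf_ivt z (z + 1) (F z + e) z0.
- by rewrite lerDl.
- by rewrite (ltW FM) andbT lerDl ltW.
exists y; last by rewrite Fy.
rewrite lt_neqAle zy andbT; apply/eqP => zy'.
by move: Fy; rewrite -zy' => /eqP; rewrite eq_sym gt_eqF// ltrDl.
Qed.

Lemma cdf_left_approx z e : 0 < z -> 0 < e ->
  exists2 y, 0 <= y < z & F z - e <= F y.
Proof.
move=> z0 e0; have [FM|FM] := leP (F z - e) (F 0); first by exists 0 => //; rewrite lexx.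
have [||y /andP[y0 yz] Fy] := @cdf_ivt 0 z (F z - e) (lexx _).
- exact: ltW.
- by rewrite (ltW FM)/= gerDl oppr_le0 ltW.
exists y; last by rewrite Fy.
rewrite y0 lt_neqAle yz andbT; apply/eqP => zy'.
by move: Fy; rewrite zy' => /eqP; rewrite gt_eqF// gtrDl oppr_lt0.
Qed.

(* Uniformity is tested on the quantiles [q i] of order [i / m] only: between two
   of them both functions are monotone and [F] varies by [1 / m]. *)
Lemma polya_uniform_cvg (H : nat -> R -> R) :
  (forall n, {homo H n : x y / x <= y}) -> (forall n x, 0 <= H n x <= 1) ->
  (forall x, 0 <= x -> H n x @[n --> \oo] --> F x) ->
  forall e, 0 < e -> \forall n \near \oo, forall x, 0 <= x -> `|H n x - F x| <= e.
Proof.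
move=> ndH H01 cH e e0.
pose m := (Num.truncn (3 / e)).+1.
have m0 : 0 < m%:R :> R by rewrite ltr0n.
have me : 3 / m%:R <= e.
  rewrite ler_pdivrMr// mulrC -ler_pdivrMr//; apply/ltW; exact: truncnS_gt.
have m1 : 0 < (m%:R)^-1 :> R by rewrite invr_gt0.
have Q (i : 'I_m) : exists q, 0 <= q /\ F q = i%:R / m%:R.
  have im : i%:R / m%:R < 1 :> R by rewrite ltr_pdivrMr// mul1r ltr_nat.
  have [n Fn] : exists n, i%:R / m%:R < F n.+1%:R.
    have [n _ /(_ n (leqnn n))] := cvgr_gt _ cdf_cvg1 _ im.
    by exists n.
  have [||q /andP[q0 _] Fq] := @cdf_ivt 0 n.+1%:R (i%:R / m%:R) (lexx _).
  - exact: ler0n.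
  - by rewrite cdf0 divr_ge0//= ltW.
  - by exists q.
pose q i := projT1 (cid (Q i)).
have q0 i : 0 <= q i by rewrite /q; case: cid => z /= [].
have Fq i : F (q i) = i%:R / m%:R by rewrite /q; case: cid => z /= [].
have near_q : \forall n \near \oo, forall i : 'I_m, `|F (q i) - H n (q i)| <= m%:R^-1.
  suff qi i : \forall n \near \oo, `|F (q i) - H n (q i)| <= m%:R^-1.
    exact: (@filter_forall _ _ (fun i n => is_true (`|F (q i) - H n (q i)| <= m%:R^-1)) \oo _ qi).
  by have /cvgrPdist_le/(_ _ m1) := cH _ (q0 i).
near=> n => x x0.
have Hq i : `|F (q i) - H n (q i)| <= m%:R^-1.
  by move: i; near: n.
pose t := Num.truncn (m%:R * F x).
have mF0 : 0 <= m%:R * F x by rewrite mulr_ge0// cdf_ge0.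
have t1 : t%:R <= m%:R * F x by rewrite truncn_le.
have t2 : m%:R * F x < t.+1%:R by exact: truncnS_gt.
have /andP[H0 H1] := H01 n x.
have tF1 : t%:R / m%:R <= F x by rewrite ler_pdivrMr// mulrC.
have tF2 : F x < t%:R / m%:R + m%:R^-1.
  by rewrite -[X in _ + X]mul1r -mulrDl natr1 ltr_pdivlMr// mulrC.
have tm : (t <= m)%N.
  rewrite -(ler_nat R) (le_trans t1)// -[leRHS]mulr1 ler_wpM2l// cdf_le1//.
apply: le_trans me; rewrite ler_norml; apply/andP; split.
- rewrite lerBrDr.
  case tE : t => [|j].
    move: tF2; rewrite tE mul0r add0r => ?; lra.
  have jm : (j < m)%N by rewrite -tE.
  have qx : q (Ordinal jm) <= x.
    rewrite leNgt; apply/negP => /ltW/cdf_nondecreasing; rewrite Fq/=.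
    move: tF1; rewrite tE -natr1 mulrDl mul1r; lra.
  move: (Hq (Ordinal jm)); rewrite Fq/= ler_norml => /andP[_].
  have := ndH n _ _ qx; move: tF2; rewrite tE -natr1 mulrDl mul1r; lra.
- rewrite lerBlDr.
  have [jm|jm] := ltnP t.+1 m.
    have qx : x <= q (Ordinal jm).
      rewrite leNgt; apply/negP => /ltW/cdf_nondecreasing; rewrite Fq/=.
      move: tF2; rewrite -natr1 mulrDl mul1r; lra.
    move: (Hq (Ordinal jm)); rewrite Fq/= ler_norml => /andP[+ _].
    have := ndH n _ _ qx; move: tF1; rewrite -natr1 mulrDl mul1r; lra.
  have : 1 <= t.+1%:R / m%:R :> R by rewrite ler_pdivlMr// mul1r ler_nat.
  move: tF1; rewrite -natr1 mulrDl mul1r; lra.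
Unshelve. all: end_near. Qed.

End cdf.

Lemma egoroff (d : measure_display) (T : measurableType d) (R : realType)
    (P : probability T R) (f : nat -> T -> R) (l : R) (e del : R) :
  (forall n, measurable_fun setT (f n)) ->
  {ae P, forall w, f n w @[n --> \oo] --> l} -> 0 < e -> 0 < del ->
  exists B K, [/\ measurable B, (P B < e%:E)%E &
    forall k w, (K <= k)%N -> ~ B w -> `|l - f k w| < del].
Proof.
move=> mf fl e0 d0.
have fl' : {ae P, forall w, [set: T] w -> f ^~ w @ \oo --> l}.
  by apply: filterS fl => w lw _.
have PT : (P [set: T] < +oo)%E by rewrite probability_setT ltry.
have [B [mB PB fB]] := ae_pointwise_almost_uniform mf (measurable_cst l) measurableT PT fl' e0.
have [K _ HK] := fB [set h | forall w, ([set: T] `\` B) w -> ball l del (h w)] (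
  (uniform_nbhs _ _).2 (ex_intro _ [set xy : R * R | ball xy.1 del xy.2]
    (conj (entourage_ball R (PosNum d0)) (fun h Hh => Hh)))).
exists B, K; split => // k w Kk Bw.
by apply: (HK k Kk w); split.
Qed.

Lemma cvg_truncn_div (R : realType) (y : R) : 0 <= y ->
  (Num.truncn (n%:R * y))%:R / n%:R @[n --> \oo] --> y.
Proof.
move=> y0; apply: (@squeeze_cvgr _ _ _ _ (fun n : nat => y - n%:R^-1) (fun=> y)).
- near=> n.
  have n0 : 0 < n%:R :> R by rewrite ltr0n; near: n; exact: nbhs_infty_gt.
  have ny : 0 <= n%:R * y by rewrite mulr_ge0.
  rewrite ler_pdivlMr// ler_pdivrMr// mulrBl mulVf ?gt_eqF// [y * _]mulrC.
  by rewrite truncn_le ny andbT lerBlDr natr1 ltW// truncnS_gt.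
- rewrite -[X in _ --> X]subr0; apply: cvgB; first exact: cvg_cst.
  by rewrite -cvg_shiftS; exact: cvg_harmonic.
- exact: cvg_cst.
Unshelve. all: end_near. Qed.

(** * Random sums *)

Lemma probability_le3 (d : measure_display) (T : measurableType d) (R : realType)
    (P : probability T R) (A B C D : set T) :
  measurable A -> measurable B -> measurable C -> measurable D ->
  A `<=` B `|` C `|` D -> fine (P A) <= fine (P B) + fine (P C) + fine (P D).
Proof.
move=> mA mB mC mD sub.
rewrite -!fineD ?fin_numD ?fin_num_measure//.
apply: fine_le; rewrite ?fin_numD ?fin_num_measure//.
apply: le_trans (le_measure P _ _ sub) _; rewrite ?inE//.
  by apply: measurableU => //; exact: measurableU.
have BCD : (P (B `|` C `|` D) <= P (B `|` C) + P D)%E.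
  by apply: measureU2 => //; exact: measurableU.
by apply: (le_trans BCD); apply: leeD => //; exact: measureU2.
Qed.

Section random_sum.
Context {d : measure_display} {T : measurableType d} {R : realType}.
Variables (P : probability T R) (X : nat -> T -> R) (c r a : R) (N : nat -> T -> nat).
Hypotheses (mX : forall j, measurable_fun setT (X j)) (c0 : 0 < c).
Hypothesis lln : {ae P, forall w,
  (fun n : nat => n%:R^-1 * \sum_(j < n) X j w) @ \oo --> c}.
Hypothesis mN : forall n k, measurable [set w | N n w = k].
Hypothesis N_law : forall n k, (0 < n)%N ->
  P [set w | N n w = k] =
  (((k`!)%:R^-1)%:E *
   \int[lebesgue_measure]_(z in `[0%R, +oo[)
      (expR (- z) * z ^+ k * gg_density r a (n%:R `^ (- a)) z)%:E)%E.
Let mu := @lebesgue_measure R.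
Let F (y : R) : R := \int[mu]_(z in `[0, y]) gg_density r a 1 z.
Let H (n : nat) (x : R) : R := fine (P [set w | rsum X (N n w) w < n%:R * x]).

Let g_ge0 z : 0 <= gg_density r a 1 z. Proof. exact: gg_density_ge0. Qed.
Let g_neg (z : R) : z <= 0 -> gg_density r a 1 z = 0.
Proof. by move=> z0; rewrite /gg_density ltNge z0. Qed.
Let ig := integrable_gg_density1 mN N_law.
Let g1 := gg_density_total mN N_law.

Let mrsum k : measurable_fun setT (rsum X k).
Proof. by apply: measurable_sum => j; exact: mX. Qed.

Let mean k w := k%:R^-1 * rsum X k w.

Let mmean k : measurable_fun setT (mean k).
Proof. by apply: measurable_funM => //; exact: measurable_cst. Qed.

Let mNlt n m : measurable [set w | (N n w < m)%N].
Proof.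
rewrite (_ : [set w | _] = \bigcup_(k in [set k | (k < m)%N]) [set w | N n w = k]).
  by apply: bigcup_measurable => k _.
by apply/seteqP; split => [w /= Nm|w [k /= km ->]//]; exists (N n w).
Qed.

Let mH n x : measurable [set w | rsum X (N n w) w < n%:R * x].
Proof.
rewrite (_ : [set w | _] = \bigcup_k ([set w | N n w = k] `&`
    (rsum X k @^-1` `]-oo, n%:R * x[%classic))).
  apply: bigcup_measurable => k _; apply: measurableI => //.
  by rewrite -[X in measurable X]setTI; apply: mrsum => //; exact: measurable_itv.
apply/seteqP; split => [w /= Nm|w [k _ [/= ->]]]; last by rewrite in_itv.
by exists (N n w) => //=; rewrite in_itv.
Qed.

Let near_small K e : 0 < e ->
  \forall n \near \oo, fine (P [set w | (N n w < K)%N]) <= e.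
Proof.
move=> e0.
have K0 : K%:R / n%:R @[n --> \oo] --> (0 : R).
  rewrite -[X in _ --> X](mulr0 (K%:R)); apply: cvgM; first exact: cvg_cst.
  by rewrite -cvg_shiftS; exact: cvg_harmonic.
have := cvg_prob_lt mN N_law (lexx 0) K0.
by rewrite (cdf0 (gg_density r a 1)) => /cvgr_le/(_ _ e0).
Qed.

Let near_le x y e : x / c < y -> 0 <= x -> 0 < e ->
  \forall n \near \oo, H n x <= F y + e.
Proof.
move=> xy x0 e0.
have y0 : 0 < y by rewrite (le_lt_trans _ xy)// divr_ge0// ltW.
have e3 : 0 < e / 3 by rewrite divr_gt0.
have d0 : 0 < c - x / y.
  by rewrite subr_gt0 ltr_pdivrMr// -ltr_pdivrMl// mulrC.
have [B [K [mB PB HK]]] := egoroff mmean lln e3 d0.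
have lim : (Num.truncn (n%:R * y)).+1%:R / n%:R @[n --> \oo] --> y.
  rewrite (_ : (fun n : nat => _) = (fun n : nat =>
    (Num.truncn (n%:R * y))%:R / n%:R + n%:R^-1)); last first.
    by apply/funext => n; rewrite -natr1 mulrDl mul1r.
  rewrite -[X in _ --> X]addr0; apply: cvgD; first exact: cvg_truncn_div (ltW y0).
  by rewrite -cvg_shiftS; exact: cvg_harmonic.
have := cvg_prob_lt mN N_law (ltW y0) lim.
have Fe : F y < F y + e / 3 by rewrite ltrDl.
move=> /cvgr_le/(_ _ Fe) near_main.
near=> n.
have n0 : 0 < n%:R :> R by rewrite ltr0n; near: n; exact: nbhs_infty_gt.
have le1 : fine (P B) <= e / 3.
  by rewrite -lee_fin fineK ?fin_num_measure// ltW.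
have le2 : fine (P [set w | (N n w < K.+1)%N]) <= e / 3.
  by near: n; exact: near_small.
have le3 : fine (P [set w | (N n w < (Num.truncn (n%:R * y)).+1)%N]) <= F y + e / 3.
  by near: n.
have : H n x <= fine (P B) + fine (P [set w | (N n w < K.+1)%N]) +
    fine (P [set w | (N n w < (Num.truncn (n%:R * y)).+1)%N]).
  apply: probability_le3 => // w /= Sw.
  have [Bw|Bw] := pselect (B w); first by left; left.
  have [NK|NK] := ltnP (N n w) K.+1; first by left; right.
  right; rewrite -(ltr_nat R); apply: le_lt_trans (truncnS_gt _).
  have N0 : 0 < (N n w)%:R :> R by rewrite ltr0n; exact: leq_trans NK.
  have := HK _ w (ltnW NK) Bw; rewrite ltr_norml => /andP[_].
  rewrite ltrD2l ltrN2 /mean ltr_pdivlMl// => NS.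
  rewrite leNgt; apply/negP => nyN.
  have : (N n w)%:R * (x / y) < n%:R * x by exact: lt_trans Sw.
  rewrite mulrA ltr_pdivrMr// mulrAC ltNge ler_wpM2r//.
  by rewrite ltW.
move: le1 le2 le3; lra.
Unshelve. all: end_near. Qed.

Let near_ge x y e : 0 <= y -> y < x / c -> 0 < e ->
  \forall n \near \oo, F y - e <= H n x.
Proof.
move=> y_ge0 yx e0.
have [y0|y0] := ltP 0 y; last first.
  apply: nearW => n; have -> : y = 0 by apply/eqP; rewrite eq_le y0.
  by rewrite /F cdf0 sub0r (@le_trans _ _ 0) ?oppr_le0 ?fine_ge0// ltW.
have x0 : 0 < x by rewrite -(pmulr_lgt0 x (_ : 0 < c^-1)) ?invr_gt0// (lt_trans y0).
have e3 : 0 < e / 3 by rewrite divr_gt0.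
have d0 : 0 < x / y - c.
  by rewrite subr_gt0 ltr_pdivlMr// mulrC -ltr_pdivlMr.
have [B [K [mB PB HK]]] := egoroff mmean lln e3 d0.
have := cvg_prob_lt mN N_law y_ge0 (cvg_truncn_div y_ge0).
have Fe : F y - e / 3 < F y by rewrite ltrBlDr ltrDl.
move=> /cvgr_ge/(_ _ Fe) near_main.
near=> n.
have n0 : 0 < n%:R :> R by rewrite ltr0n; near: n; exact: nbhs_infty_gt.
have le1 : fine (P B) <= e / 3.
  by rewrite -lee_fin fineK ?fin_num_measure// ltW.
have le2 : fine (P [set w | (N n w < K.+1)%N]) <= e / 3.
  by near: n; exact: near_small.
have le3 : F y - e / 3 <= fine (P [set w | (N n w < Num.truncn (n%:R * y))%N]).
  by near: n.
have : fine (P [set w | (N n w < Num.truncn (n%:R * y))%N]) <=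
    fine (P B) + fine (P [set w | (N n w < K.+1)%N]) + H n x.
  apply: probability_le3 => // w /= Nw.
  have [Bw|Bw] := pselect (B w); first by left; left.
  have [NK|NK] := ltnP (N n w) K.+1; first by left; right.
  right.
  have N0 : 0 < (N n w)%:R :> R by rewrite ltr0n; exact: leq_trans NK.
  have ny0 : 0 <= n%:R * y by rewrite mulr_ge0.
  have Ny : (N n w)%:R <= n%:R * y.
    by rewrite -truncn_ge_nat// ltnW.
  have := HK _ w (ltnW NK) Bw; rewrite ltr_norml => /andP[+ _].
  rewrite ltrNl opprB ltrD2r /mean ltr_pdivrMl// => /lt_le_trans; apply.
  by rewrite mulrA ler_pdivrMr// mulrAC ler_wpM2r// ltW.
move: le1 le2 le3; lra.
Unshelve. all: end_near. Qed.

Let cvg_H x : 0 <= x -> H n (c * x) @[n --> \oo] --> F x.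
Proof.
move=> x0; apply/cvgrPdist_le => e e0.
have e2 : 0 < e / 2 by rewrite divr_gt0.
have cx : c * x / c = x by rewrite mulrAC mulfV ?mul1r// gt_eqF.
have cx0 : 0 <= c * x by rewrite mulr_ge0// ltW.
have up : \forall n \near \oo, H n (c * x) <= F x + e.
  have [y xy Fy] := cdf_right_approx ig x0 e2.
  have xy' : c * x / c < y by rewrite cx.
  apply: filterS (near_le xy' cx0 e2) => n; move: Fy.
  rewrite /F /mu; lra.
have lo : \forall n \near \oo, F x - e <= H n (c * x).
  have [x1|x1] := ltP 0 x; last first.
    apply: nearW => n; have -> : x = 0 by apply/eqP; rewrite eq_le x1.
    by rewrite /F cdf0 sub0r (@le_trans _ _ 0) ?oppr_le0 ?fine_ge0// ltW.
  have [y /andP[y0 yx] Fy] := cdf_left_approx ig x1 e2.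
  have yx' : y < c * x / c by rewrite cx.
  apply: filterS (near_ge y0 yx' e2) => n; move: Fy.
  rewrite /F /mu; lra.
near=> n; rewrite ler_norml; apply/andP; split.
  rewrite lerBrDr addrC lerBlDr; near: n; exact: up.
rewrite lerBlDr -lerBlDl; near: n; exact: lo.
Unshelve. all: end_near. Qed.

Lemma gg_density_Rintegral_scale x :
  \int[mu]_(z in `[0, x]) gg_density r a (c `^ (- a)) z = F (x / c).
Proof.
have f0 z : (0 <= ((gg_density r a (c `^ (- a)) \_ `[0, x]) z)%:E)%E.
  by rewrite lee_fin patchE; case: ifPn => // _; exact: gg_density_ge0.
have mf : measurable_fun setT
    (fun z => ((gg_density r a (c `^ (- a)) \_ `[0, x]) z)%:E).
  apply/measurable_EFinP; apply/(measurable_restrictT _ _).1; first exact: measurable_itv.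
  by apply: measurable_funTS; exact: measurable_gg_density.
rewrite /F /Rintegral; congr fine.
transitivity (\int[mu]_z ((gg_density r a (c `^ (- a)) \_ `[0, x]) z)%:E)%E.
  by rewrite integral_mkcond; apply: eq_integral => z _; rewrite !patchE; case: ifPn.
transitivity (c%:E * \int[mu]_z
    ((gg_density r a (c `^ (- a)) \_ `[0, x]) (c * z + 0)%R)%:E)%E.
  exact: (ge0_integral_affine 0 c0 mf f0).
have mf' : measurable_fun setT
    (fun z : R => ((gg_density r a (c `^ (- a)) \_ `[0, x]) (c * z + 0)%R)%:E).
  by apply: (measurableT_comp mf); apply: measurable_funD => //; exact: mulrl_measurable.
transitivity (\int[mu]_z (c%:E *
    ((gg_density r a (c `^ (- a)) \_ `[0, x]) (c * z + 0)%R)%:E))%E.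
  by apply/esym; apply: (ge0_integralZl_EFin mu measurableT _ mf' (ltW c0)).
rewrite [RHS]integral_mkcond; apply: eq_integral => z _; rewrite !patchE addr0.
have -> : (c * z \in `[0, x]%classic) = (z \in `[0, x / c]%classic).
  apply/idP/idP; rewrite !inE/= !in_itv/=.
    by rewrite pmulr_rge0// ler_pdivlMr// mulrC.
  by rewrite pmulr_rge0// ler_pdivlMr// mulrC.
case: ifPn => _; last by rewrite mule0.
by rewrite gg_density_scale// -EFinM mulrA mulfV ?mul1r// gt_eqF.
Qed.

Lemma random_sum_uniform e : 0 < e -> \forall n \near \oo, forall x, 0 <= x ->
  `|fine (P [set w | rsum X (N n w) w < n%:R * x]) -
    \int[mu]_(z in `[0, x]) gg_density r a (c `^ (- a)) z| <= e.
Proof.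
move=> e0.
have ndH n : {homo (fun x => H n (c * x)) : x y / x <= y}.
  move=> x y xy; apply: fine_le; rewrite ?fin_num_measure//.
  apply: le_measure; rewrite ?inE// => w /= /lt_le_trans; apply.
  by rewrite ler_wpM2l// ler_wpM2l// ltW.
have H01 n x : 0 <= H n (c * x) <= 1.
  by rewrite fine_ge0//= -lee_fin fineK ?fin_num_measure// probability_le1.
have := polya_uniform_cvg g_ge0 g_neg ig g1 ndH H01 cvg_H e0.
apply: filterS => n Hn x x0; have xc : 0 <= x / c by rewrite divr_ge0// ltW.
rewrite gg_density_Rintegral_scale; have := Hn _ xc; rewrite /H.
by rewrite [c * _]mulrC divfK// gt_eqF.
Qed.

Lemma cvg_sup_random_sum :
  (fun n : nat =>
      sup [set `| fine (P [set w | rsum X (N n w) w < n%:R * x])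
                  - Rintegral mu `[0%R, x]%classic (gg_density r a (c `^ (- a))) |
           | x in [set x : R | 0 <= x]]) @ \oo --> 0.
Proof.
apply/cvgrPdist_le => e e0; near=> n.
have Hn : forall x, 0 <= x ->
  `|fine (P [set w | rsum X (N n w) w < n%:R * x]) -
    \int[mu]_(z in `[0, x]) gg_density r a (c `^ (- a)) z| <= e.
  by near: n; exact: random_sum_uniform.
set E := [set _ | _ in _].
have ubE : ubound E e by move=> _ [x x0 <-]; exact: Hn.
pose v := `|fine (P [set w | rsum X (N n w) w < n%:R * 0]) -
    \int[mu]_(z in `[0, 0]) gg_density r a (c `^ (- a)) z|.
have Ev : E v by exists 0 => //=.
rewrite distrC subr0 ger0_norm; first by apply: ge_sup => //; exists v.
apply: (@le_trans _ _ v); first exact: normr_ge0.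
by apply: ub_le_sup => //; exists e.
Unshelve. all: end_near. Qed.

End random_sum.

Theorem theorem5 (R : realType) (d : measure_display) (T : measurableType d)
  (P : probability T R) (X : nat -> T -> R) (c r a : R) (N : nat -> T -> nat) :
  (forall j, measurable_fun setT (X j)) ->
  (forall j w, 0 <= X j w) ->
  (forall j (B : set R), measurable B -> P (X j @^-1` B) = P (X 0%N @^-1` B)) ->
  mutual_indep P X ->
  0 < c ->
  {ae P, forall w, (fun n : nat => n%:R^-1 * \sum_(j < n) X j w) @ \oo --> c} ->
  0 < r -> a != 0 ->
  (forall n k, measurable [set w | N n w = k]) ->
  (forall n k, (0 < n)%N ->
     P [set w | N n w = k] =
     (((k`!)%:R^-1)%:E *
      \int[lebesgue_measure]_(z in `[0%R, +oo[)
         (expR (- z) * z ^+ k * gg_density r a (n%:R `^ (- a)) z)%:E)%E) ->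
  (forall n, (0 < n)%N -> mutual_indep P (fam_NX (N n) X)) ->
  ((fun n : nat =>
      sup [set `| fine (P [set w | rsum X (N n w) w < n%:R * x])
                  - Rintegral lebesgue_measure `[0%R, x]%classic
                      (gg_density r a (c `^ (- a))) |
           | x in [set x : R | 0 <= x]]) @ \oo --> 0)
  /\
  (r < 1 -> 0 < a -> a < 1 ->
   forall (d' : measure_display) (T' : measurableType d') (P' : probability T' R)
     (W S G1 G2 : T' -> R),
   measurable_fun setT W -> measurable_fun setT S ->
   measurable_fun setT G1 -> measurable_fun setT G2 ->
   mutual_indep P' (fam4 W S G1 G2) ->
   has_density P' W (@exp_density R) ->
   has_density P' G1 (gamma_density r) ->
   has_density P' G2 (gamma_density (1 - r)) ->
   (forall t : R,
      (\int[P']_w (cos (t * S w))%:E)%E =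
        (expR (- (`|t| `^ a * cos (pi * a / 2)))
         * cos (`|t| `^ a * Num.sg t * sin (pi * a / 2)))%:E /\
      (\int[P']_w (sin (t * S w))%:E)%E =
        (expR (- (`|t| `^ a * cos (pi * a / 2)))
         * sin (`|t| `^ a * Num.sg t * sin (pi * a / 2)))%:E) ->
   has_density P'
     (fun w => c * W w / (S w * ((G1 w + G2 w) / G1 w) `^ a^-1))
     (gg_density r a (c `^ (- a)))).
Proof.
move=> mX _ _ _ c0 lln _ _ mN N_law _; split.
  exact: (cvg_sup_random_sum mX c0 lln mN N_law).
move=> _ a0 a1 d' T' P' W S G1 G2 mW mS mG1 mG2 ind dW dG1 dG2 char_fun.
exact: (gg_mixed_exponential c0 a0 a1 mW mS mG1 mG2 ind dW dG1 dG2 char_fun).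
Qed.
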